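(* Fix a real number $p\ge 1$. For each positive integer $n$ let $G$ be a uniformly random labelled graph of order $n$ (equivalently, the random graph $G(n,1/2)$). Then, with probability tending to $1$ as $n\to\infty$, $$\|G\|_{S_p}=\begin{cases}\left(\dfrac{1}{\sqrt{\pi}}\cdot\dfrac{\Gamma(p/2+1/2)}{\Gamma(p/2+2)}+o(1)\right)^{1/p}n^{1/p+1/2} & \text{if } 1\le p<2,\\[2mm] \left(1/\sqrt{2}+o(1)\right)n & \text{if } p=2,\\[1mm] \left(1/2+o(1)\right)n & \text{if } p>2.\end{cases}$$
   Context: Graphs are finite, simple and undirected; the order of a graph is its number of vertices. For a graph $G$ of order $n$ with adjacency matrix $A$, let $\sigma_1(G)\ge\cdots\ge\sigma_n(G)$ be the singular values of $A$ (the absolute values of its eigenvalues), and for real $p\ge1$ let $\|G\|_{S_p}=\left(\sigma_1^p(G)+\cdots+\sigma_n^p(G)\right)^{1/p}$ be the Schatten $p$-norm. $\Gamma$ is the Gamma function. A statement ''with probability tending to $1$, $X_n=(c+o(1))^{1/p}f(n)$'' means: for every $\varepsilon>0$, the probability that $\left|(X_n/f(n))^p-c\right|<\varepsilon$ tends to $1$ as $n\to\infty$; ''$X_n=(c+o(1))f(n)$'' is understood in the same way without the $p$-th power. *)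

(* Defs.v *)
From HB Require Import structures.
From mathcomp Require Import all_boot all_order all_algebra.
From mathcomp Require Import polyrcf complex spectral sesquilinear.
From mathcomp Require Import all_classical all_reals all_analysis.

Set Implicit Arguments.
Unset Strict Implicit.
Unset Printing Implicit Defensive.

Import Order.TTheory GRing.Theory Num.Theory.
Import numFieldNormedType.Exports.

Local Open Scope classical_set_scope.
Local Open Scope ring_scope.

(* A graph is given by its set of edges, the edges being 2-element sets of
   vertices, so the type has exactly 2 ^ 'C(n, 2) elements. *)
Definition sgraph (n : nat) : finType :=
  {E : {set {set 'I_n}} | [forall e in E, #|e| == 2]}.

(* [set i; i] has one element, hence is never an edge. *)
Definition adjacent (n : nat) (G : sgraph n) : rel 'I_n :=
  fun i j => [set i; j]%SET \in val G.

Definition adjmx (R : nzRingType) (n : nat) (G : sgraph n) : 'M[R]_n :=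
  \matrix_(i, j) (adjacent G i j)%:R.

(* The real eigenvalues, each repeated according to its algebraic
   multiplicity; [eigenvalues_sym] shows that none is missed when A is
   symmetric. *)
Definition eigenvalues (R : rcfType) (n : nat) (A : 'M[R]_n) : seq R :=
  flatten [seq nseq (mup x (char_poly A)) x | x <- rootsR (char_poly A)].

Definition singular_values (R : rcfType) (n : nat) (G : sgraph n) : seq R :=
  sort >=%R [seq `|x| | x <- eigenvalues (adjmx R G)].

Definition schatten_norm (R : realType) (p : R) (n : nat) (G : sgraph n) : R :=
  (\sum_(s <- singular_values R G) s `^ p) `^ p^-1.

Definition Gamma (R : realType) (x : R) : R :=
  \int[lebesgue_measure]_(t in `]0, +oo[) (t `^ (x - 1) * expR (- t)).

Definition unif_prob (R : realType) (n : nat) (P : pred (sgraph n)) : R :=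
  #|P|%:R / #|sgraph n|%:R.

Definition whp (R : realType) (P : forall n, pred (sgraph n)) : Prop :=
  (fun n => unif_prob R (P n)) @ \oo --> (1 : R).

(* With probability tending to 1, X_n = (c + o(1)) f(n). *)
Definition whp_asymp (R : realType) (X : forall n, sgraph n -> R) (c : R)
    (f : nat -> R) : Prop :=
  forall e : R, 0 < e ->
    whp R (fun n => [pred G | `|X n G / f n - c| < e]).

(* With probability tending to 1, X_n = (c + o(1))^(1/p) f(n). *)
Definition whp_asymp_root (R : realType) (p : R) (X : forall n, sgraph n -> R)
    (c : R) (f : nat -> R) : Prop :=
  forall e : R, 0 < e ->
    whp R (fun n => [pred G | `|(X n G / f n) `^ p - c| < e]).

Lemma adjmx_sym (R : nzRingType) (n : nat) (G : sgraph n) :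
  (adjmx R G)^T = adjmx R G.
Proof. by apply/matrixP => i j; rewrite !mxE /adjacent finset.setUC. Qed.

Lemma eigenvalues_split (R : rcfType) (n : nat) (A : 'M[R]_n) (s : seq R) :
  char_poly A = \prod_(x <- s) ('X - x%:P) -> perm_eq (eigenvalues A) s.
Proof.
move=> As; apply/allP => /= y _; apply/eqP.
have q0 : char_poly A != 0 by rewrite monic_neq0 ?char_poly_monic.
have mus x : mup x (char_poly A) = count_mem x s by rewrite As mu_prod_XsubC.
rewrite count_flatten -map_comp sumnE big_map /= -mus.
under eq_bigr => x _ do rewrite count_nseq /=.
have uR : uniq (rootsR (char_poly A)) by exact: uniq_roots.
have [yr|yNr] := boolP (y \in rootsR (char_poly A)).
  rewrite (bigD1_seq y) //= eqxx mul1n big1 ?addn0 // => x xy.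
  by rewrite (negbTE xy) mul0n.
rewrite big1_seq; last first.
  move=> x /andP[_ xr]; have [xy|] := eqVneq x y; last by rewrite mul0n.
  by rewrite xy (negPf yNr) in xr.
apply/esym/eqP; rewrite -leqn0 -ltnS mup_ltn // expr1 dvdp_XsubCl.
by apply: contra yNr => yA; rewrite -roots_on_rootsR // inE.
Qed.

Lemma eigenvalues_sym (R : rcfType) (n : nat) (A : 'M[R]_n) :
  A^T = A -> char_poly A = \prod_(x <- eigenvalues A) ('X - x%:P).
Proof.
move=> Asym; pose B := map_mx (real_complex R) A.
have Bherm : B \is hermsymmx.
  apply: realsym_hermsym.
    by apply/is_hermitianmxP; rewrite expr0 scale1r map_mx_id // map_trmx Asym.
  by apply/mxOverP => i j; rewrite mxE; apply/complex_realP; exists (A i j).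
have /mxOverP dreal := hermitian_spectral_diag_real Bherm.
have /orthomx_spectralP Beq := hermitian_normalmx Bherm.
pose d i := complex.Re (spectral_diag B 0 i).
pose s := [seq d i | i <- enum 'I_n].
suff As : char_poly A = \prod_(x <- s) ('X - x%:P).
  by rewrite (perm_big _ (eigenvalues_split As)).
apply: (map_poly_inj (real_complex R)).
rewrite map_char_poly -/B rmorph_prod big_map big_enum /=.
set P := spectralmx B in Beq; have Pu : P \in unitmx := spectral_unit B.
have -> : char_poly B = char_poly (diag_mx (spectral_diag B)).
  rewrite /char_poly.
  have -> : char_poly_mx B = map_mx polyC (invmx P) *m
      char_poly_mx (diag_mx (spectral_diag B)) *m map_mx polyC P.
    rewrite /char_poly_mx mulmxBr mulmxBl -!map_mxM -Beq; congr (_ - _).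
    by rewrite scalar_mxC -mulmxA -map_mxM mulVmx // map_mx1 mulmx1.
  rewrite !det_mulmx mulrAC -det_mulmx -map_mxM mulVmx // map_mx1.
  by rewrite det1 mul1r.
rewrite char_poly_trig ?diag_mx_is_trig //; apply: eq_bigr => i _.
rewrite mxE eqxx mulr1n rmorphB /= map_polyX map_polyC /=; congr (_ - _%:P).
by have /complex_realP[x dE] := dreal 0 i; rewrite /d dE.
Qed.

(* Main.v *)
(* For p < 2, |x|^p is up to a constant the integral over t > 0 of
   t^(p-1) x^2 / (x^2 + t^2), so only the trace of the resolvent of A / sqrt n
   at the imaginary points z = i t is needed.  Discrete integration by parts,
   E[(A_ij - 1/2) f] = E[f(A_ij = 1) - f(A_ij = 0)] / 4, applied to the entries
   of the resolvent times a slowly varying function of the graph, shows that the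
   normalised trace m satisfies 1 + z m + m^2 / 4 -> 0 in mean square.  The
   matrix A need not be centred: the rank-one mean contributes the sum of all
   entries of the resolvent, which is O(n).  The limiting moment is evaluated by
   Tonelli's theorem, an explicit antiderivative for the transform of the
   semicircle law, and the relation between the Beta integral and Gamma.
   For p = 2 the norm is a function of the number of edges.  For p > 2 the top
   eigenvalue is at least n times the edge density, and the fourth moment of the
   spectrum exceeds the fourth power of this bound by only o(n^4), so that all
   other eigenvalues are o(n). *)

Require Import Defs.
From mathcomp Require Import all_boot all_order all_algebra.
From mathcomp Require Import polyrcf complex spectral sesquilinear.
From mathcomp Require Import all_classical all_reals all_analysis.
From mathcomp Require Import measurable_realfun ring lra.

Set Implicit Arguments.
Unset Strict Implicit.
Unset Printing Implicit Defensive.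

Import Order.TTheory GRing.Theory Num.Theory.
Import numFieldNormedType.Exports.

Local Open Scope classical_set_scope.
Local Open Scope ring_scope.

(** * Spectra of real symmetric matrices *)

(** At z = i t the resolvent has real part [resK] and imaginary part t [resS], both real symmetric,
    so after the spectral theorem the argument stays over the reals. The slowly varying test
    function in the integration by parts is the real or imaginary part of 1 + z m + m^2 / 4 itself;
    the expectation that comes out small is then a second moment, which replaces a separate
    concentration inequality for m. The 1/4 is the variance of an entry, so the limit law is the
    semicircle on [-1, 1]. On the imaginary axis the right root of the quadratic is singled out by
    the nonnegative trace of [resS], and the same sign makes the equation stable with constant 1.
    The integral of t^(p-1) / (1 + t^2), which links moments to transforms, occurs on both sides and
    is never evaluated. It is finite exactly for 0 < p < 2: in that range the single eigenvalue near
    n/2 is negligible against the bulk, from p = 2 on it is not. *)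

Lemma char_poly_conj (F : fieldType) (n : nat) (P D : 'M[F]_n) :
  P \in unitmx -> char_poly (invmx P *m D *m P) = char_poly D.
Proof.
move=> Pu; rewrite /char_poly.
have -> : char_poly_mx (invmx P *m D *m P) =
    map_mx polyC (invmx P) *m char_poly_mx D *m map_mx polyC P.
  rewrite /char_poly_mx mulmxBr mulmxBl -!map_mxM; congr (_ - _).
  by rewrite scalar_mxC -mulmxA -map_mxM mulVmx // map_mx1 mulmx1.
by rewrite !det_mulmx mulrAC -det_mulmx -map_mxM mulVmx // map_mx1 det1 mul1r.
Qed.

(** The diagonalisation takes place over [R[i]], but the diagonal is a real row: trace identities
    are computed in [R[i]] and pulled back along the injective embedding. *)
Lemma sym_diag (R : rcfType) (n : nat) (A : 'M[R]_n) : A^T = A ->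
  exists d : 'rV[R]_n, exists P : 'M[R[i]]_n,
  [/\ P \is unitarymx,
      map_mx (real_complex R) A =
        invmx P *m diag_mx (map_mx (real_complex R) d) *m P
    & perm_eq (eigenvalues A) [seq d 0 i | i <- enum 'I_n]].
Proof.
move=> Asym; pose B := map_mx (real_complex R) A.
have Bherm : B \is hermsymmx.
  apply: realsym_hermsym.
    by apply/is_hermitianmxP; rewrite expr0 scale1r map_mx_id // map_trmx Asym.
  by apply/mxOverP => i j; rewrite mxE; apply/complex_realP; exists (A i j).
have /mxOverP dreal := hermitian_spectral_diag_real Bherm.
have /orthomx_spectralP Beq := hermitian_normalmx Bherm.
pose d : 'rV[R]_n := \row_i complex.Re (spectral_diag B 0 i).
have dE : map_mx (real_complex R) d = spectral_diag B.
  apply/rowP => i; rewrite !mxE.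
  by have /complex_realP[x ->] := dreal 0 i.
exists d, (spectralmx B); split; rewrite ?spectral_unitarymx ?dE //.
apply: eigenvalues_split.
apply: (map_poly_inj (real_complex R)).
rewrite map_char_poly -/B rmorph_prod big_map big_enum /=.
rewrite Beq char_poly_conj ?spectral_unit //.
rewrite char_poly_trig ?diag_mx_is_trig //; apply: eq_bigr => i _.
by rewrite -dE !mxE eqxx mulr1n rmorphB /= map_polyX map_polyC.
Qed.

Lemma sum_eigenvalues_sqr (R : rcfType) (n : nat) (A : 'M[R]_n) : A^T = A ->
  \sum_(x <- eigenvalues A) x ^+ 2 = \tr (A *m A).
Proof.
move=> /sym_diag[d [P [/unitarymx_unit Pu AE /(perm_big _) ->]]].
apply: (@complexI R); rewrite -trace_map_mx map_mxM AE.
rewrite !mulmxA mulmxK // mxtrace_mulC !mulmxA (mulmxV Pu) mul1mx.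
rewrite mulmx_diag mxtrace_diag rmorph_sum big_map big_enum /=.
by apply: eq_bigr => i _; rewrite !mxE rmorphXn.
Qed.

Lemma sum_eigenvalues_exp4 (R : rcfType) (n : nat) (A : 'M[R]_n) : A^T = A ->
  \sum_(x <- eigenvalues A) x ^+ 4 = \tr (A *m A *m (A *m A)).
Proof.
move=> /sym_diag[d [P [/unitarymx_unit Pu AE /(perm_big _) ->]]].
apply: (@complexI R); rewrite -trace_map_mx !map_mxM AE.
rewrite !mulmxA !(mulmxK Pu) mxtrace_mulC !mulmxA mulmxV // mul1mx.
rewrite !mulmx_diag mxtrace_diag rmorph_sum big_map big_enum /=.
by apply: eq_bigr => i _; rewrite !mxE rmorphXn/= !exprS expr0 mulr1 !mulrA.
Qed.

(** Positive definiteness of A^2 + c replaces the complex resolvent. It is used with c = t^2 for the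
    scaled matrix and with c = n t^2 for the adjacency matrix itself. *)
Lemma sqr_add_unit_tr (R : rcfType) (n : nat) (A : 'M[R]_n) (c : R) :
  A^T = A -> 0 < c ->
  A *m A + c%:M \in unitmx /\
  \tr (invmx (A *m A + c%:M)) = \sum_(x <- eigenvalues A) (x ^+ 2 + c)^-1.
Proof.
move=> + c0 => /sym_diag[d [P [/unitarymx_unit Pu AE /(perm_big _) ->]]].
pose e := \row_i (d 0 i ^+ 2 + c).
have e0 i : e 0 i != 0 by rewrite mxE gt_eqF // ltr_wpDl // sqr_ge0.
pose f := \row_i (e 0 i)^-1.
have BE : map_mx (real_complex R) (A *m A + c%:M) =
    invmx P *m diag_mx (map_mx (real_complex R) e) *m P.
  rewrite map_mxD map_mxM AE map_scalar_mx /= !mulmxA (mulmxK Pu).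
  rewrite -(mulmxA (invmx P) (diag_mx _) (diag_mx _)) mulmx_diag ?mulmxA.
  have -> : (c%:C%C)%:M = invmx P *m (c%:C%C)%:M *m P.
    by rewrite scalar_mxC -mulmxA (mulVmx Pu) mulmx1.
  rewrite -mulmxDl -mulmxDr -diag_const_mx -linearD/=.
  set g := (X in diag_mx X); suff gE : g = map_mx (real_complex R) e by rewrite gE.
  by apply/rowP => i; rewrite !mxE rmorphD rmorphXn.
have Bu : A *m A + c%:M \in unitmx.
  rewrite -(map_unitmx (real_complex R)) BE !unitmx_mul Pu unitmx_inv Pu /= andbT.
  rewrite unitmxE det_diag unitfE prodf_seq_neq0; apply/allP => i _ /=.
  by rewrite mxE fmorph_eq0.
split=> //; apply: (@complexI R); rewrite -trace_map_mx map_invmx.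
have := Bu; rewrite -(map_unitmx (real_complex R)); set Y := map_mx _ _ => Yu.
pose X := invmx P *m diag_mx (map_mx (real_complex R) f) *m P.
have XY : X *m Y = 1%:M.
  rewrite /X [Y]BE !mulmxA (mulmxK Pu).
  rewrite -(mulmxA (invmx P) (diag_mx _) (diag_mx _)) mulmx_diag.
  rewrite [diag_mx _](_ : _ = 1%:M) ?mulmx1 ?mulVmx //.
  rewrite -diag_const_mx; congr diag_mx; apply/rowP => i.
  have := e0 i; rewrite !mxE => ei; rewrite -rmorphM /= mulVf // rmorph1.
have -> : invmx Y = X by rewrite -[RHS]mulmx1 -(mulmxV Yu) mulmxA XY mul1mx.
rewrite mxtrace_mulC !mulmxA mulmxV // mul1mx mxtrace_diag.
rewrite rmorph_sum big_map big_enum /=.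
by apply: eq_bigr => i _; rewrite !mxE.
Qed.

(** Rayleigh quotient of the all-ones vector. In the eigenbasis this vector is [w], its squared
    moduli [a] sum to n, and the sum of the entries of A is the [a]-weighted sum of the eigenvalues,
    hence at most n times the largest. *)
Lemma exists_eigenvalue_ge_mean (R : rcfType) (n : nat) (A : 'M[R]_n) :
  A^T = A -> (0 < n)%N ->
  exists2 x, x \in eigenvalues A & \sum_i \sum_j A i j <= n%:R * x.
Proof.
move=> /sym_diag[d [P [Pu AE /perm_mem dE]]] n0.
pose i0 := [arg max_(i > Ordinal n0) d 0 i]%O.
exists (d 0 i0); first by rewrite dE; apply: map_f; rewrite mem_enum.
have d_le i : d 0 i <= d 0 i0 by rewrite /i0; case: arg_maxP => //= j _; apply.
pose w : 'cV[R[i]]_n := P *m const_mx 1.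
have wE : map_mx Num.conj w^T = const_mx 1 *m invmx P.
  rewrite invmx_unitary // /w trmx_mul map_mxM; congr (_ *m _).
  by apply/matrixP => i j; rewrite !mxE rmorph1.
pose a i := complex.Re (w i 0 * (w i 0)^*).
have aE i : w i 0 * (w i 0)^* = (a i)%:C%C.
  by rewrite RRe_real // -normCK rpredX // normr_real.
have a0 i : 0 <= a i by rewrite -lecR -aE mul_conjC_ge0.
have sa : \sum_i a i = n%:R.
  apply: (@complexI R); rewrite rmorph_sum /=.
  transitivity ((map_mx Num.conj w^T *m w) 0 0).
    by rewrite mxE; apply: eq_bigr => i _; rewrite -aE !mxE mulrC.
  rewrite wE /w -mulmxA mulKmx ?unitarymx_unit // mxE.
  rewrite (eq_bigr (fun=> 1)); last by move=> i _; rewrite !mxE mulr1.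
  by rewrite sumr_const card_ord rmorph_nat.
have -> : \sum_i \sum_j A i j = \sum_i d 0 i * a i.
  apply: (@complexI R); rewrite !rmorph_sum /=.
  transitivity ((map_mx Num.conj w^T *m diag_mx (map_mx (real_complex R) d) *m w) 0 0).
    rewrite wE /w !mulmxA -(mulmxA _ (invmx P)) -(mulmxA _ _ P) -AE.
    rewrite -mulmxA mxE; apply: eq_bigr => i _; rewrite !mxE mul1r rmorph_sum.
    by apply: eq_bigr => j _; rewrite !mxE mulr1.
  rewrite mxE; apply: eq_bigr => i _; rewrite rmorphM /= -aE mul_mx_diag !mxE.
  by rewrite mulrAC mulrC [X in _ * X]mulrC.
by rewrite -sa mulr_suml ler_sum // => i _; rewrite mulrC ler_wpM2l.
Qed.

(** * Averages over labelled graphs *)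

Section Expectation.
Variables (R : realType) (n : nat).
Implicit Types (f g : sgraph n -> R) (G : sgraph n) (i j : 'I_n).

Definition expect f : R := (\sum_G f G) / #|sgraph n|%:R.

(** For i = j and b = true the candidate is not a graph and [insubd] falls back to [G], so no loop
    is ever created. *)
Definition put_edge i j (b : bool) G : sgraph n :=
  insubd G (if b then [set i; j]%SET |: val G else val G :\ [set i; j]%SET).

Lemma card_sgraph_gt0 : 0 < #|sgraph n|%:R :> R.
Proof.
have P0 : [forall e in (finset.set0 : {set {set 'I_n}}), #|e| == 2].
  by apply/forall_inP => e; rewrite inE.
by rewrite ltr0n; apply/card_gt0P; exists (exist _ finset.set0 P0).
Qed.

Lemma expect_cst (c : R) : expect (fun=> c) = c.
Proof.
by rewrite /expect sumr_const -[c *+ _]mulr_natr mulfK // gt_eqF // card_sgraph_gt0.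
Qed.

Lemma expectD f g : expect (fun G => f G + g G) = expect f + expect g.
Proof. by rewrite /expect big_split mulrDl. Qed.

Lemma expectZ c f : expect (fun G => c * f G) = c * expect f.
Proof. by rewrite /expect -mulr_sumr mulrA. Qed.

Lemma expectB f g : expect (fun G => f G - g G) = expect f - expect g.
Proof. by rewrite /expect sumrB mulrBl. Qed.

Lemma expect_sum (I : finType) (P : pred I) (F : I -> sgraph n -> R) :
  expect (fun G => \sum_(i | P i) F i G) = \sum_(i | P i) expect (F i).
Proof. by rewrite /expect exchange_big mulr_suml. Qed.

Lemma eq_expect f g : f =1 g -> expect f = expect g.
Proof. by move=> fg; rewrite /expect (eq_bigr _ (fun G _ => fg G)). Qed.

Lemma ler_expect f g : (forall G, f G <= g G) -> expect f <= expect g.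
Proof.
move=> fg; rewrite /expect ler_pM2r ?invr_gt0 ?card_sgraph_gt0 //.
by apply: ler_sum => G _; exact: fg.
Qed.

Lemma expect_ge0 f : (forall G, 0 <= f G) -> 0 <= expect f.
Proof. by move=> f0; rewrite -(expect_cst 0) ler_expect. Qed.

Lemma ler_norm_expect f : `|expect f| <= expect (fun G => `|f G|).
Proof.
rewrite /expect normrM [X in _ * X]ger0_norm ?invr_ge0 ?ler0n //.
by rewrite ler_pM2r ?invr_gt0 ?card_sgraph_gt0 // ler_norm_sum.
Qed.

(** Markov's inequality for the complement of [P], in the two-sided form that a squeeze consumes;
    [P] need only contain the event f < e. *)
Lemma expect_markov f (P : pred (sgraph n)) (e : R) : 0 < e ->
    (forall G, 0 <= f G) -> (forall G, f G < e -> P G) ->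
  1 - expect f / e <= unif_prob R P <= 1.
Proof.
move=> e0 f0 fP.
have -> : unif_prob R P = expect (fun G => (P G)%:R).
  rewrite /unif_prob -sum1_card natr_sum big_mkcond /expect; congr (_ / _).
  by apply: eq_bigr => G _; rewrite unfold_in; case: (P G).
apply/andP; split; last first.
  by rewrite -[leRHS](expect_cst 1) ler_expect // => G; rewrite lern1 leq_b1.
rewrite -[X in X - _](expect_cst 1) [X in _ - X]mulrC -expectZ -expectB.
apply: ler_expect => G; have [PG|nPG] := boolP (P G) => /=.
  by rewrite gerBl mulr_ge0 ?invr_ge0 // ltW.
rewrite subr_le0 mulrC ler_pdivlMr // mul1r leNgt.
by apply: contra nPG; exact: fP.
Qed.

Lemma val_put_edge i j b G : i != j -> val (put_edge i j b G) =
  if b then [set i; j]%SET |: val G else val G :\ [set i; j]%SET.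
Proof.
move=> ij; rewrite val_insubd ifT //; have /forall_inP GP := valP G.
apply/forall_inP => e; case: b; rewrite !inE.
  by case/orP => [/eqP ->|/GP //]; rewrite cards2 ij.
by case/andP => _ /GP.
Qed.

Lemma adjacent_put_edge i j b G k l : i != j ->
  Defs.adjacent (put_edge i j b G) k l =
    if [set k; l]%SET == [set i; j]%SET then b else Defs.adjacent G k l.
Proof.
move=> ij; rewrite /Defs.adjacent val_put_edge //.
by case: b; rewrite !inE; case: eqP.
Qed.

Lemma adjmx_put_edge i j b G k l : i != j ->
  [set k; l]%SET != [set i; j]%SET ->
  adjmx R (put_edge i j b G) k l = adjmx R G k l.
Proof. by move=> ij /negbTE kl; rewrite !mxE adjacent_put_edge // kl. Qed.

Lemma put_edge_id i j G : i != j -> put_edge i j (Defs.adjacent G i j) G = G.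
Proof.
move=> ij; apply/val_inj; rewrite val_put_edge // /Defs.adjacent.
case: ifPn => [e|e]; apply/finset.setP => x; rewrite !inE.
  by case: eqP => // ->.
by case: eqP => // ->; rewrite (negbTE e).
Qed.

Lemma put_edge_put i j b c G : i != j ->
  put_edge i j b (put_edge i j c G) = put_edge i j b G.
Proof.
move=> ij; apply/val_inj; rewrite !val_put_edge //.
by apply/finset.setP => x; case: b; case: c; rewrite !inE; case: eqP.
Qed.

Lemma set2_eqE i j k l : i != j ->
  ([set k; l]%SET == [set i; j]%SET) =
    (k == i) && (l == j) || (k == j) && (l == i).
Proof.
move=> ij; apply/eqP/idP => [E|/orP[]/andP[/eqP-> /eqP->]//]; last exact: finset.setUC.
have kij : k \in [set i; j]%SET by rewrite -E !inE eqxx.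
have lij : l \in [set i; j]%SET by rewrite -E !inE eqxx orbT.
have ikl : i \in [set k; l]%SET by rewrite E !inE eqxx.
have jkl : j \in [set k; l]%SET by rewrite E !inE eqxx orbT.
move: kij lij; rewrite !inE => /orP[]/eqP kE /orP[]/eqP lE; subst k l.
- by move: jkl; rewrite !inE orbb eq_sym (negbTE ij).
- by rewrite !eqxx.
- by rewrite !eqxx orbT.
- by move: ikl; rewrite !inE orbb (negbTE ij).
Qed.

Lemma adjmx_put_edgeB i j G : i != j ->
  adjmx R (put_edge i j true G) - adjmx R (put_edge i j false G) =
    delta_mx i j + delta_mx j i.
Proof.
move=> ij; apply/matrixP => k l; rewrite !mxE !adjacent_put_edge // set2_eqE //.
have ji : (j == i) = false by rewrite eq_sym (negbTE ij).
case: (k =P i) => [->|_]; case: (l =P j) => [->|_];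
  rewrite ?(negbTE ij) ?ji ?andbF /= ?subr0 ?subrr ?addr0 //.
by case: (_ && _); rewrite /= ?subr0 ?subrr ?add0r ?addr0.
Qed.

(** Given all other edges, A_ij - 1/2 equals 1/2 or -1/2 with equal chance. The conditioning is
    realised by averaging every graph with its image under [tau], the involution that toggles the
    edge. *)
Lemma expect_ibp i j f : i != j ->
  expect (fun G => (adjmx R G i j - 1 / 2) * f G) =
  1 / 4 * expect (fun G => f (put_edge i j true G) - f (put_edge i j false G)).
Proof.
move=> ij; pose tau G := put_edge i j (~~ Defs.adjacent G i j) G.
have adjtau G : Defs.adjacent (tau G) i j = ~~ Defs.adjacent G i j.
  by rewrite adjacent_put_edge // eqxx.
have tauK : involutive tau.
  by move=> G; rewrite {1}/tau adjtau negbK put_edge_put // put_edge_id.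
have two0 : (2 : R) != 0 by rewrite pnatr_eq0.
apply: (mulfI two0); rewrite -!expectZ.
transitivity (expect (fun G => (adjmx R G i j - 1 / 2) * f G) +
              expect (fun G => (adjmx R G i j - 1 / 2) * f G)).
  by rewrite -expectD; apply: eq_expect => G; ring.
rewrite {2}/expect (reindex_inj (inv_inj tauK)) -expectD.
apply: eq_expect => G /=; rewrite !mxE adjtau /tau.
by have := put_edge_id G ij; case: (Defs.adjacent G i j) => /= GE;
  rewrite {1}GE; field.
Qed.

End Expectation.

(** Convergence in mean gives convergence in probability. The inclusion is asked only for large n,
    so the degenerate order 0, where the normalisations divide by zero, is avoided. *)
Lemma whp_expect_cvg0 (R : realType) (X : forall n, sgraph n -> R)
    (P : forall n, pred (sgraph n)) (e : R) : 0 < e ->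
  (forall n G, 0 <= X n G) ->
  expect (X n) @[n --> \oo] --> (0 : R) ->
  (\forall n \near \oo, forall G : sgraph n, X n G < e -> P n G) ->
  whp R P.
Proof.
move=> e0 X0 EX XP.
have cvg1 : (1 - expect (X n) / e) @[n --> \oo] --> (1 : R).
  by rewrite -[X in _ --> X]subr0 -[X in 1 - X](mul0r e^-1);
     apply: cvgB; [exact: cvg_cst|apply: cvgMl].
rewrite /whp.
apply: (@squeeze_cvgr _ _ _ _ (fun n => 1 - expect (X n) / e) (fun=> 1)) => //;
  last exact: cvg_cst.
near=> n.
apply: expect_markov => //; near: n; exact: XP.
Unshelve. all: by end_near. Qed.

(** * The resolvent and its finite differences *)

Section OperatorNorm.
Variables (R : realType) (n : nat).
Implicit Types (X Y : 'M[R]_n) (v : 'cV[R]_n) (c : R).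

Definition normsq v : R := \sum_i v i 0 ^+ 2.

(** Spectral norm at most |c|, in squared form so that neither a supremum nor a square root
    appears. *)
Definition opnorm_le c X := forall v, normsq (X *m v) <= c ^+ 2 * normsq v.

Lemma normsq_ge0 v : 0 <= normsq v.
Proof. by apply: sumr_ge0 => i _; exact: sqr_ge0. Qed.

Lemma normsq_delta j : normsq (delta_mx j 0) = 1.
Proof.
rewrite /normsq (bigD1 j) //= big1 ?addr0 => [|i /negbTE ij].
  by rewrite mxE !eqxx expr1n.
by rewrite mxE ij expr0n.
Qed.

(** Cauchy-Schwarz against the constant vector, read off from the sum of squared deviations from the
    mean [m] being nonnegative. *)
Lemma sqr_sum_le (I : finType) (a : I -> R) :
  (\sum_i a i) ^+ 2 <= #|I|%:R * \sum_i a i ^+ 2.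
Proof.
have [I0|I0] := posnP #|I|.
  by rewrite I0 mul0r big_pred0 ?expr0n //; exact: card0_eq.
have N0 : 0 < #|I|%:R :> R by rewrite ltr0n.
pose m := (\sum_i a i) / #|I|%:R.
have : 0 <= \sum_i (a i - m) ^+ 2 by apply: sumr_ge0 => i _; exact: sqr_ge0.
rewrite (eq_bigr (fun i => a i ^+ 2 + (- 2 * m * a i + m ^+ 2))); last first.
  by move=> i _; ring.
rewrite !big_split /= sumr_const -mulr_sumr -[m ^+ 2 *+ _]mulr_natl.
have -> : \sum_i a i = #|I|%:R * m by rewrite /m mulrC divfK // gt_eqF.
set s := \sum_i _; move=> h; nra.
Qed.

Lemma opnorm_le_widen c d X : 0 <= c -> c <= d -> opnorm_le c X ->
  opnorm_le d X.
Proof.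
move=> c0 cd Xc v; apply: (le_trans (Xc v)).
by rewrite ler_wpM2r ?normsq_ge0 // lerXn2r // nnegrE // (le_trans c0).
Qed.

Lemma opnorm_le_col c X j : opnorm_le c X -> \sum_i X i j ^+ 2 <= c ^+ 2.
Proof.
move=> /(_ (delta_mx j 0)); rewrite normsq_delta mulr1 -colE.
by rewrite /normsq; under eq_bigr do rewrite mxE.
Qed.

Lemma opnorm_le_entry c X i j : 0 <= c -> opnorm_le c X -> `|X i j| <= c.
Proof.
move=> c0 /(opnorm_le_col j); rewrite (bigD1 i) //= => h.
rewrite -(ler_pXn2r (n := 2)) ?nnegrE // real_normK ?num_real //.
by apply: le_trans h; rewrite lerDl sumr_ge0 // => k _; exact: sqr_ge0.
Qed.

(** The sum is the quadratic form of X at the all-ones vector, whose squared norm is n. Entrywise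
    bounds would only give n^2, too weak to discard the mean of the adjacency matrix. *)
Lemma opnorm_le_sum c X : 0 <= c -> opnorm_le c X ->
  `|\sum_i \sum_j X i j| <= c * n%:R.
Proof.
move=> c0 /(_ (const_mx 1)); rewrite /normsq.
under [X in _ * X]eq_bigr do rewrite mxE expr1n.
rewrite sumr_const card_ord => h.
have E i : (X *m (const_mx 1 : 'cV_n)) i 0 = \sum_j X i j.
  by rewrite mxE; apply: eq_bigr => j _; rewrite mxE mulr1.
under eq_bigr => i _ do rewrite -E.
have := sqr_sum_le (fun i => (X *m (const_mx 1 : 'cV_n)) i 0).
rewrite card_ord => h2.
rewrite -(ler_pXn2r (n := 2)) ?nnegrE ?mulr_ge0 // real_normK ?num_real //.
rewrite (le_trans h2) // (_ : _ ^+ 2 = n%:R * (c ^+ 2 * n%:R)); last by ring.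
by rewrite ler_wpM2l.
Qed.

Lemma opnorm_leM c d X Y : opnorm_le c X -> opnorm_le d Y ->
  opnorm_le (c * d) (X *m Y).
Proof.
move=> Xc Yd v; rewrite -mulmxA (le_trans (Xc _)) //.
by rewrite exprMn -(mulrA (c ^+ 2)) ler_wpM2l ?sqr_ge0 //; exact: Yd.
Qed.

(** Each column has squared norm at most c^2, so the inner product of two columns is at most c^2 by
    the inequality between arithmetic and geometric means. *)
Lemma opnorm_le_sumM c X Y : opnorm_le c X -> opnorm_le c Y ->
  `|\sum_i \sum_j X i j * Y i j| <= c ^+ 2 * n%:R.
Proof.
move=> Xc Yc; rewrite exchange_big (le_trans (ler_norm_sum _ _ _)) //.
rewrite mulr_natr -[X in _ *+ X]card_ord -sumr_const; apply: ler_sum => j _.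
rewrite (le_trans (ler_norm_sum _ _ _)) //.
apply: (@le_trans _ _ (\sum_i (X i j ^+ 2 + Y i j ^+ 2) / 2)).
  apply: ler_sum => i _.
  have := sqr_ge0 (X i j - Y i j); have := sqr_ge0 (X i j + Y i j).
  by rewrite ler_norml => ? ?; apply/andP; split; nra.
rewrite -mulr_suml big_split /=.
have := opnorm_le_col j Xc; have := opnorm_le_col j Yc.
set a := \sum_i _; set b := \sum_i _; lra.
Qed.

End OperatorNorm.

(** * Real and imaginary parts of the resolvent on the imaginary axis *)

Section Resolvent.
Variables (R : realType) (n : nat) (t : R).
Hypothesis t0 : 0 < t.
Implicit Types (M : 'M[R]_n).

(* [resK M + i t resS M] is the resolvent of M at the point [i t]. *)
Definition resS M := invmx (M *m M + (t ^+ 2)%:M).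
Definition resK M := M *m resS M.

Section Single.
Variable M : 'M[R]_n.
Hypothesis Msym : M^T = M.

Lemma resS_unit : M *m M + (t ^+ 2)%:M \in unitmx.
Proof. by have [] := sqr_add_unit_tr Msym (exprn_gt0 2 t0). Qed.

Lemma resS_comm : M *m resS M = resS M *m M.
Proof.
have U := resS_unit; rewrite /resS; set Q := M *m M + _ in U *.
rewrite -[LHS]mul1mx -[X in X *m _](mulVmx U) -mulmxA; congr (_ *m _).
rewrite mulmxA (_ : Q *m M = M *m Q) ?mulmxK //.
by rewrite /Q mulmxDl mulmxDr mulmxA scalar_mxC.
Qed.

Lemma mulmx_resK : M *m resK M = 1%:M - t ^+ 2 *: resS M.
Proof.
rewrite /resK -[1%:M](mulmxV resS_unit) -/(resS M) mulmxDl mul_scalar_mx.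
by rewrite addrK mulmxA.
Qed.

Lemma resS_sym : (resS M)^T = resS M.
Proof.
rewrite /resS trmx_inv linearD /= trmx_mul Msym.
by rewrite tr_scalar_mx.
Qed.

Lemma resK_sym : (resK M)^T = resK M.
Proof. by rewrite /resK trmx_mul resS_sym Msym resS_comm. Qed.

(** Inserting M^2 + t^2 between two copies of S exhibits S as a sum of squares of symmetric
    matrices; positivity and all norm bounds come from this. *)
Lemma resSE : resS M = t ^+ 2 *: (resS M *m resS M) + resK M *m resK M.
Proof.
rewrite {1}/resK resS_comm -mulmxA mulmx_resK mulmxBr mulmx1 -scalemxAr.
by rewrite addrCA subrr addr0.
Qed.

Lemma trmx_mul_normsq (v : 'cV[R]_n) : (v^T *m v) 0 0 = normsq v.
Proof. by rewrite mxE; apply: eq_bigr => i _; rewrite mxE expr2. Qed.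

Lemma resS_quad v : (v^T *m (resS M *m v)) 0 0 =
  t ^+ 2 * normsq (resS M *m v) + normsq (resK M *m v).
Proof.
rewrite {1}resSE mulmxDl mulmxDr -!trmx_mul_normsq !(trmx_mul _ v) resS_sym resK_sym.
by rewrite -scalemxAl -scalemxAr mxE [X in X + _]mxE !mulmxA.
Qed.

(** This sign is what selects the root of the limiting quadratic in [graph_transform_le]. *)
Lemma resS_tr_ge0 : 0 <= \tr (resS M).
Proof.
apply: sumr_ge0 => i _; have := resS_quad (delta_mx i 0).
rewrite trmx_delta -rowE mxE -colE mxE => ->.
apply: addr_ge0; last exact: normsq_ge0.
by apply: mulr_ge0; [exact: sqr_ge0|exact: normsq_ge0].
Qed.

(** The quadratic form (v, S v) equals t^2 |S v|^2 + |K v|^2 and is at most half of t^-2 |v|^2 + t^2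
    |S v|^2; absorbing the last term on the left yields both bounds. *)
Lemma resS_resK_bound v :
  t ^+ 2 * normsq (resS M *m v) <= (t ^+ 2)^-1 * normsq v /\
  normsq (resK M *m v) <= (t ^+ 2)^-1 * normsq v.
Proof.
have q : (v^T *m (resS M *m v)) 0 0 <=
    ((t ^+ 2)^-1 * normsq v + t ^+ 2 * normsq (resS M *m v)) / 2.
  rewrite mxE /normsq !mulr_sumr -big_split /= mulr_suml.
  apply: ler_sum => i _; rewrite !mxE; set x := v i 0; set y := \sum_j _.
  have := sqr_ge0 (t^-1 * x - t * y); rewrite -exprVn.
  have tt : t^-1 * t = 1 by rewrite mulVf // gt_eqF.
  have -> : (t^-1 * x - t * y) ^+ 2 =
    t^-1 ^+ 2 * x ^+ 2 + t ^+ 2 * y ^+ 2 - 2 * (t^-1 * t) * (x * y) by ring.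
  by rewrite tt; lra.
have := resS_quad v; have := normsq_ge0 (resK M *m v).
have := normsq_ge0 v; have := normsq_ge0 (resS M *m v).
have : 0 <= (t ^+ 2)^-1 by rewrite invr_ge0 sqr_ge0.
have : 0 <= t ^+ 2 by rewrite sqr_ge0.
move: q; set y := (_ *m _) 0 0 => q a b c d e f.
have : 0 <= t ^+ 2 * normsq (resS M *m v) by rewrite mulr_ge0.
have : 0 <= (t ^+ 2)^-1 * normsq v by rewrite mulr_ge0.
by move=> g h; split; lra.
Qed.

Lemma resS_opnorm : opnorm_le ((t ^+ 2)^-1) (resS M).
Proof.
move=> v; have [h _] := resS_resK_bound v.
have t2 : 0 < t ^+ 2 by rewrite exprn_gt0.
by rewrite -(ler_pM2l t2) (le_trans h) // expr2 !mulrA mulfV ?gt_eqF // mul1r.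
Qed.

Lemma resK_opnorm : opnorm_le t^-1 (resK M).
Proof. by move=> v; have [_ h] := resS_resK_bound v; rewrite exprVn. Qed.

End Single.

Section Difference.
Variables M1 M2 : 'M[R]_n.
Hypotheses (M1sym : M1^T = M1) (M2sym : M2^T = M2).

Lemma mulmx_resK_l M : M^T = M -> resK M *m M = 1%:M - t ^+ 2 *: resS M.
Proof. by move=> Ms; rewrite {1}/resK -mulmxA -resS_comm // mulmx_resK. Qed.

Let one1 : 1%:M = resK M1 *m M1 + t ^+ 2 *: resS M1.
Proof. by rewrite mulmx_resK_l // subrK. Qed.

Let one2 : 1%:M = M2 *m resK M2 + t ^+ 2 *: resS M2.
Proof. by rewrite mulmx_resK // subrK. Qed.

Let S1M : resS M1 *m M1 = resK M1.
Proof. by rewrite -resS_comm. Qed.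

Let MS2 : M2 *m resS M2 = resK M2.
Proof. by []. Qed.

(** Real part of the resolvent identity R1 - R2 = - R1 (M1 - M2) R2 with R = K + i t S; [resSB] is
    the imaginary part divided by t. The proofs expand K1 and K2, respectively S1 and S2, with
    [one1] on one side and [one2] on the other. *)
Lemma resKB : resK M1 - resK M2 =
  t ^+ 2 *: (resS M1 *m (M1 - M2) *m resS M2) -
  resK M1 *m (M1 - M2) *m resK M2.
Proof.
rewrite -{1}[resK M1]mulmx1 -{1}[resK M2]mul1mx {1}one2 one1.
rewrite mulmxDr mulmxDl !mulmxBr !mulmxBl -!scalemxAl -!scalemxAr.
rewrite S1M -(mulmxA (resS M1)) MS2 !mulmxA scalerBr.
by rewrite opprD addrACA opprB addrC.
Qed.

Lemma resSB : resS M1 - resS M2 =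
  - (resS M1 *m (M1 - M2) *m resK M2) - resK M1 *m (M1 - M2) *m resS M2.
Proof.
rewrite -{1}[resS M1]mulmx1 -{1}[resS M2]mul1mx {1}one2 one1.
rewrite mulmxDr mulmxDl !mulmxBr !mulmxBl -!scalemxAl -!scalemxAr.
rewrite S1M -(mulmxA (resK M1) M2) MS2 !mulmxA.
by rewrite !opprB opprD addrACA subrr addr0 addrA subrK.
Qed.

End Difference.
End Resolvent.

Lemma mulmx_deltaE (R : comNzRingType) (n : nat) (P Q : 'M[R]_n)
    (i j k l : 'I_n) : (P *m delta_mx i j *m Q) k l = P k i * Q j l.
Proof.
rewrite mxE (bigD1 j) //= big1 ?addr0 => [|h /negbTE hj].
  congr (_ * _); rewrite mxE (bigD1 i) //= big1 ?addr0 => [|h /negbTE hi].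
    by rewrite mxE !eqxx mulr1.
  by rewrite mxE hi mulr0.
rewrite [X in X * _]mxE big1 ?mul0r // => m _.
by rewrite mxE hj andbF mulr0.
Qed.

Lemma mxtrace_mul_delta (R : comNzRingType) (n : nat) (P : 'M[R]_n)
    (i j : 'I_n) : \tr (P *m delta_mx i j) = P j i.
Proof.
rewrite /mxtrace (bigD1 j) //= -[P *m _]mulmx1 mulmx_deltaE mxE eqxx mulr1.
rewrite big1 ?addr0 // => k /negbTE kj.
by rewrite mulmx_deltaE mxE eq_sym kj mulr0.
Qed.

(** * Effect of a single edge on the resolvent *)

Section RankTwo.
Variables (R : realType) (n : nat) (t c r : R) (M M1 M2 : 'M[R]_n).
Variables (i j : 'I_n).
Hypotheses (t0 : 0 < t) (c1 : 1 <= c).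
Hypotheses (ct1 : t^-1 <= c) (ct2 : (t ^+ 2)^-1 <= c) (ct : t ^+ 2 <= c).
Hypotheses (M1sym : M1^T = M1) (M2sym : M2^T = M2).
Hypotheses (r0 : 0 <= r) (MM : M = M1 \/ M = M2).
Hypothesis M12 : M1 - M2 = r *: (delta_mx i j + delta_mx j i).

Lemma resS_opnorm_le (N : 'M[R]_n) : N^T = N -> opnorm_le c (resS t N).
Proof.
move=> Ns; apply: opnorm_le_widen (resS_opnorm t0 Ns) => //.
by rewrite invr_ge0 sqr_ge0.
Qed.

Lemma resK_opnorm_le (N : 'M[R]_n) : N^T = N -> opnorm_le c (resK t N).
Proof.
move=> Ns; apply: opnorm_le_widen (resK_opnorm t0 Ns) => //.
by rewrite invr_ge0 ltW.
Qed.

Let c0 : 0 <= c. Proof. exact: le_trans ler01 c1. Qed.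

Let DE (P Q : 'M[R]_n) k l : (P *m (M1 - M2) *m Q) k l =
  r * (P k i * Q j l + P k j * Q i l).
Proof.
rewrite M12 -scalemxAr -scalemxAl mulmxDr mulmxDl mxE [X in _ * X]mxE.
by rewrite !mulmx_deltaE.
Qed.

Let Dbound (P Q : 'M[R]_n) k l : opnorm_le c P -> opnorm_le c Q ->
  `|(P *m (M1 - M2) *m Q) k l| <= r * (2 * c ^+ 2).
Proof.
move=> Pc Qc; rewrite DE normrM (ger0_norm r0) ler_wpM2l //.
rewrite (le_trans (ler_normD _ _)) // !normrM mulrDl mul1r expr2.
by apply: lerD; apply: ler_pM; rewrite ?normr_ge0 // opnorm_le_entry.
Qed.

(** By cyclicity the trace is r times two entries of Q P, hence bounded independently of n. After
    normalisation by r^2 = 1/n one edge therefore moves the traces only by order r^3. *)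
Let trbound (P Q : 'M[R]_n) : opnorm_le c P -> opnorm_le c Q ->
  `|\tr (P *m (M1 - M2) *m Q)| <= r * (2 * c ^+ 2).
Proof.
move=> Pc Qc; rewrite mxtrace_mulC mulmxA M12 -scalemxAr mxtraceZ mulmxDr.
rewrite mxtraceD !mxtrace_mul_delta normrM (ger0_norm r0) ler_wpM2l //.
rewrite (le_trans (ler_normD _ _)) // mulrDl mul1r.
by apply: lerD; apply: opnorm_le_entry; rewrite ?sqr_ge0 //; apply: opnorm_leM.
Qed.

(** The single constant [c] dominates 1, t^-1, t^-2 and t^2, so every error becomes a monomial in c
    and r. Here t^2 <= c raises 2 c^2 to 2 c^3, and c^2 <= c^3 treats the other term. *)
Let comb (x y : R) : `|x| <= r * (2 * c ^+ 2) -> `|y| <= r * (2 * c ^+ 2) ->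
  `|t ^+ 2 * x - y| <= 4 * c ^+ 3 * r /\ `|- x - y| <= 4 * c ^+ 3 * r.
Proof.
move=> hx hy; have t2 : 0 <= t ^+ 2 by rewrite sqr_ge0.
have cc : c ^+ 2 <= c ^+ 3 by rewrite [leRHS]exprS ler_peMl // exprn_ge0.
have rc : 0 <= r * c ^+ 2 by rewrite mulr_ge0 // exprn_ge0.
have rc3 : r * c ^+ 2 <= r * c ^+ 3 by rewrite ler_wpM2l.
split.
  rewrite (le_trans (ler_normB _ _)) // normrM (ger0_norm t2).
  have : t ^+ 2 * `|x| <= c * (r * (2 * c ^+ 2)) by apply: ler_pM.
  rewrite (_ : c * _ = 2 * (r * c ^+ 3)); last by ring.
  by rewrite (_ : 4 * _ * _ = 4 * (r * c ^+ 3)); [lra|ring].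
rewrite (le_trans (ler_normB _ _)) // normrN.
by rewrite (_ : 4 * _ * _ = 4 * (r * c ^+ 3)); [lra|ring].
Qed.

Lemma resK_entryB k l :
  `|resK t M1 k l - resK t M2 k l| <= 4 * c ^+ 3 * r.
Proof.
have -> : resK t M1 k l - resK t M2 k l = (resK t M1 - resK t M2) k l.
  by rewrite !mxE.
rewrite resKB // mxE [X in X + _]mxE [X in _ + X]mxE.
by apply comb; apply: Dbound; (exact: resS_opnorm_le || exact: resK_opnorm_le).
Qed.

Lemma resS_entryB k l :
  `|resS t M1 k l - resS t M2 k l| <= 4 * c ^+ 3 * r.
Proof.
have -> : resS t M1 k l - resS t M2 k l = (resS t M1 - resS t M2) k l.
  by rewrite [RHS]mxE [in RHS]mxE.
rewrite resSB // mxE [X in X + _]mxE [X in _ + X]mxE.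
by apply comb; apply: Dbound; (exact: resS_opnorm_le || exact: resK_opnorm_le).
Qed.

Lemma resK_trB : `|\tr (resK t M1) - \tr (resK t M2)| <= 4 * c ^+ 3 * r.
Proof.
rewrite -raddfB /= resKB // raddfB /= mxtraceZ.
by apply comb; apply: trbound; (exact: resS_opnorm_le || exact: resK_opnorm_le).
Qed.

Lemma resS_trB : `|\tr (resS t M1) - \tr (resS t M2)| <= 4 * c ^+ 3 * r.
Proof.
rewrite -raddfB /= resSB // raddfB /= raddfN.
by apply comb; apply: trbound; (exact: resS_opnorm_le || exact: resK_opnorm_le).
Qed.

(** The (i, j) entry of P (E_ij + E_ji) Q: the first-order effect of the edge ij on the entry at
    that same place. *)
Definition bilin (P Q : 'M[R]_n) : R := P i i * Q j j + P i j * Q i j.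

(** The exact identity mixes M1 and M2, while summation over i and j into traces requires
    coefficients that depend on one matrix only. Replacing both by M, whichever of the two belongs
    to the graph at hand, costs a further factor r. *)
Let bilin_bound (f g : 'M[R]_n -> 'M[R]_n) :
  (forall N, N^T = N -> opnorm_le c (f N)) ->
  (forall N, N^T = N -> opnorm_le c (g N)) ->
  (forall k l, `|f M1 k l - f M2 k l| <= 4 * c ^+ 3 * r) ->
  (forall k l, `|g M1 k l - g M2 k l| <= 4 * c ^+ 3 * r) ->
  `|(f M1 *m (M1 - M2) *m g M2) i j - r * bilin (f M) (g M)| <=
  16 * c ^+ 4 * r ^+ 2.
Proof.
move=> fc gc fB gB.
have Ms : M^T = M by case: MM => ->.
have fd k l : `|f M1 k l - f M k l| <= 4 * c ^+ 3 * r.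
  by case: MM => ->; rewrite ?subrr ?normr0 ?fB // !mulr_ge0 // exprn_ge0.
have gd k l : `|g M2 k l - g M k l| <= 4 * c ^+ 3 * r.
  case: MM => ->; rewrite ?subrr ?normr0 ?mulr_ge0 // ?exprn_ge0 //.
  by rewrite distrC.
rewrite DE -mulrBr normrM (ger0_norm r0) /bilin.
have prod k l k' l' :
    `|f M1 k l * g M2 k' l' - f M k l * g M k' l'| <= 8 * c ^+ 4 * r.
  rewrite (_ : _ - _ = (f M1 k l - f M k l) * g M2 k' l' +
    f M k l * (g M2 k' l' - g M k' l')); last by ring.
  rewrite (le_trans (ler_normD _ _)) // !normrM.
  have g2 := opnorm_le_entry k' l' c0 (gc _ M2sym).
  have f2 := opnorm_le_entry k l c0 (fc _ Ms).
  have h1 := ler_pM (normr_ge0 _) (normr_ge0 _) (fd k l) g2.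
  have h2 := ler_pM (normr_ge0 _) (normr_ge0 _) f2 (gd k' l').
  rewrite (_ : 8 * _ * _ = 4 * c ^+ 3 * r * c + c * (4 * c ^+ 3 * r)).
    exact: lerD.
  ring.
rewrite (_ : 16 * _ * _ = r * (8 * c ^+ 4 * r + 8 * c ^+ 4 * r)); last by ring.
rewrite ler_wpM2l // opprD addrACA (le_trans (ler_normD _ _)) //.
by rewrite lerD.
Qed.

Let SS := bilin_bound resS_opnorm_le resS_opnorm_le resS_entryB resS_entryB.
Let KK := bilin_bound resK_opnorm_le resK_opnorm_le resK_entryB resK_entryB.
Let SK := bilin_bound resS_opnorm_le resK_opnorm_le resS_entryB resK_entryB.
Let KS := bilin_bound resK_opnorm_le resS_opnorm_le resK_entryB resS_entryB.

Let c45 : c ^+ 4 * r ^+ 2 <= c ^+ 5 * r ^+ 2.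
Proof.
rewrite ler_wpM2r ?sqr_ge0 //.
by rewrite [leRHS]exprS ler_peMl // exprn_ge0.
Qed.

Lemma resK_entryB2 :
  `|resK t M1 i j - resK t M2 i j -
    r * (t ^+ 2 * bilin (resS t M) (resS t M) - bilin (resK t M) (resK t M))|
  <= 32 * c ^+ 5 * r ^+ 2.
Proof.
have -> : resK t M1 i j - resK t M2 i j = (resK t M1 - resK t M2) i j.
  by rewrite !mxE.
rewrite resKB // mxE [X in X + _ - _]mxE [X in _ + X - _]mxE.
rewrite (_ : _ - _ = t ^+ 2 * ((resS t M1 *m (M1 - M2) *m resS t M2) i j -
    r * bilin (resS t M) (resS t M)) -
  ((resK t M1 *m (M1 - M2) *m resK t M2) i j -
    r * bilin (resK t M) (resK t M))); last by ring.
rewrite (le_trans (ler_normB _ _)) // normrM ger0_norm ?sqr_ge0 //.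
have h := ler_pM (sqr_ge0 t) (normr_ge0 _) ct SS.
have := lerD h KK; rewrite (_ : c * _ = 16 * (c ^+ 5 * r ^+ 2)); last by ring.
rewrite -!(mulrA _ (c ^+ _)) => h2; apply: (le_trans h2).
by have := c45; lra.
Qed.

Lemma resS_entryB2 :
  `|resS t M1 i j - resS t M2 i j -
    r * (- bilin (resS t M) (resK t M) - bilin (resK t M) (resS t M))|
  <= 32 * c ^+ 5 * r ^+ 2.
Proof.
have -> : resS t M1 i j - resS t M2 i j = (resS t M1 - resS t M2) i j.
  by rewrite [RHS]mxE [in RHS]mxE.
rewrite resSB // mxE [X in X + _ - _]mxE [X in _ + X - _]mxE.
rewrite (_ : _ - _ = - ((resS t M1 *m (M1 - M2) *m resK t M2) i j -
    r * bilin (resS t M) (resK t M)) -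
  ((resK t M1 *m (M1 - M2) *m resS t M2) i j -
    r * bilin (resK t M) (resS t M))); last by ring.
rewrite (le_trans (ler_normB _ _)) // normrN.
have := lerD SK KS; rewrite -!(mulrA _ (c ^+ _)) => h2; apply: (le_trans h2).
by have := c45; lra.
Qed.

End RankTwo.

Section BilinSum.
Variables (R : realType) (n : nat) (c : R) (P Q : 'M[R]_n).
Hypotheses (c0 : 0 <= c) (Pc : opnorm_le c P) (Qc : opnorm_le c Q).

(** The product of traces, of order n^2, is the main term. The error 3 consists of 1 for the sum of
    P_ij Q_ij and 2 for the diagonal, where both terms of [bilin] coincide. *)
Lemma sum_bilin :
  `|\sum_i \sum_(j | j != i) bilin i j P Q - \tr P * \tr Q| <=
  3 * c ^+ 2 * n%:R.
Proof.
have -> : \sum_i \sum_(j | j != i) bilin i j P Q =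
    \sum_i \sum_j bilin i j P Q - \sum_i 2 * (P i i * Q i i).
  rewrite -sumrB; apply: eq_bigr => i _; rewrite [in RHS](bigD1 i) //=.
  by rewrite /bilin; ring.
have -> : \sum_i \sum_j bilin i j P Q =
    \tr P * \tr Q + \sum_i \sum_j P i j * Q i j.
  rewrite mulr_suml -big_split /=; apply: eq_bigr => i _.
  by rewrite mulr_sumr -big_split.
rewrite (_ : _ - _ = \sum_i \sum_j P i j * Q i j -
  \sum_i 2 * (P i i * Q i i)); last by ring.
rewrite (le_trans (ler_normB _ _)) //.
rewrite (_ : 3 * _ * _ = c ^+ 2 * n%:R + 2 * c ^+ 2 * n%:R); last by ring.
apply: lerD; first exact: opnorm_le_sumM.
rewrite (le_trans (ler_norm_sum _ _ _)) //.
rewrite (_ : 2 * _ * _ = \sum_(i < n) 2 * c ^+ 2); last first.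
  by rewrite sumr_const card_ord mulr_natr.
apply: ler_sum => i _; rewrite normrM ger0_norm // ler_wpM2l // normrM expr2.
by apply: ler_pM; rewrite ?normr_ge0 // opnorm_le_entry.
Qed.
End BilinSum.

(** * The self-consistent equation *)

Section Core.
Variables (R : realType) (n : nat) (r : R).
Hypotheses (r0 : 0 < r) (r1 : r <= 1) (rn : r ^+ 2 * n%:R = 1).
Implicit Types (G : sgraph n) (i j : 'I_n).

Let Gp i j G := put_edge i j true G.
Let Gm i j G := put_edge i j false G.

Section Ibp.
Variables (a b : R) (X : sgraph n -> 'M[R]_n).
Variables (L : sgraph n -> 'I_n -> 'I_n -> R) (ell Y : sgraph n -> R).
Hypotheses (a0 : 0 <= a) (b0 : 0 <= b).
Hypothesis (Xa : forall G i j, `|X G i j| <= a).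
Hypothesis (Xsum : forall G, `|\sum_i \sum_j X G i j| <= a * n%:R).
Hypothesis (Yb : forall G, `|Y G| <= b).
Hypothesis (Yd : forall G i j, i != j ->
  `|Y (Gp i j G) - Y (Gm i j G)| <= b * r ^+ 3).
Hypothesis (Xd : forall G i j, i != j ->
  `|X (Gp i j G) i j - X (Gm i j G) i j - r * L G i j| <= a * r ^+ 2).
Hypothesis (Lsum : forall G,
  `|\sum_i \sum_(j | j != i) L G i j - ell G| <= a * n%:R).

Let D i j G := X (Gp i j G) i j * Y (Gp i j G) - X (Gm i j G) i j * Y (Gm i j G).

Let XoffE G : \sum_i \sum_(j | j != i) X G i j =
  \sum_i \sum_j X G i j - \sum_i X G i i.
Proof.
rewrite -sumrB; apply: eq_bigr => i _.
by rewrite [in RHS](bigD1 i) //= addrAC subrr add0r.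
Qed.

Let Xoff G : `|\sum_i \sum_(j | j != i) X G i j| <= 2 * a * n%:R.
Proof.
rewrite XoffE (le_trans (ler_normB _ _)) // -mulrA mulrDl mul1r lerD //.
rewrite (le_trans (ler_norm_sum _ _ _)) //.
rewrite (_ : a * _ = \sum_(i < n) a); first exact: ler_sum.
by rewrite sumr_const card_ord mulr_natr.
Qed.

(** Discrete product rule. [G] equals one of its two modifications, and the product is split so that
    [Y] is evaluated at that one. The constant 4 is chosen to cancel the 1/4 of the integration by
    parts. *)
Let Dbound G i j : i != j -> `|D i j G - r * L G i j * Y G| <= 4 * a * b * r ^+ 2.
Proof.
move=> ij; have [-> | ->] : Y G = Y (Gp i j G) \/ Y G = Y (Gm i j G).
- rewrite /Gp /Gm -{1 3}(put_edge_id G ij).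
  by case: (Defs.adjacent G i j); [left|right].
- rewrite (_ : D i j G - _ = (X (Gp i j G) i j - X (Gm i j G) i j -
    r * L G i j) * Y (Gp i j G) +
    X (Gm i j G) i j * (Y (Gp i j G) - Y (Gm i j G))); last by rewrite /D; ring.
  rewrite (le_trans (ler_normD _ _)) // !normrM.
  have h1 := ler_pM (normr_ge0 _) (normr_ge0 _) (Xd G ij) (Yb (Gp i j G)).
  have h2 := ler_pM (normr_ge0 _) (normr_ge0 _) (Xa (Gm i j G) i j) (Yd G ij).
  have abr : 0 <= a * b * r ^+ 2.
  by rewrite mulr_ge0 ?sqr_ge0 // mulr_ge0.
  have r32 : a * b * r ^+ 2 * r <= a * b * r ^+ 2 by rewrite ler_piMr.
  nra.
rewrite (_ : D i j G - _ = (X (Gp i j G) i j - X (Gm i j G) i j -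
    r * L G i j) * Y (Gm i j G) +
    X (Gp i j G) i j * (Y (Gp i j G) - Y (Gm i j G))); last by rewrite /D; ring.
rewrite (le_trans (ler_normD _ _)) // !normrM.
have h1 := ler_pM (normr_ge0 _) (normr_ge0 _) (Xd G ij) (Yb (Gm i j G)).
have h2 := ler_pM (normr_ge0 _) (normr_ge0 _) (Xa (Gp i j G) i j) (Yd G ij).
have abr : 0 <= a * b * r ^+ 2.
  by rewrite mulr_ge0 ?sqr_ge0 // mulr_ge0.
have r32 : a * b * r ^+ 2 * r <= a * b * r ^+ 2 by rewrite ler_piMr.
nra.
Qed.

(** What remains under the expectation after integration by parts: the first summand comes from the
    centred entries A_ij - 1/2, the sum of the X_ij carries their mean 1/2. *)
Let Z G := r ^+ 3 / 4 * \sum_i \sum_(j | j != i) D i j G +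
  Y G * (r ^+ 3 / 2 * \sum_i \sum_(j | j != i) X G i j - r ^+ 4 * ell G / 4).

Let Zbound G : `|Z G| <= 3 * a * b * r.
Proof.
have abr : 0 <= a * b * r by rewrite !mulr_ge0 // ltW.
rewrite (_ : Z G = r ^+ 3 / 4 * \sum_i \sum_(j | j != i)
    (D i j G - r * L G i j * Y G) +
  Y G * (r ^+ 4 / 4) * (\sum_i \sum_(j | j != i) L G i j - ell G) +
  Y G * (r ^+ 3 / 2) * (\sum_i \sum_(j | j != i) X G i j)); last first.
  under eq_bigr do rewrite sumrB -mulr_suml -mulr_sumr.
  by rewrite sumrB -mulr_suml -mulr_sumr /Z; field.
rewrite (_ : 3 * a * b * r = a * b * r + a * b * r + a * b * r); last by ring.
have rge0 k : 0 <= r ^+ k by rewrite exprn_ge0 // ltW.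
rewrite (le_trans (ler_normD _ _)) // lerD //.
  rewrite (le_trans (ler_normD _ _)) // lerD //.
    rewrite normrM ger0_norm ?divr_ge0 //.
    rewrite [leRHS](_ : _ = r ^+ 3 / 4 * (n%:R * (n%:R * (4 * a * b * r ^+ 2)))).
      rewrite ler_wpM2l ?divr_ge0 //.
      rewrite (le_trans (ler_norm_sum _ _ _)) //.
      rewrite mulr_natl -[X in _ *+ X]card_ord -sumr_const.
      apply: ler_sum => i _; rewrite (le_trans (ler_norm_sum _ _ _)) //.
      rewrite mulr_natl -[X in _ *+ X]card_ord -sumr_const big_mkcond /=.
      apply: ler_sum => j _; case: eqVneq => /= [_|ij].
        by rewrite mulr_ge0 ?sqr_ge0 // !mulr_ge0.
      by apply: Dbound; rewrite eq_sym.
    transitivity (a * b * r * (r ^+ 2 * n%:R) ^+ 2); last by field.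
    by rewrite rn expr1n mulr1.
  have := ler_pM (normr_ge0 _) (normr_ge0 _) (Yb G) (Lsum G).
  rewrite -normrM => h; have q0 : 0 <= r ^+ 4 / 4 by rewrite divr_ge0.
  rewrite mulrAC mulrC normrM (ger0_norm q0).
  rewrite (le_trans (ler_wpM2l q0 h)) //.
  rewrite [leLHS](_ : _ = a * b * r * r * (r ^+ 2 * n%:R) / 4); last by field.
  rewrite rn mulr1.
  have : a * b * r * r <= a * b * r by rewrite ler_piMr.
  lra.
have := ler_pM (normr_ge0 _) (normr_ge0 _) (Yb G) (Xoff G).
rewrite -normrM => h; have q0 : 0 <= r ^+ 3 / 2 by rewrite divr_ge0.
rewrite mulrAC mulrC normrM (ger0_norm q0).
rewrite (le_trans (ler_wpM2l q0 h)) //.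
rewrite [leLHS](_ : _ = a * b * r * (r ^+ 2 * n%:R)); last by field.
by rewrite rn mulr1.
Qed.

(** Three errors of at most a b r each: n^2 differences, each off by order r^2 and weighted by r^3;
    the replacement of the sum of [L] by [ell]; and the mean of the matrix, bounded through the sum
    of all entries of X. All three use r^2 n = 1. *)
Lemma expect_ibp_approx : `|expect (fun G => Y G *
    (r ^+ 2 * (\sum_i \sum_j (r *: adjmx R G) i j * X G i j) -
     r ^+ 4 * ell G / 4))| <= 3 * a * b * r.
Proof.
have -> : expect (fun G => Y G *
    (r ^+ 2 * (\sum_i \sum_j (r *: adjmx R G) i j * X G i j) -
     r ^+ 4 * ell G / 4)) = expect Z.
  rewrite /Z expectD expectZ expect_sum.
  under [X in _ * X + _]eq_bigr => i _ do rewrite expect_sum.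
  transitivity (r ^+ 3 * \sum_i \sum_(j | j != i)
      expect (fun G => (adjmx R G i j - 1 / 2) * (X G i j * Y G)) +
    expect (fun G => Y G * (r ^+ 3 / 2 * \sum_i \sum_(j | j != i) X G i j -
      r ^+ 4 * ell G / 4))); last first.
    congr (_ + _); rewrite -[r ^+ 3 / 4 * _]mulrA; congr (_ * _).
    rewrite mulr_sumr; apply: eq_bigr => i _; rewrite mulr_sumr.
    by apply: eq_bigr => j ij; rewrite expect_ibp 1?eq_sym // div1r.
  under [X in _ * X + _]eq_bigr => i _ do rewrite -expect_sum.
  rewrite -expect_sum -expectZ -expectD; apply: eq_expect => G.
  have -> : \sum_i \sum_j (r *: adjmx R G) i j * X G i j =
      r * \sum_i \sum_(j | j != i) adjmx R G i j * X G i j.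
    rewrite mulr_sumr; apply: eq_bigr => i _; rewrite (bigD1 i) //= !mxE.
    rewrite /Defs.adjacent (_ : [set i; i]%SET \in val G = false) ?mulr0 ?mul0r.
      by rewrite add0r mulr_sumr; apply: eq_bigr => j _; rewrite !mxE mulrA.
    apply/negP => iG; have /forall_inP/(_ _ iG) := valP G.
    by rewrite finset.setUid cards1.
  have -> : \sum_i \sum_(j | j != i) (adjmx R G i j - 1 / 2) * (X G i j * Y G) =
      Y G * (\sum_i \sum_(j | j != i) adjmx R G i j * X G i j -
        1 / 2 * \sum_i \sum_(j | j != i) X G i j).
    rewrite mulr_sumr -sumrB mulr_sumr; apply: eq_bigr => i _.
    rewrite mulr_sumr -sumrB mulr_sumr; apply: eq_bigr => j _; ring.
  by field.
rewrite (le_trans (ler_norm_expect _)) // -[leRHS](expect_cst n).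
exact: ler_expect.
Qed.

End Ibp.
End Core.

Section SelfConsistent.
Variables (R : realType) (n : nat) (r t c : R).
Hypotheses (r0 : 0 < r) (r1 : r <= 1) (rn : r ^+ 2 * n%:R = 1).
Hypotheses (t0 : 0 < t) (c1 : 1 <= c).
Hypotheses (ct1 : t^-1 <= c) (ct2 : (t ^+ 2)^-1 <= c) (ct : t ^+ 2 <= c).
Implicit Types (G : sgraph n) (i j : 'I_n).

Let M G := r *: adjmx R G.
Let S G := resS t (M G).
Let K G := resK t (M G).
Let s G := r ^+ 2 * \tr (S G).
Let k G := r ^+ 2 * \tr (K G).

Let c0 : 0 <= c. Proof. exact: le_trans ler01 c1. Qed.

Let Msym G : (M G)^T = M G.
Proof. by rewrite /M linearZ /= adjmx_sym. Qed.

Let Sc G : opnorm_le c (S G). Proof. exact: resS_opnorm_le. Qed.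
Let Kc G : opnorm_le c (K G). Proof. exact: resK_opnorm_le. Qed.

Let tr_le (P : 'M[R]_n) : opnorm_le c P -> `|r ^+ 2 * \tr P| <= c.
Proof.
move=> Pc; rewrite normrM ger0_norm ?sqr_ge0 //.
rewrite (_ : c = r ^+ 2 * (c * n%:R)); last by rewrite mulrCA rn mulr1.
rewrite ler_wpM2l ?sqr_ge0 // (le_trans (ler_norm_sum _ _ _)) //.
rewrite (_ : c * _ = \sum_(i < n) c); last by rewrite sumr_const card_ord mulr_natr.
by apply: ler_sum => i _; exact: opnorm_le_entry.
Qed.

Let MB G i j : i != j -> M (put_edge i j true G) - M (put_edge i j false G) =
  r *: (delta_mx i j + delta_mx j i).
Proof. by move=> ij; rewrite -scalerBr adjmx_put_edgeB. Qed.

Let MG G i j : i != j ->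
  M G = M (put_edge i j true G) \/ M G = M (put_edge i j false G).
Proof.
move=> ij; rewrite -{1 3}(put_edge_id G ij).
by case: (Defs.adjacent G i j); [left|right].
Qed.

Let sB G i j : i != j ->
  `|s (put_edge i j true G) - s (put_edge i j false G)| <= 4 * c ^+ 3 * r ^+ 3.
Proof.
move=> ij; rewrite -mulrBr normrM ger0_norm ?sqr_ge0 //.
rewrite (_ : 4 * _ * _ = r ^+ 2 * (4 * c ^+ 3 * r)); last by ring.
rewrite ler_wpM2l ?sqr_ge0 //.
exact: (resS_trB t0 c1 ct1 ct2 ct (Msym _) (Msym _) (ltW r0) (MB G ij)).
Qed.

Let kB G i j : i != j ->
  `|k (put_edge i j true G) - k (put_edge i j false G)| <= 4 * c ^+ 3 * r ^+ 3.
Proof.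
move=> ij; rewrite -mulrBr normrM ger0_norm ?sqr_ge0 //.
rewrite (_ : 4 * _ * _ = r ^+ 2 * (4 * c ^+ 3 * r)); last by ring.
rewrite ler_wpM2l ?sqr_ge0 //.
exact: (resK_trB t0 c1 ct1 ct2 ct (Msym _) (Msym _) (ltW r0) (MB G ij)).
Qed.

(* With [m = k + i t s] the normalised trace of the resolvent at [z = i t],
   these are the real part and [1 / t] times the imaginary part of
   [1 + z m + m ^ 2 / 4]. *)
Definition self_re G : R :=
  1 - t ^+ 2 * s G + k G ^+ 2 / 4 - t ^+ 2 * s G ^+ 2 / 4.
Definition self_im G : R := k G + k G * s G / 2.

Let cX m p : (m <= p)%N -> c ^+ m <= c ^+ p.
Proof. exact: ler_weXn2l. Qed.

Let cXr m p q : (m <= p)%N -> c ^+ m * r ^+ q <= c ^+ p * r ^+ q.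
Proof. by move=> mp; rewrite ler_wpM2r ?exprn_ge0 ?(ltW r0) // cX. Qed.

Let s_le G : `|s G| <= c. Proof. exact: tr_le. Qed.
Let k_le G : `|k G| <= c. Proof. exact: tr_le. Qed.

Let prodB (x y x' y' : R) q : `|x| <= c -> `|y'| <= c ->
  `|x - x'| <= 4 * c ^+ 3 * q -> `|y - y'| <= 4 * c ^+ 3 * q ->
  `|x * y - x' * y'| <= 8 * c ^+ 4 * q.
Proof.
move=> xc yc dx dy.
rewrite (_ : _ - _ = x * (y - y') + (x - x') * y'); last by ring.
rewrite (le_trans (ler_normD _ _)) // !normrM.
have h1 := ler_pM (normr_ge0 _) (normr_ge0 _) xc dy.
have h2 := ler_pM (normr_ge0 _) (normr_ge0 _) dx yc.
rewrite (_ : 8 * _ * _ = c * (4 * c ^+ 3 * q) + 4 * c ^+ 3 * q * c);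
  [exact: lerD|ring].
Qed.

Let prod_le (x y : R) : `|x| <= c -> `|y| <= c -> `|x * y| <= c ^+ 2.
Proof. by move=> xc yc; rewrite normrM expr2 ler_pM. Qed.

Let t2M (x d : R) : `|x| <= d -> `|t ^+ 2 * x| <= c * d.
Proof.
by move=> xd; rewrite normrM ger0_norm ?sqr_ge0 // ler_pM ?sqr_ge0.
Qed.

Let self_re_le G : `|self_re G| <= 8 * c ^+ 5.
Proof.
have h1 := t2M (s_le G); have h2 := prod_le (k_le G) (k_le G).
have h3 := t2M (prod_le (s_le G) (s_le G)).
have c15 := cX (isT : 0 <= 5)%N; have c25 := cX (isT : 2 <= 5)%N.
have c35 := cX (isT : 3 <= 5)%N.
move: h1 h2 h3; rewrite -!exprS -!expr2 => h1 h2 h3.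
rewrite expr0 in c15; move: h1 h2 h3.
rewrite !ler_norml => /andP[? ?] /andP[? ?] /andP[? ?].
by rewrite /self_re; apply/andP; split; lra.
Qed.

Let self_im_le G : `|self_im G| <= 8 * c ^+ 5.
Proof.
have h1 := k_le G; have h2 := prod_le (k_le G) (s_le G).
have c15 := cX (isT : 1 <= 5)%N; have c25 := cX (isT : 2 <= 5)%N.
move: h1 h2; rewrite !ler_norml => /andP[? ?] /andP[? ?].
by rewrite expr1 in c15; rewrite /self_im; apply/andP; split; lra.
Qed.

Let self_reB G i j : i != j ->
  `|self_re (put_edge i j true G) - self_re (put_edge i j false G)| <=
  8 * c ^+ 5 * r ^+ 3.
Proof.
move=> ij; rewrite /self_re; have := kB G ij; have := sB G ij.
set G1 := put_edge i j true G; set G2 := put_edge i j false G => ds dk.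
have h1 := t2M ds.
have h2 := prodB (k_le G1) (k_le G2) dk dk.
have h3 := t2M (prodB (s_le G1) (s_le G2) ds ds).
have c45 := cXr 3 (isT : 4 <= 5)%N.
move: h1 h2 h3; rewrite (_ : c * (4 * _ * _) = 4 * (c ^+ 4 * r ^+ 3)); last by ring.
rewrite (_ : c * _ = 8 * (c ^+ 5 * r ^+ 3)); last by ring.
rewrite -!(mulrA _ (c ^+ _)) -!expr2 {ds dk}.
move: (s G1) (s G2) (k G1) (k G2) c45 => s1 s2 k1 k2 c45.
rewrite !ler_norml => /andP[? ?] /andP[? ?] /andP[? ?].
by apply/andP; split; lra.
Qed.

Let self_imB G i j : i != j ->
  `|self_im (put_edge i j true G) - self_im (put_edge i j false G)| <=
  8 * c ^+ 5 * r ^+ 3.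
Proof.
move=> ij; rewrite /self_im; have := kB G ij; have := sB G ij.
set G1 := put_edge i j true G; set G2 := put_edge i j false G => ds dk.
have h2 := prodB (k_le G1) (s_le G2) dk ds.
have c45 := cXr 3 (isT : 4 <= 5)%N; have c35 := cXr 3 (isT : 3 <= 5)%N.
move: dk h2; rewrite -!(mulrA _ (c ^+ _)) {ds}.
move: (s G1) (s G2) (k G1) (k G2) c45 c35 => s1 s2 k1 k2 c45 c35.
rewrite !ler_norml => /andP[? ?] /andP[? ?].
by apply/andP; split; lra.
Qed.

Let sum_mul (G : sgraph n) (P : 'M[R]_n) : P^T = P ->
  \sum_i \sum_j M G i j * P i j = \tr (M G *m P).
Proof.
move=> Ps; apply: eq_bigr => i _; rewrite mxE; apply: eq_bigr => j _.
by congr (_ * _); rewrite -[in LHS]Ps mxE.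
Qed.

Let c25 : c ^+ 2 <= c ^+ 5 /\ c <= c ^+ 5 /\ c ^+ 3 <= c ^+ 5.
Proof. by have := cX (isT : 1 <= 5)%N; rewrite expr1 !cX. Qed.

(** Applied with X = K and with [self_re] itself as test function Y. Since M K = 1 - t^2 S, the
    other factor is again [self_re], so a square appears. The bound is 3 a b r with a = 32 c^5 from
    the expansion of the entries and b = 8 c^5 from the size and variation of Y. *)
Lemma expect_self_re : expect (fun G => self_re G ^+ 2) <= 768 * c ^+ 10 * r.
Proof.
have [c2 [c5 c3]] := c25.
have a0 : 0 <= 32 * c ^+ 5 by rewrite mulr_ge0 // exprn_ge0.
have b0 : 0 <= 8 * c ^+ 5 by rewrite mulr_ge0 // exprn_ge0.
have cp : 0 <= c ^+ 5 by rewrite exprn_ge0.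
have := @expect_ibp_approx R n r r0 r1 rn (32 * c ^+ 5) (8 * c ^+ 5) K
  (fun G i j => t ^+ 2 * bilin i j (S G) (S G) - bilin i j (K G) (K G))
  (fun G => t ^+ 2 * (\tr (S G) * \tr (S G)) - \tr (K G) * \tr (K G))
  self_re a0 b0.
rewrite (_ : 768 * _ * _ = 3 * (32 * c ^+ 5) * (8 * c ^+ 5) * r); last by ring.
move=> h; apply: le_trans (h _ _ _ _ _ _) => {h}.
- apply: le_trans (ler_norm _); rewrite le_eqVlt; apply/orP; left; apply/eqP.
  apply: eq_expect => G; rewrite expr2; congr (_ * _).
  rewrite sum_mul ?resK_sym // mulmx_resK // mxtraceD raddfN /= mxtraceZ.
  rewrite mxtrace1 mulrBr rn /self_re /s /k -/(S G) -/(K G); by field.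
- by move=> G i j; rewrite (le_trans (opnorm_le_entry i j c0 (Kc G))) //; lra.
- move=> G; rewrite (le_trans (opnorm_le_sum c0 (Kc G))) // ler_wpM2r //; lra.
- exact: self_re_le.
- by move=> G i j; exact: self_reB.
- move=> G i j ij.
  exact: (resK_entryB2 t0 c1 ct1 ct2 ct (Msym _) (Msym _) (ltW r0)
    (MG G ij) (MB G ij)).
- move=> G.
  have -> : \sum_i \sum_(j | j != i)
      (t ^+ 2 * bilin i j (S G) (S G) - bilin i j (K G) (K G)) =
      t ^+ 2 * (\sum_i \sum_(j | j != i) bilin i j (S G) (S G)) -
      \sum_i \sum_(j | j != i) bilin i j (K G) (K G).
    rewrite mulr_sumr -sumrB; apply: eq_bigr => i _.
    by rewrite mulr_sumr -sumrB.
  have h1 := t2M (sum_bilin c0 (Sc G) (Sc G)).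
  have h2 := sum_bilin c0 (Kc G) (Kc G).
  rewrite (_ : _ - _ = t ^+ 2 * (\sum_i \sum_(j | j != i) bilin i j (S G) (S G)
    - \tr (S G) * \tr (S G)) - (\sum_i \sum_(j | j != i) bilin i j (K G) (K G)
    - \tr (K G) * \tr (K G))); last by ring.
  rewrite (le_trans (ler_normB _ _)) // (le_trans (lerD h1 h2)) //.
  rewrite (_ : _ + _ = (3 * c ^+ 3 + 3 * c ^+ 2) * n%:R); last by ring.
  by rewrite ler_wpM2r //; lra.
Qed.

(** The same with X = S, where the leading term is the trace of M S = K. *)
Lemma expect_self_im : expect (fun G => self_im G ^+ 2) <= 768 * c ^+ 10 * r.
Proof.
have [c2 [c5 c3]] := c25.
have a0 : 0 <= 32 * c ^+ 5 by rewrite mulr_ge0 // exprn_ge0.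
have b0 : 0 <= 8 * c ^+ 5 by rewrite mulr_ge0 // exprn_ge0.
have cp : 0 <= c ^+ 5 by rewrite exprn_ge0.
have := @expect_ibp_approx R n r r0 r1 rn (32 * c ^+ 5) (8 * c ^+ 5) S
  (fun G i j => - bilin i j (S G) (K G) - bilin i j (K G) (S G))
  (fun G => - (\tr (S G) * \tr (K G)) - \tr (K G) * \tr (S G))
  self_im a0 b0.
rewrite (_ : 768 * _ * _ = 3 * (32 * c ^+ 5) * (8 * c ^+ 5) * r); last by ring.
move=> h; apply: le_trans (h _ _ _ _ _ _) => {h}.
- apply: le_trans (ler_norm _); rewrite le_eqVlt; apply/orP; left; apply/eqP.
  apply: eq_expect => G; rewrite expr2; congr (_ * _).
  rewrite sum_mul ?resS_sym // -/(resK t (M G)) -/(K G).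
  by rewrite /self_im /s /k; field.
- by move=> G i j; rewrite (le_trans (opnorm_le_entry i j c0 (Sc G))) //; lra.
- move=> G; rewrite (le_trans (opnorm_le_sum c0 (Sc G))) // ler_wpM2r //; lra.
- exact: self_im_le.
- by move=> G i j; exact: self_imB.
- move=> G i j ij.
  exact: (resS_entryB2 t0 c1 ct1 ct2 ct (Msym _) (Msym _) (ltW r0)
    (MG G ij) (MB G ij)).
- move=> G.
  have -> : \sum_i \sum_(j | j != i)
      (- bilin i j (S G) (K G) - bilin i j (K G) (S G)) =
      - (\sum_i \sum_(j | j != i) bilin i j (S G) (K G)) -
      \sum_i \sum_(j | j != i) bilin i j (K G) (S G).
    rewrite -sumrN -sumrB; apply: eq_bigr => i _.
    by rewrite -sumrN -sumrB.
  have h1 := sum_bilin c0 (Sc G) (Kc G).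
  have h2 := sum_bilin c0 (Kc G) (Sc G).
  move: h1 h2; set A := \sum_i _; set B := \sum_i _ => h1 h2.
  rewrite (_ : - A - B - _ = - (A - \tr (S G) * \tr (K G)) -
    (B - \tr (K G) * \tr (S G))); last by ring.
  rewrite (le_trans (ler_normB _ _)) // normrN (le_trans (lerD h1 h2)) //.
  rewrite (_ : _ + _ = (6 * c ^+ 2) * n%:R); last by ring.
  by rewrite ler_wpM2r //; lra.
Qed.

End SelfConsistent.

(** * Stability of the quadratic equation and convergence of the transform *)

Lemma size_eigenvalues (R : rcfType) (n : nat) (A : 'M[R]_n) :
  A^T = A -> size (eigenvalues A) = n.
Proof.
by move=> /sym_diag[d [P [_ _ /perm_size ->]]]; rewrite size_map size_enum_ord.
Qed.

Lemma expect_norm_le_sqrt (R : realType) (n : nat) (f : sgraph n -> R) :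
  expect (fun G => `|f G|) <= Num.sqrt (expect (fun G => f G ^+ 2)).
Proof.
set m := expect _; have m0 : 0 <= m by apply: expect_ge0.
rewrite -[leLHS]ger0_norm // -sqrtr_sqr ler_wsqrtr //.
have : 0 <= expect (fun G => (`|f G| - m) ^+ 2).
  by apply: expect_ge0 => G; exact: sqr_ge0.
rewrite (@eq_expect _ _ _ (fun G => f G ^+ 2 + ((- 2 * m) * `|f G| + m ^+ 2))).
  by rewrite !expectD expectZ expect_cst -/m; lra.
by move=> G; rewrite -(real_normK (num_real (f G))); ring.
Qed.

(** The integral of x^2 / (x^2 + t^2) against the semicircle law on [-1, 1], in closed form. *)
Definition sc_transform (R : realType) (t : R) : R :=
  (Num.sqrt (1 + t ^+ 2) - t) ^+ 2.

(** The same integral against the empirical spectral distribution of A / sqrt n. *)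
Definition graph_transform (R : realType) (n : nat) (t : R) (G : sgraph n) : R :=
  \sum_(x <- eigenvalues (adjmx R G)) x ^+ 2 / (n%:R * (x ^+ 2 + n%:R * t ^+ 2)).

Section Convergence.
Variable R : realType.
Implicit Types (t : R) (n : nat).

(** With s1 the nonnegative root of the limiting equation, subtracting the two quadratics factors as
    the difference of the transforms times 1 + (s + s1) / 4, and this factor is at least 1 because s
    and s1 are nonnegative. The leftover k^2 is controlled by [self_im] = k (1 + s / 2), whose
    second factor is also at least 1. *)
Lemma graph_transform_le (n : nat) t (G : sgraph n) : (0 < n)%N -> 0 < t ->
  `|graph_transform t G - sc_transform t| <=
  `|self_re (Num.sqrt n%:R)^-1 t G| + self_im (Num.sqrt n%:R)^-1 t G ^+ 2 / 4.
Proof.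
move=> n0 t0; set r := (Num.sqrt n%:R)^-1; have N0 : 0 < n%:R :> R by rewrite ltr0n.
have r0 : 0 < r by rewrite invr_gt0 sqrtr_gt0.
have r2 : r ^+ 2 = n%:R^-1 by rewrite exprVn sqr_sqrtr // ltW.
have t2 : 0 < t ^+ 2 by rewrite exprn_gt0.
have Asym := adjmx_sym R G; set A := adjmx R G in Asym.
pose s := r ^+ 2 * \tr (resS t (r *: A)).
pose k := r ^+ 2 * \tr (resK t (r *: A)).
have Msym : (r *: A)^T = r *: A by rewrite linearZ /= Asym.
have s0 : 0 <= s by rewrite mulr_ge0 ?sqr_ge0 // resS_tr_ge0.
have [Au trA] := sqr_add_unit_tr Asym (mulr_gt0 N0 t2).
have sE : s = \sum_(x <- eigenvalues A) (x ^+ 2 + n%:R * t ^+ 2)^-1.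
  rewrite -trA /s /resS.
  have -> : r *: A *m (r *: A) + (t ^+ 2)%:M =
      r ^+ 2 *: (A *m A + (n%:R * t ^+ 2)%:M).
    rewrite scalerDr -scalemxAl -scalemxAr scalerA -expr2 scale_scalar_mx.
    by rewrite mulrA r2 mulVf ?gt_eqF // mul1r.
  rewrite invmxZ; last by rewrite unitmxZ // unitfE expf_neq0 // gt_eqF.
  by rewrite mxtraceZ mulrA mulfV ?mul1r // expf_neq0 // gt_eqF.
have hE : graph_transform t G = 1 - t ^+ 2 * s.
  rewrite /graph_transform -/A sE mulr_sumr.
  have one : \sum_(x <- eigenvalues A) n%:R^-1 = 1 :> R.
    rewrite big_const_seq count_predT (size_eigenvalues Asym) iter_addr_0.
    by rewrite -[LHS]mulr_natr mulVf // gt_eqF.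
  rewrite -[X in X - _]one.
  rewrite -sumrB; apply: eq_bigr => x _.
  have : x ^+ 2 + n%:R * t ^+ 2 != 0.
    by rewrite gt_eqF // ltr_wpDl ?sqr_ge0 // mulr_gt0.
  by move=> x0; field; rewrite x0 gt_eqF.
pose a := Num.sqrt (1 + t ^+ 2).
have a2 : a ^+ 2 = 1 + t ^+ 2 by rewrite sqr_sqrtr // addr_ge0 // ltW.
have ta : t <= a.
  rewrite -(ler_pXn2r (n := 2)) ?nnegrE ?sqrtr_ge0 ?(ltW t0) // a2.
  by rewrite lerDr.
pose s1 := 2 * (a - t) / t.
have s10 : 0 <= s1 by rewrite divr_ge0 ?mulr_ge0 ?subr_ge0 // ltW.
have h1E : sc_transform t = 1 - t ^+ 2 * s1.
  rewrite /sc_transform -/a /s1 (_ : t ^+ 2 * _ = 2 * t * (a - t)).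
    by rewrite sqrrB a2; ring.
  by field; rewrite gt_eqF.
have s1E : t ^+ 2 * s1 + t ^+ 2 * s1 ^+ 2 / 4 = 1.
  have -> : t ^+ 2 * s1 + t ^+ 2 * s1 ^+ 2 / 4 = a ^+ 2 - t ^+ 2.
    by rewrite /s1; field; rewrite gt_eqF.
  by rewrite a2 addrK.
have fE : self_re r t G - k ^+ 2 / 4 =
    (graph_transform t G - sc_transform t) * (1 + (s + s1) / 4).
  rewrite /self_re -/A -/s -/k hE h1E.
  have : 1 - t ^+ 2 * s - t ^+ 2 * s ^+ 2 / 4 = t ^+ 2 * s1 +
    t ^+ 2 * s1 ^+ 2 / 4 - t ^+ 2 * s - t ^+ 2 * s ^+ 2 / 4 by rewrite s1E.
  by move=> E; transitivity (1 - t ^+ 2 * s - t ^+ 2 * s ^+ 2 / 4);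
    [ring|rewrite E; field].
have kE : k ^+ 2 <= self_im r t G ^+ 2.
  rewrite /self_im -/A -/s -/k (_ : k + _ = k * (1 + s / 2)); last by ring.
  rewrite (exprMn _ k) ler_peMr ?sqr_ge0 // exprn_ege1 // lerDl.
  by rewrite divr_ge0.
have : `|graph_transform t G - sc_transform t| <= `|self_re r t G - k ^+ 2 / 4|.
  rewrite fE normrM ler_peMr // ger0_norm ?addr_ge0 ?divr_ge0 ?addr_ge0 //.
  by rewrite lerDl divr_ge0 ?addr_ge0.
move=> /le_trans; apply; rewrite (le_trans (ler_normB _ _)) // lerD2l.
by rewrite ger0_norm ?divr_ge0 ?sqr_ge0 // ler_pM2r ?invr_gt0.
Qed.

Lemma cvg_expect_transform t : 0 < t ->
  expect (fun G : sgraph n => `|graph_transform t G - sc_transform t|)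
    @[n --> \oo] --> (0 : R).
Proof.
(* As t is fixed, one c independent of n serves for all bounds, and only r = n^(-1/2) tends to 0. *)
move=> t0; pose c := 1 + t^-1 + (t ^+ 2)^-1 + t ^+ 2.
have ti : 0 <= t^-1 by rewrite invr_ge0 ltW.
have ti2 : 0 <= (t ^+ 2)^-1 by rewrite invr_ge0 sqr_ge0.
have t2 : 0 <= t ^+ 2 by rewrite sqr_ge0.
have c1 : 1 <= c by rewrite /c; lra.
have ct1 : t^-1 <= c by rewrite /c; lra.
have ct2 : (t ^+ 2)^-1 <= c by rewrite /c; lra.
have ct : t ^+ 2 <= c by rewrite /c; lra.
pose r n : R := (Num.sqrt n%:R)^-1.
pose B : R := 768 * c ^+ 10.
have rcvg : r n @[n --> \oo] --> (0 : R).
  have icvg : (n%:R^-1 : R) @[n --> \oo] --> (0 : R).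
    apply/gtr0_cvgV0; last exact: cvgr_idn.
    by near=> n; rewrite ltr0n; near: n; exists 1%N.
  rewrite (_ : r = (fun n => Num.sqrt n%:R^-1)).
    rewrite -[X in _ --> X]sqrtr0.
    by apply: continuous_cvg => //; exact: sqrt_continuous.
  by apply/funext => n; rewrite /r sqrtrV.
have Bcvg : (Num.sqrt (B * r n) + B * r n / 4) @[n --> \oo] --> (0 : R).
  have -> : (0 : R) = Num.sqrt (B * 0) + B * 0 / 4 by rewrite mulr0 sqrtr0 mul0r addr0.
  have Br : B * r n @[n --> \oo] --> B * 0 by exact: cvgMr.
  apply: cvgD; last exact: cvgMl.
  by apply: continuous_cvg => //; exact: sqrt_continuous.
apply: (@squeeze_cvgr _ _ _ _ (fun=> 0)
  (fun n => Num.sqrt (B * r n) + B * r n / 4)) => //; last exact: cvg_cst.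
near=> n; have n0 : (0 < n)%N by near: n; exists 1%N.
rewrite expect_ge0 //=.
have N1 : 1 <= n%:R :> R by rewrite ler1n.
have r0 : 0 < r n by rewrite invr_gt0 sqrtr_gt0 ltr0n.
have r1 : r n <= 1.
  by rewrite invf_le1 ?sqrtr_gt0 ?ltr0n // -[leLHS]sqrtr1 ler_wsqrtr.
have rn : r n ^+ 2 * n%:R = 1.
  by rewrite exprVn sqr_sqrtr ?ler0n // mulVf // pnatr_eq0 -lt0n.
have hre := expect_self_re r0 r1 rn t0 c1 ct1 ct2 ct.
have him := expect_self_im r0 r1 rn t0 c1 ct1 ct2 ct.
apply: (@le_trans _ _ (expect (fun G : sgraph n => `|self_re (r n) t G|) +
    4^-1 * expect (fun G : sgraph n => self_im (r n) t G ^+ 2))).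
  rewrite -expectZ -expectD; apply: ler_expect => G.
  by rewrite (mulrC 4^-1); exact: graph_transform_le.
apply: lerD.
  by rewrite (le_trans (expect_norm_le_sqrt _)) // ler_wsqrtr.
by rewrite mulrC ler_pM2r ?invr_gt0.
Unshelve. all: by end_near. Qed.

End Convergence.

(** * Beta and Gamma integrals *)

Section HalfLine.
Variable R : realType.
Implicit Types (f g : R -> R) (a b c p x y t : R).
Local Notation mu := (@lebesgue_measure R).
Local Notation P := (`]0%R, +oo[%classic : set R).

Let inP x : P x -> 0 < x.
Proof. by rewrite /= in_itv /= andbT. Qed.

Let mP : measurable P. Proof. exact: measurable_itv. Qed.

Lemma measurable_fun_ge0V d (T : measurableType d) (f : T -> R) :
  (forall z, 0 <= f z) -> measurable_fun setT f ->
  measurable_fun setT (fun z => (f z)^-1).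
Proof.
move=> f0 mf; rewrite (_ : (fun z => _) = (@powR R ^~ (-1)) \o f).
  exact: measurableT_comp (measurable_powR _) mf.
by apply/funext => z /=; rewrite powR_inv1.
Qed.

Lemma tonelli_pos (f : R * R -> R) : measurable_fun setT f ->
  (forall z, 0 <= f z) ->
  (\int[mu]_(x in P) \int[mu]_(y in P) (f (x, y))%:E =
   \int[mu]_(y in P) \int[mu]_(x in P) (f (x, y))%:E)%E.
Proof.
move=> mf f0; pose g (z : R * R) := (f z * (\1_P z.1 * \1_P z.2))%:E.
have mg : measurable_fun setT g.
  have mi : measurable_fun setT (\1_P : R -> R) by exact: measurable_indic.
  apply/measurable_EFinP; apply: measurable_funM => //.
  apply: measurable_funM; apply: (measurableT_comp mi).
    exact: measurable_fst.
  exact: measurable_snd.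
have g0 z : (0 <= g z)%E by rewrite lee_fin !mulr_ge0 // indicE ler0n.
have E1 x : (\int[mu]_(y in P) (f (x, y))%:E)%E = 
  (\int[mu]_y (f (x, y) * \1_P y)%:E)%E.
  rewrite integral_mkcond; apply: eq_integral => y _.
  by rewrite patchE indicE; case: (y \in P); rewrite /= ?mulr1 ?mulr0.
have E2 y : (\int[mu]_(x in P) (f (x, y))%:E)%E = 
  (\int[mu]_x (f (x, y) * \1_P x)%:E)%E.
  rewrite integral_mkcond; apply: eq_integral => x _.
  by rewrite patchE indicE; case: (x \in P); rewrite /= ?mulr1 ?mulr0.
transitivity (\int[mu]_x \int[mu]_y g (x, y))%E.
  rewrite integral_mkcond; apply: eq_integral => x _; rewrite patchE.
  case: ifPn => xP; rewrite ?E1.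
    by apply: eq_integral => y _; rewrite /g /= [\1_P x]indicE xP /= mul1r.
  rewrite integral0_eq // => y _; rewrite /g /= [\1_P x]indicE (negbTE xP) /=.
  by rewrite mul0r mulr0.
rewrite fubini_tonelli //; apply/esym.
rewrite integral_mkcond; apply: eq_integral => y _; rewrite patchE.
case: ifPn => yP; rewrite ?E2.
  by apply: eq_integral => x _; rewrite /g /= [\1_P y]indicE yP /= mulr1.
rewrite integral0_eq // => x _; rewrite /g /= [\1_P y]indicE (negbTE yP) /=.
by rewrite !mulr0.
Qed.

(** Continuity is required up to 0, hence the restriction to parameters at least 1 in the Gamma and
    Beta integrals; only (p + 1) / 2 and 3/2 will occur as factors. *)
Lemma scale_pos f c : 0 < c -> {within `[0, +oo[, continuous f} ->
  (forall x, 0 < x -> 0 <= f x) -> 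
  (\int[mu]_(x in P) (f x)%:E = \int[mu]_(x in P) (f (c * x) * c)%:E)%E.
Proof.
move=> c0 cf f0.
have mf : measurable_fun P f.
  apply: open_continuous_measurable_fun => //.
  by move: cf => /continuous_within_itvcyP[/in_continuous_mksetP cf _].
have dE x : is_derive x 1 (fun x => c * x) c.
  by apply: is_derive_eq; rewrite /GRing.scale /= mulr1.
have dc : (fun x => c * x)^`()%classic = fun=> c.
  by apply/funext => x; rewrite derive1E derive_val.
have F0 : (fun x : R => c * x) 0 = 0 by rewrite mulr0.
have := @increasing_ge0_integration_by_substitutiony R (fun x => c * x) f 0.
rewrite F0 dc => /(_ _ _ _ _ _ _ _ _) H.
have mfc : measurable_fun P (fun x => f (c * x) * c).
  apply: measurable_funM => //.
  apply: (@measurable_comp _ _ _ _ _ _ P) => //.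
  - by move=> _ [x /inP x0 <-]; rewrite /= in_itv /= andbT mulr_gt0.
rewrite integral_itv_obnd_cbnd; last exact/measurable_EFinP.
rewrite integral_itv_obnd_cbnd; last exact/measurable_EFinP.
rewrite H //.
- by move=> x y _ _ xy; rewrite ltr_pM2l.
- by move=> x _; exact: cvg_cst.
- exact: is_cvg_cst.
- exact: is_cvg_cst.
- split=> [x _|]; first by have [] := dE x.
  by apply: cvg_at_right_filter; apply: cvgMr.
- by apply: gt0_cvgMry.
- by move=> x; rewrite in_itv /= andbT; exact: f0.
Qed.

End HalfLine.

Section GammaBeta.
Variable R : realType.
Implicit Types (a b c p x y t : R).
Local Notation mu := (@lebesgue_measure R).
Local Notation P := (`]0%R, +oo[%classic : set R).

Let inP x : P x -> 0 < x.
Proof. by rewrite /= in_itv /= andbT. Qed.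

Let mP : measurable P. Proof. exact: measurable_itv. Qed.

Lemma within_continuous_powR p : 0 <= p ->
  {within `[0, +oo[, continuous (@powR R ^~ p)}.
Proof.
rewrite le_eqVlt => /predU1P[<-|p0].
  rewrite (_ : _ ^~ _ = fun=> 1); last by apply/funext => x; rewrite powRr0.
  by move=> x; exact: cvg_cst.
apply/continuous_within_itvcyP; split; last first.
  by rewrite powR0 ?gt_eqF //; exact: powR_cvg0.
move=> x; rewrite in_itv /= andbT => x0.
apply: differentiable_continuous; apply/derivable1_diffP.
by have [] := is_derive1_powR p x0.
Qed.

Lemma within_continuousM (A : set R) (f g : R -> R) :
  {within A, continuous f} -> {within A, continuous g} ->
  {within A, continuous (fun x => f x * g x)}.
Proof. by move=> cf cg x; apply: cvgM; [exact: cf|exact: cg]. Qed.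

Lemma continuous_expRN : continuous (fun x : R => expR (- x)).
Proof.
move=> x; apply: (@continuous_comp _ _ _ -%R expR); first exact: continuousN.
exact: continuous_expR.
Qed.

Lemma cvgy_expR_half : expR (- (x / 2)) @[x --> +oo] --> (0 : R).
Proof.
apply: (@cvg_comp _ _ _ (fun x => x / 2) (fun x => expR (- x)) _ +oo).
  by apply: gt0_cvgMly; rewrite ?invr_gt0.
exact: cvgr_expR.
Qed.

(** From 1 + u <= exp u at u = x / (2 p), raised to the power p. It leaves half of the exponential
    to make the Gamma integral converge. *)
Lemma powR_le_expR p x : 0 <= p -> 0 < x ->
  x `^ p <= (2 * p) `^ p * expR (x / 2).
Proof.
rewrite le_eqVlt => /predU1P[<- x0|p0 x0].
  by rewrite !powRr0 mul1r -expR0 ler_expR divr_ge0 // ltW.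
have q0 : 0 < 2 * p by rewrite mulr_gt0.
have -> : x / 2 = x / (2 * p) * p by field; rewrite gt_eqF.
rewrite expRM -powRM ?expR_ge0 ?(ltW q0) //.
apply: ge0_ler_powR; rewrite ?nnegrE ?mulr_ge0 ?expR_ge0 ?(ltW p0) ?(ltW x0) //.
rewrite mulrC -ler_pdivrMr // (le_trans _ (expR_ge1Dx _)) //.
by rewrite lerDr.
Qed.

Definition GammaE a : \bar R :=
  (\int[mu]_(x in P) (x `^ (a - 1) * expR (- x))%:E)%E.

Lemma GammaEE a : Gamma a = fine (GammaE a). Proof. by []. Qed.

Lemma measurable_Gamma_fun a :
  measurable_fun setT (fun x => x `^ (a - 1) * expR (- x)).
Proof.
apply: measurable_funM => //.
by apply: continuous_measurable_fun; exact: continuous_expRN.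
Qed.

Lemma measurable_Gamma_fun_scale a c : measurable_fun P
  (fun x => ((c * x) `^ (a - 1) * expR (- (c * x)) * c)%:E).
Proof.
apply/measurable_EFinP; apply: measurable_funTS; apply: measurable_funM => //.
have mc : measurable_fun setT (fun x => c * x) by exact: measurable_funM.
exact: (measurableT_comp (measurable_Gamma_fun a) mc).
Qed.

Lemma integral_expR_half : (\int[mu]_(x in P) (expR (- (x / 2)))%:E = 2%:E)%E.
Proof.
have ce : continuous (fun x : R => expR (- (x / 2))).
  move=> x; apply: (@continuous_comp _ _ _ (fun x => - (x / 2)) expR).
    by apply: cvgN; apply: cvgMl.
  exact: continuous_expR.
rewrite integral_itv_obnd_cbnd; last first.
  apply/measurable_EFinP; apply: measurable_funTS; exact: continuous_measurable_fun.
have dF x : is_derive x 1 (fun x : R => - 2 * expR (- (x / 2))) (expR (- (x / 2))).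
  by apply: is_derive_eq; rewrite /GRing.scale /= !mulr1; field.
rewrite (@ge0_continuous_FTC2y _ (fun x => expR (- (x / 2)))
  (fun x => - 2 * expR (- (x / 2))) _ 0) //.
- by rewrite mul0r oppr0 expR0 mulr1 -EFinB sub0r opprK.
- exact: continuous_subspaceT.
- by rewrite -[X in _ --> X](mulr0 (- 2)); apply: cvgMr; exact: cvgy_expR_half.
- apply: cvg_at_right_filter; apply: cvgMr; exact: ce.
- by move=> x _; rewrite derive1E derive_val.
Qed.

Lemma GammaE_ge0 a : (0 <= GammaE a)%E.
Proof.
by apply: integral_ge0 => x _; rewrite lee_fin mulr_ge0 ?powR_ge0 ?expR_ge0.
Qed.

Lemma GammaE_lty a : 1 <= a -> (GammaE a < +oo)%E.
Proof.
move=> a1; have b0 : 0 <= a - 1 by rewrite subr_ge0.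
set K := (2 * (a - 1)) `^ (a - 1); have K0 : 0 <= K by exact: powR_ge0.
have me : measurable_fun P (fun x : R => expR (- (x / 2))).
  apply: measurable_funTS; apply: continuous_measurable_fun => x.
  apply: (@continuous_comp _ _ _ (fun x => - (x / 2)) expR).
    by apply: cvgN; apply: cvgMl.
  exact: continuous_expR.
apply: (@le_lt_trans _ _ (\int[mu]_(x in P) (K * expR (- (x / 2)))%:E)%E).
  apply: ge0_le_integral => //.
  - by move=> x _; rewrite lee_fin mulr_ge0 ?powR_ge0 ?expR_ge0.
  - by apply/measurable_EFinP; apply: measurable_funTS; exact: measurable_Gamma_fun.
  - by apply/measurable_EFinP; apply: measurable_funM.
  - move=> x /inP x0; rewrite lee_fin.
    have xE : - x = - (x / 2) - x / 2. by field. rewrite xE.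
    rewrite expRD mulrA ler_wpM2r ?expR_ge0 // expRN ler_pdivrMr ?expR_gt0 //.
    exact: powR_le_expR.
under eq_integral do rewrite EFinM.
rewrite ge0_integralZl_EFin //; last exact/measurable_EFinP.
by rewrite integral_expR_half -EFinM ltry.
Qed.

Lemma GammaE_fineK a : 1 <= a -> GammaE a = (Gamma a)%:E.
Proof. by move=> a1; rewrite GammaEE fineK // ge0_fin_numE ?GammaE_ge0 ?GammaE_lty. Qed.

Lemma within_continuous_Gamma_fun a : 1 <= a ->
  {within `[0, +oo[, continuous (fun x => x `^ (a - 1) * expR (- x))}.
Proof.
move=> a1; apply: within_continuousM.
  by apply: within_continuous_powR; rewrite subr_ge0.
by apply: continuous_subspaceT; exact: continuous_expRN.
Qed.

Lemma GammaE_scale a c : 1 <= a -> 0 < c ->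
  (\int[mu]_(x in P) (x `^ (a - 1) * expR (- (c * x)))%:E =
   (c `^ (- a))%:E * GammaE a)%E.
Proof.
move=> a1 c0; rewrite /GammaE.
rewrite (@scale_pos _ (fun x => x `^ (a - 1) * expR (- x)) c) //; last 2 first.
- exact: within_continuous_Gamma_fun.
- by move=> x _; rewrite mulr_ge0 ?powR_ge0 ?expR_ge0.
rewrite -ge0_integralZl_EFin ?powR_ge0 //; last 2 first.
- by move=> x _; rewrite lee_fin !mulr_ge0 ?powR_ge0 ?expR_ge0 // ltW.
- exact: measurable_Gamma_fun_scale.
apply: eq_integral => x; rewrite inE => /inP x0; rewrite -EFinM; congr EFin.
rewrite powRM ?(ltW c0) ?(ltW x0) // powRN.
rewrite (_ : _ * expR _ * c = c * c `^ (a - 1) * (x `^ (a - 1) * expR (- (c * x)))).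
  rewrite mulr_powRB1 ?(ltW c0) //; last exact: lt_le_trans a1.
  by rewrite mulKf // gt_eqF // powR_gt0.
ring.
Qed.

(** The Beta integral moved from the unit interval to the half-line by u = v / (1 + v). *)
Definition BetaE a b : \bar R :=
  (\int[mu]_(v in P) (v `^ (a - 1) * (1 + v) `^ (- (a + b)))%:E)%E.

(* The substitution [x = y v] in the product of the two integrals. *)
Lemma GammaE_mul a b : 1 <= a -> 1 <= b ->
  (GammaE a * GammaE b = GammaE (a + b) * BetaE a b)%E.
Proof.
move=> a1 b1; have ab1 : 1 <= a + b by lra.
have mG d : measurable_fun P (fun x => (x `^ (d - 1) * expR (- x))%:E).
  by apply/measurable_EFinP; apply: measurable_funTS; exact: measurable_Gamma_fun.
have G0 d x : P x -> (0 <= (x `^ (d - 1) * expR (- x))%:E)%E.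
  by move=> _; rewrite lee_fin mulr_ge0 ?powR_ge0 ?expR_ge0.
(* The components of [z] are y and v, in this order. Integrating over y first yields Gamma(a + b) (1
   + v)^(- (a + b)) times v^(a - 1). *)
pose f (z : R * R) := z.2 `^ (a - 1) *
  (z.1 `^ (a + b - 1) * expR (- ((1 + z.2) * z.1))).
have f0 z : 0 <= f z by rewrite !mulr_ge0 ?powR_ge0 ?expR_ge0.
have mp d (g : R * R -> R) : measurable_fun setT g ->
    measurable_fun setT (fun z => g z `^ d).
  by move=> mg; exact: (measurableT_comp (measurable_powR d) mg).
have m1 : measurable_fun setT (fun z : R * R => z.1) by exact: measurable_fst.
have m2 : measurable_fun setT (fun z : R * R => z.2) by exact: measurable_snd.
have mf : measurable_fun setT f.
  apply: measurable_funM; first exact: mp.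
  apply: measurable_funM; first exact: mp.
  have me : measurable_fun setT (fun x : R => expR (- x)).
    by apply: continuous_measurable_fun; exact: continuous_expRN.
  have mz : measurable_fun setT (fun z : R * R => (1 + z.2) * z.1).
    by apply: measurable_funM => //; apply: measurable_funD.
  exact: (measurableT_comp me mz).
rewrite -(ge0_integralZl mu mP (mG b) (G0 b)) ?GammaE_ge0 //.
transitivity (\int[mu]_(y in P) \int[mu]_(v in P) (f (y, v))%:E)%E.
  apply: eq_integral => y; rewrite inE => /inP y0.
  rewrite muleC /GammaE.
  rewrite (@scale_pos _ (fun x => x `^ (a - 1) * expR (- x)) y) //; last 2 first.
  - exact: within_continuous_Gamma_fun.
  - by move=> x _; rewrite mulr_ge0 ?powR_ge0 ?expR_ge0.
  rewrite -ge0_integralZl_EFin ?mulr_ge0 ?powR_ge0 ?expR_ge0 //; last 2 first.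
  - by move=> x _; rewrite lee_fin !mulr_ge0 ?powR_ge0 ?expR_ge0 // ltW.
  - exact: measurable_Gamma_fun_scale.
  apply: eq_integral => v; rewrite inE => /inP v0; rewrite -EFinM; congr EFin.
  rewrite /f /= powRM ?(ltW v0) ?(ltW y0) //.
  rewrite (_ : a + b - 1 = (a - 1) + (b - 1) + 1); last by ring.
  have yD r s : y `^ (r + s) = y `^ r * y `^ s.
    by rewrite powRD // (gt_eqF y0) implybT.
  move: (a - 1) (b - 1) => A B; rewrite !yD powRr1 ?(ltW y0) //.
  rewrite mulrDl mul1r opprD expRD (mulrC v y); ring.
rewrite tonelli_pos //.
transitivity (\int[mu]_(v in P) (GammaE (a + b) *
    (v `^ (a - 1) * (1 + v) `^ (- (a + b)))%:E))%E; last first.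
  rewrite ge0_integralZl ?GammaE_ge0 //.
  - apply/measurable_EFinP; apply: measurable_funTS; apply: measurable_funM => //.
    apply: (measurableT_comp (measurable_powR _)).
    exact: measurable_funD.
  - by move=> x _; rewrite lee_fin mulr_ge0 ?powR_ge0.
apply: eq_integral => v; rewrite inE => /inP v0.
rewrite /f /=; under eq_integral do rewrite EFinM.
have m3 : measurable_fun P (fun y =>
    (y `^ (a + b - 1) * expR (- ((1 + v) * y)))%:E).
  apply/measurable_EFinP; apply: measurable_funTS; apply: measurable_funM => //.
  have mv : measurable_fun setT (fun y : R => (1 + v) * y).
    exact: measurable_funM.
  have me : measurable_fun setT (fun x : R => expR (- x)).
    by apply: continuous_measurable_fun; exact: continuous_expRN.
  exact: (measurableT_comp me mv).
have p3 y : P y -> (0 <= (y `^ (a + b - 1) * expR (- ((1 + v) * y)))%:E)%E.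
  by move=> _; rewrite lee_fin mulr_ge0 ?powR_ge0 ?expR_ge0.
rewrite (ge0_integralZl_EFin mu mP p3 m3) ?powR_ge0 //.
by rewrite GammaE_scale ?addr_gt0 // muleA -EFinM muleC.
Qed.

End GammaBeta.

(** * Moments of the semicircle law *)

Section SemicircleIntegrals.
Variable R : realType.
Implicit Types (a b c p x y t u v : R).
Local Notation mu := (@lebesgue_measure R).
Local Notation P := (`]0%R, +oo[%classic : set R).

Let inP x : P x -> 0 < x.
Proof. by rewrite /= in_itv /= andbT. Qed.

Let mP : measurable P. Proof. exact: measurable_itv. Qed.

Lemma cvgy_sqrt : Num.sqrt x @[x --> +oo] --> (+oo : set_system R).
Proof.
apply/cvgryPge => A; near=> x.
rewrite (le_trans (ler_norm A)) // -sqrtr_sqr ler_wsqrtr //; near: x.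
Unshelve. all: by end_near. Qed.

Lemma cvgy_inv : x^-1 @[x --> +oo] --> (0 : R).
Proof.
apply: ((gtr0_cvgV0 (f := id) _).2 cvg_id).
exact: nbhs_pinfty_gt.
Qed.

(** The substitution v = u^2: the antiderivatives below are rational functions and arctangents of u.
    At v = 0, where the square root has no derivative, continuity of g o sqrt is what enters. *)
Lemma integral_sqrt (g psi : R -> R) (l : R) :
  (forall u, is_derive u 1 g (2 * u * psi u)) -> continuous psi ->
  (forall u, 0 <= u -> 0 <= psi u) -> g u @[u --> +oo] --> l ->
  (\int[mu]_(v in P) (psi (Num.sqrt v))%:E = (l - g 0)%:E)%E.
Proof.
move=> dg cpsi psi0 gl.
have cps : continuous (psi \o Num.sqrt).
  move=> x; apply: continuous_comp; first exact: sqrt_continuous.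
  exact: cpsi.
rewrite integral_itv_obnd_cbnd; last first.
  by apply/measurable_EFinP; apply: measurable_funTS; exact: continuous_measurable_fun.
have dF x : 0 < x -> is_derive x 1 (g \o Num.sqrt) (psi (Num.sqrt x)).
  move=> x0; have s0 : 0 < Num.sqrt x by rewrite sqrtr_gt0.
  have ds := is_derive1_sqrt x0.
  have dgs := dg (Num.sqrt x).
  have := @is_derive1_comp R g Num.sqrt x _ _ dgs ds.
  set w := (X in is_derive _ _ _ X) => h.
  suff <- : w = psi (Num.sqrt x) by [].
  by rewrite /w; field; rewrite gt_eqF.
rewrite (@ge0_continuous_FTC2y _ (psi \o Num.sqrt) (g \o Num.sqrt) _ l) /=.
- by rewrite sqrtr0 EFinB.
- by move=> x _; apply: psi0; exact: sqrtr_ge0.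
- exact: continuous_subspaceT.
- exact: (cvg_comp _ _ cvgy_sqrt gl).
- by move=> x x0; have [] := dF x x0.
- apply: cvg_at_right_filter; apply: continuous_comp; first exact: sqrt_continuous.
  apply: differentiable_continuous; apply/derivable1_diffP.
  by have [] := dg (Num.sqrt 0).
- move=> x; rewrite in_itv /= andbT => x0.
  by rewrite derive1E; have dFx := dF x x0; rewrite derive_val.
Qed.

Lemma cvgy_rational (f : R -> R) : (forall u, 0 < u -> `|f u| <= u^-1) ->
  f u @[u --> +oo] --> (0 : R).
Proof.
move=> fu; have iN : - u^-1 @[u --> +oo] --> (0 : R).
  by rewrite -oppr0; apply: cvgN; exact: cvgy_inv.
apply: (squeeze_cvgr _ iN cvgy_inv); near=> u.
by rewrite -ler_norml fu.
Unshelve. all: by end_near. Qed.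

Lemma Gamma3 : GammaE 3 = 2%:E :> \bar R.
Proof.
rewrite /GammaE integral_itv_obnd_cbnd; last first.
  by apply/measurable_EFinP; apply: measurable_funTS; exact: measurable_Gamma_fun.
pose F (x : R) := - ((x ^+ 2 + 2 * x + 2) * expR (- x)).
have dF x : is_derive x 1 F (x ^+ 2 * expR (- x)).
  by apply: is_derive_eq; rewrite /GRing.scale /=; field.
transitivity (\int[mu]_(x in `[0%R, +oo[) (x ^+ 2 * expR (- x))%:E)%E.
  apply: eq_integral => x; rewrite inE /= in_itv /= andbT => x0.
  by rewrite (_ : 3 - 1 = 2%:R) ?powR_mulrn //; ring.
have cF : continuous F.
  move=> x; apply: differentiable_continuous; apply/derivable1_diffP.
  by have [] := dF x.
have cf : continuous (fun x : R => x ^+ 2 * expR (- x)).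
  move=> x; apply: cvgM; first exact: exprn_continuous.
  exact: continuous_expRN.
rewrite (@ge0_continuous_FTC2y _ (fun x => x ^+ 2 * expR (- x)) F _ 0).
- rewrite -EFinB; congr EFin.
  by rewrite /F oppr0 expR0 expr0n /= mulr0 !add0r mulr1 opprK.
- by move=> x _; rewrite mulr_ge0 ?sqr_ge0 ?expR_ge0.
- exact: continuous_subspaceT.
(* Squaring exp (x / 4) >= 1 + x / 4 gives x^2 + 2 x + 2 <= 22 exp (x / 2) for x > 0; any constant
   from 16 on would do. *)
- have c0 : 22 * expR (- (x / 2)) @[x --> +oo] --> (0 : R).
    by rewrite -(mulr0 22); apply: cvgMr; exact: cvgy_expR_half.
  have cN0 : - (22 * expR (- (x / 2))) @[x --> +oo] --> (0 : R).
    by rewrite -oppr0; exact: cvgN.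
  apply: (squeeze_cvgr _ cN0 (cvg_cst 0)); near=> x.
  have x0 : 0 < x by near: x; exact: nbhs_pinfty_gt.
  rewrite oppr_le0 mulr_ge0 ?expR_ge0 ?addr_ge0 ?sqr_ge0 ?mulr_ge0 ?(ltW x0) //.
  rewrite andbT lerN2 (_ : - x = - (x / 2) - x / 2); last by field.
  rewrite expRD mulrA ler_wpM2r ?expR_ge0 //.
  rewrite [expR (- _)]expRN ler_pdivrMr ?expR_gt0 //.
  have := expR_ge1Dx (x / 4); rewrite (_ : x / 2 = x / 4 * 2%:R); last by field.
  rewrite expRM_natr; set w := expR _ => h.
  have x4 : 0 <= x / 4 by rewrite divr_ge0 // ltW.
  nra.
- by move=> x _; have [] := dF x.
- by apply: cvg_at_right_filter; exact: cF.
- by move=> x _; rewrite derive1E derive_val.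
Unshelve. all: by end_near. Qed.


Let derive1V (x : R) : 0 <= x -> 1 + x != 0.
Proof. by move=> x0; rewrite gt_eqF // ltr_pwDl. Qed.

Lemma is_derive_inv1sqr u : is_derive u 1 (fun u : R => (1 + u ^+ 2)^-1)
  (- 2 * u * (1 + u ^+ 2)^-1 ^+ 2).
Proof.
have h : 1 + u ^+ 2 != 0 by rewrite derive1V ?sqr_ge0.
have := @is_deriveV R (fun u : R => 1 + u ^+ 2) u (2 * u) 1 h.
move=> /(_ _)[].
  by apply: is_derive_eq; rewrite /GRing.scale /=; ring.
move=> d1 d2; apply: DeriveDef => //; rewrite d2 /GRing.scale /=; field.
by rewrite h.
Qed.

Lemma is_derive_continuous (f f' : R -> R) :
  (forall u, is_derive u 1 f (f' u)) -> continuous f.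
Proof.
move=> df u; apply: differentiable_continuous; apply/derivable1_diffP.
by have [] := df u.
Qed.

(** After v = u^2 the integrand 2 u^2 / (1 + u^2)^3 has the elementary antiderivative [g]. With
    Gamma(3) = 2 this value determines Gamma(3/2), which stands in for a Gaussian integral. *)
Lemma BetaE_32 : BetaE (3 / 2) (3 / 2) = (pi / 8)%:E :> \bar R.
Proof.
pose g (u : R) := 4^-1 * (atan u + (u ^+ 3 - u) * (1 + u ^+ 2)^-1 ^+ 2).
pose psi (u : R) := u * (1 + u ^+ 2)^-1 ^+ 3.
have dV := is_derive_inv1sqr.
have := @integral_sqrt g psi (pi / 8).
have -> : (\int[mu]_(v in P) (psi (Num.sqrt v))%:E)%E = BetaE (3 / 2) (3 / 2).
  apply: eq_integral => v; rewrite inE => /inP v0.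
  rewrite /psi sqr_sqrtr ?(ltW v0) // (_ : 3 / 2 - 1 = 2^-1); last by field.
  rewrite (_ : 3 / 2 + 3 / 2 = 3%:R); last by field.
  rewrite powR12_sqrt ?(ltW v0) // powR_invn ?exprVn //.
  by rewrite addr_ge0 // ltW.
have -> : g 0 = 0 by rewrite /g atan0 expr0n /= subrr mul0r addr0 mulr0.
rewrite subr0; apply.
- move=> u; have h : 1 + u ^+ 2 != 0 by rewrite derive1V ?sqr_ge0.
  by apply: is_derive_eq; rewrite /GRing.scale /psi /=; field.
- apply: (@is_derive_continuous psi ('D_1 psi)) => u.
  by apply: derivableP; apply: ex_derive.
- by move=> u u0; rewrite mulr_ge0 // exprn_ge0 // invr_ge0 addr_ge0 ?sqr_ge0.
- rewrite (_ : pi / 8 = 4^-1 * (pi / 2 + 0)); last by field.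
  apply: cvgMr; apply: cvgD; first exact: cvgy_atan.
  apply: cvgy_rational => u u0; have ui : 0 < u^-1 by rewrite invr_gt0.
  have D0 : 0 < (1 + u ^+ 2) ^+ 2 by rewrite exprn_gt0 // ltr_pwDl ?sqr_ge0.
  have E : u^-1 * (1 + u ^+ 2) ^+ 2 = u^-1 + 2 * u + u ^+ 3.
    by field; rewrite gt_eqF.
  rewrite exprVn ler_norml ler_pdivlMr // ler_pdivrMr // mulNr E.
  have u3 : 0 < u ^+ 3 by rewrite exprn_gt0.
  by apply/andP; split; lra.
Qed.

Lemma Gamma32 : Gamma (3 / 2) = Num.sqrt pi / 2 :> R.
Proof.
have h1 : 1 <= 3 / 2 :> R by lra.
have := GammaE_mul h1 h1; rewrite (_ : 3 / 2 + 3 / 2 = 3); last by field.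
rewrite Gamma3 BetaE_32 (GammaE_fineK h1) -!EFinM => -[] E.
have G0 : 0 <= Gamma (3 / 2) :> R by rewrite GammaEE fine_ge0 // GammaE_ge0.
rewrite -[LHS]ger0_norm // -sqrtr_sqr expr2 E.
rewrite (_ : 2 * (pi / 8) = pi * 2^-1 ^+ 2); last by field.
by rewrite sqrtrM ?pi_ge0 // sqrtr_sqr ger0_norm.
Qed.

(** The semicircle integral of x^2 / (x^2 + t^2) after x^2 = v / (1 + v), a substitution that
    prepares the Beta integral over v. *)
Lemma integral_sc_transform t : 0 < t ->
  (\int[mu]_(v in P)
    (Num.sqrt v / ((v + t ^+ 2 * (1 + v)) * (1 + v) ^+ 2))%:E =
   (pi / 2 * sc_transform t)%:E)%E.
Proof.
move=> t0; have t2 : 0 < t ^+ 2 by rewrite exprn_gt0.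
pose a := Num.sqrt (1 + t ^+ 2); pose c := a / t.
have a2 : a ^+ 2 = 1 + t ^+ 2 by rewrite sqr_sqrtr // addr_ge0 // ltW.
have c2 : c ^+ 2 = 1 + (t ^+ 2)^-1.
  by rewrite expr_div_n a2; field; rewrite gt_eqF.
have c0 : 0 < c by rewrite divr_gt0 // sqrtr_gt0 ltr_pwDl // ltW.
have aE : a = c * t by rewrite divfK // gt_eqF.
(* Antiderivative by partial fractions in u = sqrt v; [c] is chosen so that v + t^2 (1 + v) = t^2 (1
   + (c u)^2). *)
pose g (u : R) := u * (1 + u ^+ 2)^-1 + (1 + 2 * t ^+ 2) * atan u -
  2 * t ^+ 2 * c * atan (c * u).
pose psi (u : R) := u * ((t ^+ 2)^-1 * (1 + (c * u) ^+ 2)^-1) *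
  (1 + u ^+ 2)^-1 ^+ 2.
have dV := is_derive_inv1sqr.
have dl u : is_derive u 1 (fun u => c * u) c.
  by apply: is_derive_eq; rewrite /GRing.scale /= mulr1.
have dVc u := @is_derive1_comp R (fun u : R => (1 + u ^+ 2)^-1) (fun u => c * u)
  u _ _ (dV (c * u)) (dl u).
have da u := @is_derive1_comp R (@atan R) (fun u => c * u)
  u _ _ (is_derive1_atan (c * u)) (dl u).
pose L := 0 + (1 + 2 * t ^+ 2) * (pi / 2) - 2 * t ^+ 2 * c * (pi / 2).
have -> : pi / 2 * sc_transform t = L.
  by rewrite /sc_transform -/a sqrrB a2 aE /L; ring.
have := @integral_sqrt g psi L.
have -> : (\int[mu]_(v in P) (psi (Num.sqrt v))%:E)%E =
  (\int[mu]_(v in P)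
    (Num.sqrt v / ((v + t ^+ 2 * (1 + v)) * (1 + v) ^+ 2))%:E)%E.
  apply: eq_integral => v; rewrite inE => /inP v0.
  rewrite /psi (exprMn _ c) sqr_sqrtr ?(ltW v0) // c2; congr EFin; field.
  have v1 : 0 < 1 + v by rewrite addr_gt0.
  by rewrite !gt_eqF // addr_gt0 // mulr_gt0.
have -> : g 0 = 0 by rewrite /g mulr0 atan0 !mulr0 mul0r addr0 subrr.
rewrite subr0; apply.
- move=> u; have h : 1 + u ^+ 2 != 0 by rewrite derive1V ?sqr_ge0.
  have h2 : 1 + (c * u) ^+ 2 != 0 by rewrite derive1V ?sqr_ge0.
  have tn : t != 0 by rewrite gt_eqF.
  apply: is_derive_eq; rewrite /GRing.scale /psi /=.
  rewrite (_ : 2 * t ^+ 2 * c * (_ * c) =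
    2 * t ^+ 2 * c ^+ 2 * (1 + (c * u) ^+ 2)^-1); last by ring.
  have pos : 0 < u ^+ 2 * (t ^+ 2 + 1) + t ^+ 2.
    by rewrite ltr_wpDl // mulr_ge0 ?sqr_ge0 // addr_ge0 // ltW.
  rewrite (exprMn _ c u) c2; field; rewrite h tn /= gt_eqF //; lra.
- apply: (@is_derive_continuous psi ('D_1 psi)) => u.
  by apply: derivableP; apply: ex_derive.
- have p1 x : 0 <= (1 + x ^+ 2)^-1 by rewrite invr_ge0 addr_ge0 ?sqr_ge0.
  move=> u u0; apply: mulr_ge0; last by rewrite exprn_ge0.
  by rewrite !mulr_ge0 // invr_ge0 ltW.
- rewrite /L; apply: cvgB.
    apply: cvgD.
      apply: cvgy_rational => u u0; have ui : 0 < u^-1 by rewrite invr_gt0.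
      have D0 : 0 < 1 + u ^+ 2 by rewrite ltr_pwDl ?sqr_ge0.
      rewrite ger0_norm ?divr_ge0 ?(ltW u0) ?(ltW D0) // ler_pdivrMr //.
      have -> : u^-1 * (1 + u ^+ 2) = u^-1 + u by field; rewrite gt_eqF.
      by rewrite lerDr ltW.
    by apply: cvgMr; exact: cvgy_atan.
  apply: cvgMr; apply: (@cvg_comp _ _ _ (fun u => c * u) atan _ +oo).
    exact: gt0_cvgMry.
  exact: cvgy_atan.
Qed.

End SemicircleIntegrals.

(** * Absolute powers as integrals of rational kernels *)

Section Kernel.
Variable R : realType.
Implicit Types (a b c p x y t u v : R).
Local Notation mu := (@lebesgue_measure R).
Local Notation P := (`]0%R, +oo[%classic : set R).

Let inP x : P x -> 0 < x.
Proof. by rewrite /= in_itv /= andbT. Qed.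

Let mP : measurable P. Proof. exact: measurable_itv. Qed.

Lemma integral_pos_gt0 (f : R -> R) (m : R) : 0 < m -> measurable_fun P f ->
  (forall x, 0 < x -> 0 <= f x) -> (forall x, 1 <= x -> x <= 2 -> m <= f x) ->
  (0 < \int[mu]_(x in P) (f x)%:E)%E.
Proof.
move=> m0 mf f0 fm.
have sub : (`[1, 2]%classic : set R) `<=` P.
  by move=> x; rewrite /= !in_itv /= andbT => /andP[x1 _]; exact: lt_le_trans x1.
have m12 : measurable (`[1, 2]%classic : set R) by exact: measurable_itv.
apply: (@lt_le_trans _ _ (\int[mu]_(x in `[1%R, 2%R]) m%:E)%E).
  rewrite integral_cst //= lebesgue_measure_itv /= lte_fin ltr1n -EFinB -EFinM.
  by rewrite lte_fin mulr_gt0 // subr_gt0 ltr1n.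
apply: (@le_trans _ _ (\int[mu]_(x in `[1%R, 2%R]) (f x)%:E)%E).
  apply: ge0_le_integral => //.
  - by move=> x _; rewrite lee_fin ltW.
  - by apply/measurable_EFinP; exact: measurable_funS sub mf.
  - move=> x /=; rewrite in_itv /= => /andP[x1 x2]; rewrite lee_fin; exact: fm.
apply: ge0_subset_integral => //; first exact/measurable_EFinP.
by move=> x /inP x0; rewrite lee_fin f0.
Qed.

Let powR_ge1 p x : 0 <= p -> 1 <= x -> 1 <= x `^ p.
Proof.
move=> p0 x1; rewrite -[leLHS](powRr0 x).
by apply: ler_powR.
Qed.

Lemma Gamma_gt0 a : 1 <= a -> 0 < Gamma a.
Proof.
move=> a1; rewrite -lte_fin -GammaE_fineK //.
apply: (@integral_pos_gt0 _ (expR (- 2))); first exact: expR_gt0.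
- by apply: measurable_funTS; exact: measurable_Gamma_fun.
- by move=> x _; rewrite mulr_ge0 ?powR_ge0 ?expR_ge0.
- move=> x x1 x2; rewrite -[leLHS]mul1r ler_pM ?expR_ge0 //.
    by apply: powR_ge1; rewrite ?subr_ge0.
  by rewrite ler_expR lerN2.
Qed.

(** The constant relating |x|^p to its integral representation. Only 0 < [kerE p] < +oo matters,
    since it cancels in the comparison of moments. *)
Definition kerE p : \bar R :=
  (\int[mu]_(t in P) (t `^ (p - 1) / (1 + t ^+ 2))%:E)%E.

Let add_sqr_gt0 c t : 0 < c -> 0 < c + t ^+ 2.
Proof. by move=> c0; rewrite ltr_pwDl ?sqr_ge0. Qed.

Let continuous_inv_sqr c : 0 < c -> continuous (fun t => (c + t ^+ 2)^-1).
Proof.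
move=> c0 t; apply: cvgV; first by rewrite gt_eqF // add_sqr_gt0.
by apply: cvgD; [exact: cvg_cst|exact: exprn_continuous].
Qed.

Lemma measurable_ker_fun p c : 0 < c ->
  measurable_fun setT (fun t => t `^ (p - 1) / (c + t ^+ 2)).
Proof.
move=> c0; apply: measurable_funM => //.
by apply: continuous_measurable_fun; exact: continuous_inv_sqr.
Qed.

Lemma measurable_ker_fun2 p x :
  measurable_fun setT (fun t => t `^ (p - 1) * (x ^+ 2 / (x ^+ 2 + t ^+ 2))).
Proof.
apply: measurable_funM => //; apply: measurable_funM => //.
apply: measurable_fun_ge0V; first by move=> t; rewrite addr_ge0 ?sqr_ge0.
by apply: measurable_funD => //; exact: measurable_funX.
Qed.

Lemma kerE_gt0 p : 1 <= p -> (0 < kerE p)%E.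
Proof.
move=> p1; apply: (@integral_pos_gt0 _ 5^-1) => //.
- by apply: measurable_funTS; exact: measurable_ker_fun.
- move=> x _; rewrite mulr_ge0 ?powR_ge0 // invr_ge0 ltW //; exact: add_sqr_gt0.
- move=> x x1 x2; rewrite -[leLHS]mul1r ler_pM //.
    by apply: powR_ge1; rewrite ?subr_ge0.
  by rewrite lef_pV2 ?posrE ?add_sqr_gt0 //; nra.
Qed.

(** As (1 + t)^2 <= 2 (1 + t^2), the integrand is at most 2 (1 + t)^(p - 3), which has an explicit
    antiderivative; its decay at infinity is where p < 2 enters. *)
Lemma kerE_lty p : 1 <= p -> p < 2 -> (kerE p < +oo)%E.
Proof.
move=> p1 p2.
have q0 : 2 - p != 0 by rewrite subr_eq0 gt_eqF.
pose F x := - (2 - p)^-1 * (1 + x) `^ (p - 2).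
pose f x := (1 + x) `^ (p - 3).
have dF x : 0 <= x -> is_derive x 1 F (f x).
  move=> x0; have x1 : 0 < 1 + x by rewrite ltr_pwDl.
  have d1 : is_derive x 1 (fun x => 1 + x) (1 : R).
    by apply: is_derive_eq; rewrite add0r mulr1.
  have := @is_derive1_comp R (@powR R ^~ (p - 2)) (fun x => 1 + x) x _ _
    (is_derive1_powR (p - 2) x1) d1.
  move=> h; rewrite /F; apply: is_derive_eq; rewrite /GRing.scale /=.
  rewrite (_ : p - 2 - 1 = p - 3); last by ring.
  by rewrite /f; field.
have cf : {within `[0, +oo[, continuous f}.
  have cfx x : 0 <= x -> {for x, continuous f}.
    move=> x0; have x1 : 0 < 1 + x by rewrite ltr_pwDl.
    apply: (@continuous_comp _ _ _ (fun x => 1 + x) (@powR R ^~ (p - 3))).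
      by apply: cvgD; [exact: cvg_cst|exact: cvg_id].
    apply: differentiable_continuous; apply/derivable1_diffP.
    by have [] := is_derive1_powR (p - 3) x1.
  apply/continuous_within_itvcyP; split.
    by move=> x; rewrite in_itv /= andbT => x0; apply: cfx; exact: ltW.
  by apply: cvg_at_right_filter; exact: cfx.
have mf : measurable_fun P f.
  apply: measurable_funTS; apply: (measurableT_comp (measurable_powR _)).
  exact: measurable_funD.
have intf : (\int[mu]_(x in P) (f x)%:E = (0 - F 0)%:E)%E.
  rewrite integral_itv_obnd_cbnd; last exact/measurable_EFinP.
  rewrite (@ge0_continuous_FTC2y _ f F 0 0).
  - by rewrite EFinB.
  - by move=> x _; exact: powR_ge0.
  - exact: cf.
  - rewrite -[X in _ --> X](mulr0 (- (2 - p)^-1)); apply: cvgMr.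
    rewrite (_ : (fun x => _) = (fun x => ((1 + x) `^ (2 - p))^-1)); last first.
      by apply/funext => x; rewrite -powRN opprB.
    apply: ((gtr0_cvgV0 (f := fun x => (1 + x) `^ (2 - p)) _).2 _).
      near=> x; have x0 : 0 < x by near: x; exact: nbhs_pinfty_gt.
      by rewrite powR_gt0 // addr_gt0.
    apply/cvgryPge => A; near=> x.
    apply: (@le_trans _ _ ((`|A| `^ (2 - p)^-1) `^ (2 - p))).
      by rewrite -powRrM mulVf // powRr1 ?ler_norm.
    have x0 : 0 <= x by near: x; exact: nbhs_pinfty_ge.
    have q1 : 0 <= 2 - p by rewrite subr_ge0 ltW.
    have x1 : 0 <= 1 + x by rewrite addr_ge0.
    apply: ge0_ler_powR; rewrite ?nnegrE ?powR_ge0 //.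
    rewrite (@le_trans _ _ x) ?lerDr //; near: x; exact: nbhs_pinfty_ge.
  - by move=> x x0; have [] := dF x (ltW x0).
  - apply: cvg_at_right_filter; apply: differentiable_continuous.
    by apply/derivable1_diffP; have [] := dF 0 (lexx 0).
  - move=> x; rewrite in_itv /= andbT => x0; rewrite derive1E.
    by have dFx := dF x (ltW x0); rewrite derive_val.
apply: (@le_lt_trans _ _ (\int[mu]_(x in P) (2 * f x)%:E)%E).
  apply: ge0_le_integral => //.
  - move=> x _; rewrite lee_fin mulr_ge0 ?powR_ge0 // invr_ge0 ltW //.
    exact: add_sqr_gt0.
  - by apply/measurable_EFinP; apply: measurable_funTS; exact: measurable_ker_fun.
  - by apply/measurable_EFinP; apply: measurable_funM.
  - move=> x /inP x0; rewrite lee_fin ler_pdivrMr ?add_sqr_gt0 //.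
    have x1 : 0 < 1 + x by rewrite addr_gt0.
    have -> : f x = (1 + x) `^ (p - 1) * (1 + x) ^- 2.
      rewrite /f (_ : p - 3 = (p - 1) + - 2%:R); last by ring.
      by rewrite powRD ?(gt_eqF x1) ?implybT // powR_invn ?(ltW x1).
    rewrite (_ : 2 * _ * _ = (1 + x) `^ (p - 1) *
      (2 * (1 + x ^+ 2) / (1 + x) ^+ 2)); last by ring.
    rewrite -[leLHS]mulr1 ler_pM ?powR_ge0 //.
      by apply: ge0_ler_powR; rewrite ?nnegrE ?subr_ge0 ?(ltW x0) ?(ltW x1) ?lerDr.
    by rewrite ler_pdivlMr ?exprn_gt0 // mul1r; have := sqr_ge0 (1 - x); lra.
under eq_integral do rewrite EFinM.
rewrite ge0_integralZl_EFin //; last exact/measurable_EFinP.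
  by rewrite intf -EFinM ltry.
by move=> x _; rewrite lee_fin powR_ge0.
Unshelve. all: by end_near. Qed.

Lemma kerE_fineK p : 1 <= p -> p < 2 -> kerE p = (fine (kerE p))%:E.
Proof.
by move=> p1 p2; rewrite fineK // ge0_fin_numE ?kerE_lty // ltW // kerE_gt0.
Qed.

Lemma integral_ker p x : 1 <= p ->
  (\int[mu]_(t in P) (t `^ (p - 1) * (x ^+ 2 / (x ^+ 2 + t ^+ 2)))%:E =
   (`|x| `^ p)%:E * kerE p)%E.
Proof.
move=> p1; have [->|x0] := eqVneq x 0.
  rewrite normr0 powR0 ?gt_eqF ?(lt_le_trans ltr01) // mul0e.
  by rewrite integral0_eq // => t _; rewrite expr0n /= mul0r mulr0.
have nx : 0 < `|x| by rewrite normr_gt0.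
have x2 : 0 < x ^+ 2 by rewrite -real_normK ?num_real // exprn_gt0.
rewrite (@scale_pos _ (fun t => t `^ (p - 1) * (x ^+ 2 / (x ^+ 2 + t ^+ 2)))
  `|x|) //; last 2 first.
- apply: within_continuousM.
    by apply: within_continuous_powR; rewrite subr_ge0.
  by apply: continuous_subspaceT => t; apply: cvgMr; exact: continuous_inv_sqr.
- move=> t _; rewrite mulr_ge0 ?powR_ge0 // divr_ge0 ?(ltW x2) // ltW //.
  exact: add_sqr_gt0.
have mk : measurable_fun P (fun t => (t `^ (p - 1) / (1 + t ^+ 2))%:E).
  by apply/measurable_EFinP; apply: measurable_funTS; exact: measurable_ker_fun.
have k0 t : P t -> (0 <= (t `^ (p - 1) / (1 + t ^+ 2))%:E)%E.
  move=> _; rewrite lee_fin mulr_ge0 ?powR_ge0 // invr_ge0 ltW //.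
  exact: add_sqr_gt0.
rewrite -(ge0_integralZl_EFin mu mP k0 mk) ?powR_ge0 //.
apply: eq_integral => t; rewrite inE => /inP t0; rewrite -EFinM; congr EFin.
rewrite powRM ?(ltW nx) ?(ltW t0) // exprMn real_normK ?num_real //.
rewrite -[in RHS](@mulr_powRB1 _ `|x|) ?(ltW nx) //; last exact: lt_le_trans p1.
by field; rewrite ?gt_eqF ?add_sqr_gt0 //= ?x0 ?mulf_neq0 //.
Qed.

End Kernel.

(** * Absolute moments of the semicircle law *)

Section ScMoment.
Variables (R : realType) (p : R).
Hypothesis p1 : 1 <= p.
Implicit Types (t v : R).
Local Notation mu := (@lebesgue_measure R).
Local Notation P := (`]0%R, +oo[%classic : set R).

Let inP x : P x -> 0 < x.
Proof. by rewrite /= in_itv /= andbT. Qed.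

Let mP : measurable P. Proof. exact: measurable_itv. Qed.

(* The absolute value makes the integrand nonnegative on the whole plane. *)
Let k (z : R * R) : R := 2 / pi * z.1 `^ (p - 1) *
  (Num.sqrt `|z.2| / ((`|z.2| + z.1 ^+ 2 * (1 + `|z.2|)) * (1 + `|z.2|) ^+ 2)).

Let c0 : 0 <= 2 / pi :> R. Proof. by rewrite divr_ge0 // pi_ge0. Qed.

Let den_ge0 (z : R * R) :
  0 <= (`|z.2| + z.1 ^+ 2 * (1 + `|z.2|)) * (1 + `|z.2|) ^+ 2.
Proof.
by rewrite mulr_ge0 ?sqr_ge0 // addr_ge0 // mulr_ge0 ?sqr_ge0 // addr_ge0.
Qed.

Let k_ge0 z : 0 <= k z.
Proof.
apply: mulr_ge0; first by rewrite mulr_ge0 ?powR_ge0.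
by rewrite divr_ge0 ?sqrtr_ge0 // den_ge0.
Qed.

Let m1 : measurable_fun setT (fun z : R * R => z.1).
Proof. exact: measurable_fst. Qed.

Let m2 : measurable_fun setT (fun z : R * R => `|z.2|).
Proof.
have mn : measurable_fun setT (fun x : R => `|x|).
  by apply: continuous_measurable_fun; exact: norm_continuous.
exact: (measurableT_comp mn measurable_snd).
Qed.

Let mk : measurable_fun setT k.
Proof.
apply: measurable_funM.
  by apply: measurable_funM => //; exact: (measurableT_comp (measurable_powR _) m1).
apply: measurable_funM.
  have ms : measurable_fun setT (@Num.sqrt R).
    by apply: continuous_measurable_fun; exact: sqrt_continuous.
  exact: (measurableT_comp ms m2).
apply: measurable_fun_ge0V; first exact: den_ge0.
apply: measurable_funM; last by apply: measurable_funX; exact: measurable_funD.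
apply: measurable_funD => //.
by apply: measurable_funM; [exact: measurable_funX|exact: measurable_funD].
Qed.

Let a := (p + 1) / 2.

(** With x^2 = v / (1 + v) the t-integral is that of [integral_ker], and the factor |x|^p turns the
    remaining weight into the integrand of [BetaE a (3 / 2)]; this dictates the choice of [a]. *)
Let swapped v : 0 < v -> (\int[mu]_(t in P) (k (t, v))%:E =
  kerE p * (2 / pi)%:E * (v `^ (a - 1) * (1 + v) `^ (- (a + 3 / 2)))%:E)%E.
Proof.
move=> v0; have v1 : 0 < 1 + v by rewrite addr_gt0.
pose x := Num.sqrt (v / (1 + v)).
have q0 : 0 < v / (1 + v) by rewrite divr_gt0.
have x0 : 0 <= x by exact: sqrtr_ge0.
have x2 : x ^+ 2 = v / (1 + v) by rewrite sqr_sqrtr // ltW.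
pose c := 2 / pi * (Num.sqrt v / (v * (1 + v) ^+ 2)).
have c1 : 0 <= c.
  by rewrite mulr_ge0 // divr_ge0 ?sqrtr_ge0 // mulr_ge0 ?sqr_ge0 // ltW.
have E t : (k (t, v))%:E = (c%:E * (t `^ (p - 1) * (x ^+ 2 / (x ^+ 2 + t ^+ 2)))%:E)%E.
  rewrite -EFinM /k /= gtr0_norm // x2 /c; congr EFin.
  have h : v + t ^+ 2 * (1 + v) != 0.
    by rewrite gt_eqF // ltr_pwDl // mulr_ge0 ?sqr_ge0 // ltW.
  move: (2 / pi) => q; field; rewrite (gt_eqF v1) (gt_eqF v0) /= ?andbT //.
under eq_integral do rewrite E.
have p0 t : P t -> (0 <= (t `^ (p - 1) * (x ^+ 2 / (x ^+ 2 + t ^+ 2)))%:E)%E.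
  by rewrite lee_fin mulr_ge0 ?powR_ge0 // divr_ge0 ?addr_ge0 ?sqr_ge0.
have m0 : measurable_fun P
    (fun t => (t `^ (p - 1) * (x ^+ 2 / (x ^+ 2 + t ^+ 2)))%:E).
  by apply/measurable_EFinP; apply: measurable_funTS; exact: measurable_ker_fun2.
rewrite (ge0_integralZl_EFin mu mP p0 m0) //.
rewrite integral_ker // muleA muleC -muleA; congr (_ * _)%E.
rewrite -!EFinM /c -(mulrA (2 / pi)); congr (_ * _)%:E.
rewrite ger0_norm // /x -(powR12_sqrt (ltW q0)) -powRrM.
rewrite -(powR12_sqrt (ltW v0)).
have vN : v `^ (-1) = v^-1 by rewrite powR_inv1 // ltW.
have vN1 : (1 + v) `^ (- 2%:R) = (1 + v) ^- 2 by rewrite powR_invn // ltW.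
have vN2 : ((1 + v)^-1) `^ (2^-1 * p) = (1 + v) `^ (- (2^-1 * p)).
  by rewrite -[in LHS]powR_inv1 ?(ltW v1) // -powRrM mulN1r.
rewrite powRM ?(ltW v0) ?invr_ge0 ?(ltW v1) // vN2.
rewrite (_ : a - 1 = 2^-1 + -1 + 2^-1 * p); last by rewrite /a; field.
rewrite (_ : - (a + 3 / 2) = - 2%:R + - (2^-1 * p)); last by rewrite /a; field.
have vD (y r s : R) : 0 < y -> y `^ (r + s) = y `^ r * y `^ s.
  by move=> y0; rewrite powRD // (gt_eqF y0) implybT.
rewrite (vD v) // (vD v) // (vD (1 + v)) // vN vN1.
by field; rewrite !gt_eqF.
Qed.

(** The factor after [kerE p] is the p-th absolute moment of the semicircle law: 2 / pi times a Beta
    value, where Gamma(3/2) = sqrt pi / 2 leaves 1 / sqrt pi. *)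
Lemma integral_sc_moment :
  (\int[mu]_(t in P) (t `^ (p - 1) * sc_transform t)%:E =
   kerE p * ((Num.sqrt pi)^-1 *
     (Gamma (p / 2 + 1 / 2) / Gamma (p / 2 + 2)))%:E)%E.
Proof.
have pi0 : 0 < pi :> R := pi_gt0 R.
transitivity (\int[mu]_(t in P) \int[mu]_(v in P) (k (t, v))%:E)%E.
  apply: eq_integral => t; rewrite inE => /inP t0.
  have H (q A B : R) : q != 0 -> A * B = 2 / q * A * (q / 2 * B).
    by move=> qN; field.
  rewrite (H pi) ?gt_eqF // EFinM -integral_sc_transform //.
  transitivity ((2 / pi * t `^ (p - 1))%:E * \int[mu]_(v in P) (Num.sqrt `|v| /
        ((`|v| + t ^+ 2 * (1 + `|v|)) * (1 + `|v|) ^+ 2))%:E)%E.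
    congr (_ * _)%E; apply: eq_integral => v; rewrite inE => /inP v0.
    by rewrite gtr0_norm.
  have ct : 0 <= 2 / pi * t `^ (p - 1) by rewrite mulr_ge0 ?powR_ge0.
  rewrite -ge0_integralZl_EFin //.
  - by move=> v _; rewrite lee_fin divr_ge0 ?sqrtr_ge0 // (den_ge0 (t, v)).
  - have mn : measurable_fun setT (fun x : R => `|x|).
      by apply: continuous_measurable_fun; exact: norm_continuous.
    have ms : measurable_fun setT (@Num.sqrt R).
      by apply: continuous_measurable_fun; exact: sqrt_continuous.
    apply/measurable_EFinP; apply: measurable_funTS; apply: measurable_funM.
      exact: (measurableT_comp ms mn).
    apply: measurable_fun_ge0V; first by move=> v; exact: (den_ge0 (t, v)).
    apply: measurable_funM; last by apply: measurable_funX; exact: measurable_funD.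
    apply: measurable_funD => //; apply: measurable_funM => //.
    exact: measurable_funD.
rewrite (tonelli_pos mk k_ge0).
transitivity (kerE p * (2 / pi)%:E * BetaE a (3 / 2))%E.
  rewrite -ge0_integralZl //.
  - by apply: eq_integral => v; rewrite inE => /inP v0; rewrite swapped.
  - apply/measurable_EFinP; apply: measurable_funTS; apply: measurable_funM => //.
    apply: (measurableT_comp (measurable_powR _)).
    exact: measurable_funD.
  - by move=> v _; rewrite lee_fin mulr_ge0 ?powR_ge0.
  - by rewrite mule_ge0 // ltW // kerE_gt0.
have a1 : 1 <= a by rewrite /a; have := p1; lra.
have b1 : 1 <= 3 / 2 :> R by lra.
have ab1 : 1 <= a + 3 / 2 by lra.
have := GammaE_mul a1 b1; rewrite !GammaE_fineK // Gamma32.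
have Gab := Gamma_gt0 ab1.
rewrite -EFinM => /(congr1 (fun x => ((Gamma (a + 3 / 2))^-1%:E * x)%E)).
rewrite muleA -!EFinM mulVf ?gt_eqF // mul1e => <-.
rewrite -muleA; congr (_ * _)%E; rewrite -EFinM; congr EFin.
rewrite (_ : p / 2 + 1 / 2 = a); last by rewrite /a; field.
rewrite (_ : p / 2 + 2 = a + 3 / 2); last by rewrite /a; field.
have H (s q A B : R) : s != 0 -> q = s ^+ 2 -> B != 0 ->
    2 / q * (B^-1 * (A * (s / 2))) = s^-1 * (A / B).
  by move=> sN -> BN; field; rewrite BN sN.
apply: H; rewrite ?gt_eqF ?sqrtr_gt0 //.
by rewrite sqr_sqrtr // ltW.
Qed.

End ScMoment.

Lemma sum_singular_values (R : realType) (p : R) (n : nat) (G : sgraph n) :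
  \sum_(s <- singular_values R G) s `^ p =
  \sum_(x <- eigenvalues (adjmx R G)) `|x| `^ p.
Proof. by rewrite /singular_values (perm_big _ (permEl (perm_sort _ _))) big_map. Qed.

Lemma mxtrace_adjmx_sqr (R : nzRingType) (n : nat) (G : sgraph n) :
  \tr (adjmx R G *m adjmx R G) = \sum_i \sum_j adjmx R G i j.
Proof.
apply: eq_bigr => i _; rewrite mxE; apply: eq_bigr => j _.
have -> : adjmx R G j i = adjmx R G i j by rewrite -{1}(adjmx_sym R G) mxE.
by rewrite !mxE; case: (Defs.adjacent G i j); rewrite ?mulr1 ?mulr0.
Qed.

(** * Exponents below two *)

Section SmallExponent.
Variables (R : realType) (p : R).
Hypotheses (p1 : 1 <= p) (p2 : p < 2).
Implicit Types (t : R) (n : nat).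
Local Notation mu := (@lebesgue_measure R).
Local Notation P := (`]0%R, +oo[%classic : set R).

Let inP x : P x -> 0 < x.
Proof. by rewrite /= in_itv /= andbT. Qed.

Let mP : measurable P. Proof. exact: measurable_itv. Qed.

(** With a = sqrt (1 + t^2) one has (a - t) (a + t) = 1 and (a + t)^2 >= 1 + t^2. The factor 2
    matches the bound for [graph_transform]. *)
Lemma sc_transform_bound t : 0 < t ->
  0 <= sc_transform t <= 2 * (1 + t ^+ 2)^-1.
Proof.
move=> t0; rewrite sqr_ge0 /=.
have t2 : 0 < 1 + t ^+ 2 by rewrite ltr_pwDl ?sqr_ge0.
rewrite ler_pdivlMr // /sc_transform.
have := sqr_sqrtr (ltW t2); have := sqrtr_ge0 (1 + t ^+ 2).
set a := Num.sqrt _ => a0 a2.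
have ta : 0 < t * a ^+ 2 by rewrite a2 mulr_gt0.
have E : (a - t) ^+ 2 * (a + t) ^+ 2 = 1.
  by rewrite -exprMn -subr_sqr a2 addrK expr1n.
have : (a - t) ^+ 2 * (1 + t ^+ 2) <= (a - t) ^+ 2 * (a + t) ^+ 2.
  by rewrite ler_wpM2l ?sqr_ge0 // -a2 lerXn2r ?nnegrE ?addr_ge0 ?lerDl // ltW.
by rewrite E; lra.
Qed.

Lemma sum_eigenvalues_sqr_le n (G : sgraph n) :
  \sum_(x <- eigenvalues (adjmx R G)) x ^+ 2 <= n%:R ^+ 2.
Proof.
rewrite sum_eigenvalues_sqr ?adjmx_sym // mxtrace_adjmx_sqr.
apply: (@le_trans _ _ (\sum_(i < n) \sum_(j < n) 1)).
  by apply: ler_sum => i _; apply: ler_sum => j _; rewrite mxE lern1 leq_b1.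
by under eq_bigr do rewrite sumr_const card_ord;
  rewrite sumr_const card_ord expr2 mulr_natr.
Qed.

(** The transform is at most 1, as a mean of numbers below 1, and at most t^-2, because the trace of
    A^2 is at most n^2; the two bounds add up. The outlying top eigenvalue is covered, so the
    domination is uniform over all graphs. *)
Lemma graph_transform_bound n t (G : sgraph n) : 0 < t ->
  0 <= graph_transform t G <= 2 * (1 + t ^+ 2)^-1.
Proof.
move=> t0; have t2 : 0 < t ^+ 2 by rewrite exprn_gt0.
have t21 : 0 < 1 + t ^+ 2 by rewrite addr_gt0.
have [n0|n0] := posnP n.
  rewrite /graph_transform big1_seq ?lexx ?mulr_ge0 ?invr_ge0 ?(ltW t21) //.
  by move=> x _; rewrite n0 mul0r invr0 mulr0.
have N0 : 0 < n%:R :> R by rewrite ltr0n.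
have den x : 0 < x ^+ 2 + n%:R * t ^+ 2.
  by rewrite ltr_wpDl ?sqr_ge0 // mulr_gt0.
have ge0 : 0 <= graph_transform t G.
  by apply: sumr_ge0 => x _; rewrite divr_ge0 ?sqr_ge0 // mulr_ge0 // ltW.
rewrite ge0 /=.
have le1 : graph_transform t G <= 1.
  have one : \sum_(x <- eigenvalues (adjmx R G)) n%:R^-1 = 1 :> R.
    rewrite big_const_seq count_predT (size_eigenvalues (adjmx_sym R G)) iter_addr_0.
    by rewrite -[LHS]mulr_natr mulVf // gt_eqF.
  rewrite -one; apply: ler_sum => x _.
  rewrite ler_pdivrMr ?mulr_gt0 // mulKf ?gt_eqF // lerDl.
  by rewrite mulr_ge0 // ltW.
have le2 : graph_transform t G * t ^+ 2 <= 1.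
  apply: (@le_trans _ _ (\sum_(x <- eigenvalues (adjmx R G)) x ^+ 2 / n%:R ^+ 2)).
    rewrite mulr_suml; apply: ler_sum => x _.
    rewrite -(mulrA (x ^+ 2)) ler_wpM2l ?sqr_ge0 // invfM -mulrA.
    rewrite (_ : (n%:R ^+ 2)^-1 = n%:R^-1 * n%:R^-1); last by rewrite -invfM.
    rewrite ler_wpM2l ?invr_ge0 // mulrC ler_pdivrMr //.
    by rewrite mulrDr mulKf ?gt_eqF // lerDr mulr_ge0 ?sqr_ge0 ?invr_ge0.
  rewrite -mulr_suml ler_pdivrMr ?exprn_gt0 // mul1r.
  exact: sum_eigenvalues_sqr_le.
by rewrite ler_pdivlMr //; lra.
Qed.

Let X n (G : sgraph n) : R :=
  \sum_(x <- eigenvalues (adjmx R G)) n%:R^-1 * `|x / Num.sqrt n%:R| `^ p.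

Lemma graph_transformE n t (G : sgraph n) : (0 < n)%N ->
  graph_transform t G = \sum_(x <- eigenvalues (adjmx R G)) n%:R^-1 *
   ((x / Num.sqrt n%:R) ^+ 2 / ((x / Num.sqrt n%:R) ^+ 2 + t ^+ 2)).
Proof.
move=> n0; have N0 : 0 < n%:R :> R by rewrite ltr0n.
apply: eq_bigr => x _; rewrite expr_div_n sqr_sqrtr ?(ltW N0) //.
have -> : x ^+ 2 / n%:R + t ^+ 2 = (x ^+ 2 + n%:R * t ^+ 2) / n%:R.
  by field; rewrite gt_eqF.
rewrite !invfM invrK; move: (_ + _)^-1 => b.
by field; rewrite gt_eqF.
Qed.

Lemma integral_graph_transform n (G : sgraph n) : (0 < n)%N ->
  (\int[mu]_(t in P) (t `^ (p - 1) * graph_transform t G)%:E =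
   (X G)%:E * kerE p)%E.
Proof.
move=> n0; have N0 : 0 < n%:R :> R by rewrite ltr0n.
pose f x t := t `^ (p - 1) * (x ^+ 2 / (x ^+ 2 + t ^+ 2)).
have f0 x t : P t -> (0 <= (n%:R^-1 * f x t)%:E)%E.
  move=> _; rewrite lee_fin mulr_ge0 ?invr_ge0 ?(ltW N0) // mulr_ge0 ?powR_ge0 //.
  by rewrite divr_ge0 ?addr_ge0 ?sqr_ge0.
have mf x : measurable_fun P (fun t => (n%:R^-1 * f x t)%:E).
  apply/measurable_EFinP; apply: measurable_funTS; apply: measurable_funM => //.
  exact: measurable_ker_fun2.
pose y (x : R) := x / Num.sqrt n%:R.
transitivity (\int[mu]_(t in P) \sum_(x <- eigenvalues (adjmx R G))
    (n%:R^-1 * f (y x) t)%:E)%E.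
  apply: eq_integral => t _; rewrite graph_transformE // sumEFin mulr_sumr.
  by congr EFin; apply: eq_bigr => x _; rewrite mulrCA.
rewrite (ge0_integral_sum mu mP (fun x => mf (y x)) (fun x => f0 (y x))).
rewrite /X -sumEFin ge0_sume_distrl; last first.
  by move=> x _; rewrite lee_fin mulr_ge0 ?invr_ge0 ?powR_ge0 ?(ltW N0).
apply: eq_bigr => x _.
under eq_integral do rewrite EFinM.
have ff t : P t -> (0 <= (f (y x) t)%:E)%E.
  by rewrite lee_fin mulr_ge0 ?powR_ge0 // divr_ge0 ?addr_ge0 ?sqr_ge0.
have mff : measurable_fun P (fun t => (f (y x) t)%:E).
  by apply/measurable_EFinP; apply: measurable_funTS; exact: measurable_ker_fun2.
rewrite (ge0_integralZl_EFin mu mP ff mff) ?invr_ge0 ?(ltW N0) //.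
by rewrite integral_ker // EFinM muleA.
Qed.


(** A one-sided triangle inequality, additive so that no difference of possibly infinite integrals
    has to be formed. *)
Lemma integral_le_dist (f g : R -> R) : measurable_fun setT f ->
  measurable_fun setT g -> (forall t, 0 < t -> 0 <= f t) ->
  (forall t, 0 < t -> 0 <= g t) ->
  (\int[mu]_(t in P) (f t)%:E <=
   \int[mu]_(t in P) (g t)%:E + \int[mu]_(t in P) (`|f t - g t|)%:E)%E.
Proof.
move=> mf mg f0 g0.
have mE (u : R -> R) : measurable_fun setT u ->
    measurable_fun P (fun t => (u t)%:E).
  by move=> mu0; apply/measurable_EFinP; exact: measurable_funTS.
have md : measurable_fun setT (fun t => `|f t - g t|).
  have mn : measurable_fun setT (fun x : R => `|x|).
    by apply: continuous_measurable_fun; exact: norm_continuous.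
  by apply: (measurableT_comp mn); exact: measurable_funB.
rewrite -ge0_integralD //.
- apply: ge0_le_integral => //.
  + by move=> t /inP t0; rewrite lee_fin f0.
  + exact: mE.
  + by apply: (mE (fun t => g t + `|f t - g t|)); exact: measurable_funD.
  + move=> t _; rewrite -EFinD lee_fin -lerBlDl; exact: ler_norm.
- by move=> t /inP t0; rewrite lee_fin g0.
- exact: mE.
- exact: (mE (fun t => `|f t - g t|)).
Qed.

Let mgt n (G : sgraph n) :
  measurable_fun setT (fun t : R => graph_transform t G).
Proof.
apply: measurable_sum => x; apply: measurable_funM => //.
apply: measurable_fun_ge0V.
  by move=> t; rewrite mulr_ge0 // addr_ge0 ?sqr_ge0 // mulr_ge0 // sqr_ge0.
apply: measurable_funM => //; apply: measurable_funD => //.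
by apply: measurable_funM => //; exact: measurable_funX.
Qed.

Let msc : measurable_fun setT (@sc_transform R).
Proof.
apply: measurable_funX; apply: measurable_funB => //.
have ms : measurable_fun setT (@Num.sqrt R).
  by apply: continuous_measurable_fun; exact: sqrt_continuous.
by apply: (measurableT_comp ms); apply: measurable_funD => //; exact: measurable_funX.
Qed.

Let mdist n (G : sgraph n) :
  measurable_fun setT (fun t : R => `|graph_transform t G - sc_transform t|).
Proof.
have mn : measurable_fun setT (fun x : R => `|x|).
  by apply: continuous_measurable_fun; exact: norm_continuous.
by apply: (measurableT_comp mn); exact: measurable_funB.
Qed.

Let c : R := (Num.sqrt pi)^-1 * (Gamma (p / 2 + 1 / 2) / Gamma (p / 2 + 2)).
Let kap : R := fine (kerE p).

Let kapE : kerE p = kap%:E. Proof. exact: kerE_fineK. Qed.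

(** Both the spectral moment and its limit, multiplied by [kap], are integrals of the respective
    transform against t^(p-1), so their distance is bounded by a weighted L1 distance of
    transforms. *)
Lemma moment_dist_le n (G : sgraph n) : (0 < n)%N ->
  ((`|X G - c| * kap)%:E <=
   \int[mu]_(t in P)
     (t `^ (p - 1) * `|graph_transform t G - sc_transform t|)%:E)%E.
Proof.
move=> n0; have k0 : 0 <= kap by rewrite fine_ge0 // ltW // kerE_gt0.
have m1 : measurable_fun setT (fun t : R => t `^ (p - 1) * graph_transform t G).
  exact: measurable_funM.
have m2 : measurable_fun setT (fun t : R => t `^ (p - 1) * sc_transform t).
  exact: measurable_funM.
have p1' t : 0 < t -> 0 <= t `^ (p - 1) * graph_transform t G.
  by move=> t0; rewrite mulr_ge0 ?powR_ge0 //; case/andP: (graph_transform_bound G t0).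
have p2' t : 0 < t -> 0 <= t `^ (p - 1) * sc_transform t.
  by move=> t0; rewrite mulr_ge0 ?powR_ge0 ?sqr_ge0.
have d1 := integral_le_dist m1 m2 p1' p2'.
have d2 := integral_le_dist m2 m1 p2' p1'.
have E1 : (\int[mu]_(t in P) (`|t `^ (p - 1) * graph_transform t G -
    t `^ (p - 1) * sc_transform t|)%:E = \int[mu]_(t in P)
     (t `^ (p - 1) * `|graph_transform t G - sc_transform t|)%:E)%E.
  apply: eq_integral => t _.
  by rewrite -mulrBr normrM ger0_norm ?powR_ge0.
have E2 : (\int[mu]_(t in P) (`|t `^ (p - 1) * sc_transform t -
    t `^ (p - 1) * graph_transform t G|)%:E = \int[mu]_(t in P)
     (t `^ (p - 1) * `|graph_transform t G - sc_transform t|)%:E)%E.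
  by rewrite -E1; apply: eq_integral => t _; rewrite distrC.
move: d1 d2; rewrite E1 E2 integral_graph_transform // integral_sc_moment //.
rewrite -/c kapE; set I := (\int[mu]_(t in P) _)%E.
have I0 : (0 <= I)%E.
  by apply: integral_ge0 => t _; rewrite lee_fin mulr_ge0 ?powR_ge0.
rewrite -!EFinM; move: I0; case: I => [i|_ _ _|//]; last exact: leey.
rewrite -!EFinD !lee_fin => _ h1 h2.
rewrite -[X in _ * X]ger0_norm // -normrM ler_norml mulrBl (mulrC c).
by apply/andP; split; lra.
Qed.

Lemma expect_moment_dist_le n : (0 < n)%N ->
  ((expect (fun G : sgraph n => `|X G - c|) * kap)%:E <=
   \int[mu]_(t in P) (t `^ (p - 1) * expect (fun G : sgraph n =>
     `|graph_transform t G - sc_transform t|))%:E)%E.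
Proof.
move=> n0; pose N : R := #|sgraph n|%:R.
have N0 : 0 <= N^-1 by rewrite invr_ge0 ltW // card_sgraph_gt0.
pose f (G : sgraph n) t := t `^ (p - 1) * `|graph_transform t G - sc_transform t|.
have f0 G t : P t -> (0 <= (f G t)%:E)%E.
  by rewrite lee_fin mulr_ge0 ?powR_ge0.
have mf G : measurable_fun P (fun t => (f G t)%:E).
  by apply/measurable_EFinP; apply: measurable_funTS; apply: measurable_funM.
have -> : (\int[mu]_(t in P) (t `^ (p - 1) * expect (fun G : sgraph n =>
     `|graph_transform t G - sc_transform t|))%:E =
   N^-1%:E * \sum_(G : sgraph n) \int[mu]_(t in P) (f G t)%:E)%E.
  rewrite -(ge0_integral_sum mu mP mf f0) -ge0_integralZl_EFin //.
  - apply: eq_integral => t _; rewrite sumEFin -EFinM; congr EFin.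
    by rewrite /expect -mulr_sumr mulrA mulrC.
  - by move=> t Pt; apply: sume_ge0 => G _; exact: f0.
  - exact: emeasurable_sum.
rewrite /expect mulrAC mulrC mulr_suml EFinM -sumEFin.
rewrite lee_wpmul2l // lee_sum // => G _; exact: moment_dist_le.
Qed.

(** Dominated convergence in t: the integrand tends to 0 for each t by [cvg_expect_transform], and
    both transforms lie between 0 and 2 / (1 + t^2), which is integrable against t^(p-1) for p <
    2. *)
Lemma cvg_expect_moment :
  expect (fun G : sgraph n => `|X G - c|) @[n --> \oo] --> (0 : R).
Proof.
pose F n t := t `^ (p - 1) * expect (fun G : sgraph n =>
     `|graph_transform t G - sc_transform t|).
have mF n : measurable_fun setT (F n).
  apply: measurable_funM => //; apply: measurable_funM => //.
  exact: measurable_sum.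
have F0 n t : 0 <= F n t.
  by rewrite mulr_ge0 ?powR_ge0 // expect_ge0.
have k0 : 0 < kap by rewrite -lte_fin -kapE kerE_gt0.
have Fg n t : P t -> (`|(F n t)%:E| <= (2 * (t `^ (p - 1) / (1 + t ^+ 2)))%:E)%E.
  move=> /inP t0; rewrite gee0_abs ?lee_fin // mulrCA ler_wpM2l ?powR_ge0 //.
  rewrite -[leRHS](expect_cst n) ler_expect // => G.
  have /andP[g0 gb] := graph_transform_bound G t0.
  have /andP[s0 sb] := sc_transform_bound t0.
  by rewrite ler_norml; apply/andP; split; lra.
have ker0 t : P t -> (0 <= (t `^ (p - 1) / (1 + t ^+ 2))%:E)%E.
  by move=> _; rewrite lee_fin divr_ge0 ?powR_ge0 // addr_ge0 ?sqr_ge0.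
have mker : measurable_fun P (fun t => (t `^ (p - 1) / (1 + t ^+ 2))%:E).
  by apply/measurable_EFinP; apply: measurable_funTS; exact: measurable_ker_fun.
pose dom t := (2 * (t `^ (p - 1) / (1 + t ^+ 2)))%:E.
have ig : mu.-integrable (`]0%R, +oo[%classic) dom.
  apply/integrableP; split.
    apply/measurable_EFinP; apply: measurable_funM => //.
    by apply: measurable_funTS; exact: measurable_ker_fun.
  rewrite (_ : integral _ _ _ = (2 * kap)%:E) ?ltry //.
  rewrite EFinM -kapE -ge0_integralZl_EFin //; apply: eq_integral => t.
  rewrite inE => tP; rewrite /dom gee0_abs ?EFinM //.
  by apply: mule_ge0; [rewrite lee_fin|exact: ker0].
have mFE n : measurable_fun P (fun t => (F n t)%:E).
  by apply/measurable_EFinP; exact: measurable_funTS.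
have F_cvg t : P t -> (F n t)%:E @[n --> \oo] --> (cst 0%E : R -> \bar R) t.
  move=> /inP t0; apply: cvg_EFin; first by near=> n.
  rewrite -(mulr0 (t `^ (p - 1))); apply: cvgMr.
  exact: cvg_expect_transform.
have gfin t : P t -> (2 * (t `^ (p - 1) / (1 + t ^+ 2)))%:E \is a fin_num by [].
have := @dominated_cvg _ _ R mu _ mP (fun n t => (F n t)%:E) (cst 0%E) dom
  mFE F_cvg gfin ig Fg.
rewrite integral0 => /fine_cvgP[Ifin Icvg].
have kcvg : kap^-1 * fine (\int[mu]_(t in P) (F n t)%:E) @[n --> \oo] --> (0 : R).
  by rewrite -[X in _ --> X](mulr0 kap^-1); apply: cvgMr; exact: Icvg.
apply: (@squeeze_cvgr _ _ _ _ (fun=> 0)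
  (fun n => kap^-1 * fine (\int[mu]_(t in P) (F n t)%:E))) => //.
  near=> n; rewrite expect_ge0 //= mulrC ler_pdivlMr // -lee_fin fineK //.
    by apply: expect_moment_dist_le; near: n; exists 1%N.
  by near: n.
exact: cvg_cst.
Unshelve. all: by end_near. Qed.

End SmallExponent.

Lemma schatten_norm_lt2 (R : realType) (p : R) : 1 <= p -> p < 2 ->
  whp_asymp_root p (schatten_norm p)
    ((Num.sqrt pi)^-1 * (Gamma (p / 2 + 1 / 2) / Gamma (p / 2 + 2)))
    (fun n => n%:R `^ (p^-1 + 1 / 2)).
Proof.
move=> p1 p2 e e0; have p0 : 0 < p by exact: lt_le_trans p1.
apply: (whp_expect_cvg0 e0 _ (cvg_expect_moment p1 p2)) => //.
near=> n; have n0 : 0 < n%:R :> R by rewrite ltr0n; near: n; exists 1%N.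
move=> G; rewrite (_ : \sum_(x <- _) _ =
  (schatten_norm p G / n%:R `^ (p^-1 + 1 / 2)) `^ p) //.
rewrite /schatten_norm sum_singular_values.
rewrite powRM ?powR_ge0 ?invr_ge0 ?powR_ge0 // -powRrM mulVf ?gt_eqF //.
rewrite powRr1; last by apply: sumr_ge0 => x _; exact: powR_ge0.
rewrite -powRN -powRrM mulr_suml; apply: eq_bigr => x _.
rewrite normrM normfV (ger0_norm (sqrtr_ge0 _)) powRM ?invr_ge0 ?sqrtr_ge0 //.
rewrite -(powR12_sqrt (ltW n0)) -powRN -powRrM.
rewrite (_ : - (p^-1 + 1 / 2) * p = -1 + - 2^-1 * p); last first.
  by field; rewrite gt_eqF.
rewrite powRD ?(gt_eqF n0) ?implybT // powR_inv1 ?(ltW n0) //.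
by rewrite mulrCA.
Unshelve. all: by end_near. Qed.

(** * Exponents from two on *)

Section EdgeDensity.
Variables (R : realType) (n : nat).
Hypothesis n0 : (0 < n)%N.
Implicit Types (G : sgraph n).

Definition edge_density m (H : sgraph m) : R :=
  (\sum_i \sum_j adjmx R H i j) / m%:R ^+ 2.

Let N0 : 0 < n%:R :> R. Proof. by rewrite ltr0n. Qed.

Let Y G : R := \sum_i \sum_(j | j != i) (adjmx R G i j - 1 / 2).

Lemma adjmx_diag G i : adjmx R G i i = 0.
Proof.
rewrite mxE /Defs.adjacent (_ : [set i; i]%SET \in val G = false) //.
apply/negP => iG; have /forall_inP/(_ _ iG) := valP G.
by rewrite finset.setUid cards1.
Qed.

Let sum_off (c : R) : \sum_(i < n) \sum_(j < n | j != i) c = c * (n%:R * (n%:R - 1)).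
Proof.
rewrite (eq_bigr (fun=> c * (n%:R - 1))).
  by rewrite sumr_const card_ord -[LHS]mulr_natr; ring.
move=> i _; rewrite sumr_const cardC1 card_ord -[LHS]mulr_natr; congr (_ * _).
by rewrite -subn1 natrB.
Qed.

(** The correction (2 n)^-1 is due to the n diagonal places, which never carry an edge. *)
Lemma edge_densityE G : edge_density G - 1 / 2 = Y G / n%:R ^+ 2 - (2 * n%:R)^-1.
Proof.
have -> : Y G = \sum_i \sum_j adjmx R G i j - 1 / 2 * (n%:R * (n%:R - 1)).
  rewrite -sum_off -sumrB; apply: eq_bigr => i _.
  by rewrite [in RHS](bigD1 i) //= adjmx_diag add0r sumrB.
by rewrite /edge_density; field; rewrite gt_eqF.
Qed.

Lemma expect_edge_deviation : expect Y = 0.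
Proof.
rewrite expect_sum big1 // => i _; rewrite expect_sum big1 // => j ij.
have := @expect_ibp R n i j (fun=> 1); rewrite eq_sym ij => /(_ isT).
rewrite (@eq_expect _ _ (fun G => (adjmx R G i j - 1 / 2) * 1)
  (fun G => adjmx R G i j - 1 / 2)); last by move=> G; rewrite mulr1.
move=> ->; rewrite (@eq_expect _ _ _ (fun=> 0)) ?expect_cst ?mulr0 //.
by move=> G; rewrite subrr.
Qed.

(** Integration by parts also computes the variance: putting in an edge changes Y by exactly 2, as
    each edge is counted in both orders, so each of the n (n - 1) terms contributes 1/2. *)
Lemma expect_edge_deviation_sqr : expect (fun G => Y G ^+ 2) <= n%:R ^+ 2.
Proof.
have YB (G : sgraph n) i j : i != j ->
    Y (put_edge i j true G) - Y (put_edge i j false G) = 2.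
  move=> ij; rewrite /Y.
  transitivity (\sum_k \sum_(l | l != k) (delta_mx i j + delta_mx j i : 'M[R]_n) k l).
    rewrite -sumrB; apply: eq_bigr => k _; rewrite -sumrB; apply: eq_bigr => l _.
    by rewrite -(adjmx_put_edgeB R G ij) !mxE; ring.
  have d (a b : 'I_n) : a != b ->
      \sum_k \sum_(l | l != k) (delta_mx a b : 'M[R]_n) k l = 1.
    move=> ab; rewrite (bigD1 a) //= (bigD1 b) 1?eq_sym //= mxE !eqxx.
    rewrite big1 ?addr0 => [|l /andP[_ /negbTE lb]]; last by rewrite mxE lb andbF.
    rewrite big1 ?addr0 // => k /negbTE ka; rewrite big1 // => l _.
    by rewrite mxE ka.
  under eq_bigr do under eq_bigr do rewrite mxE.
  under eq_bigr do rewrite big_split.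
  by rewrite big_split /= d // d 1?eq_sym.
have -> : expect (fun G => Y G ^+ 2) = 1 / 2 * (n%:R * (n%:R - 1)).
  rewrite -sum_off.
  transitivity (expect (fun G => \sum_i \sum_(j | j != i)
      (adjmx R G i j - 1 / 2) * Y G)).
    apply: eq_expect => G; rewrite expr2 {1}/Y mulr_suml.
    by apply: eq_bigr => i _; rewrite mulr_suml.
  rewrite expect_sum; apply: eq_bigr => i _; rewrite expect_sum.
  apply: eq_bigr => j ij; rewrite expect_ibp 1?eq_sym //.
  rewrite (@eq_expect _ _ _ (fun=> 2)) ?expect_cst; first by field.
  by move=> G; rewrite YB 1?eq_sym.
have : 1 <= n%:R :> R by rewrite ler1n.
nra.
Qed.

Lemma expect_edge_density : expect (@edge_density n) = 1 / 2 - (2 * n%:R)^-1.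
Proof.
rewrite (@eq_expect _ _ _ (fun G => (n%:R ^+ 2)^-1 * Y G + (1 / 2 - (2 * n%:R)^-1))).
  by rewrite expectD expectZ expect_edge_deviation expect_cst mulr0 add0r.
by move=> G; have := edge_densityE G; rewrite mulrC; lra.
Qed.

Lemma expect_edge_density_dist :
  expect (fun G => `|edge_density G - 1 / 2|) <= 2 / n%:R.
Proof.
apply: (@le_trans _ _ (expect (fun G => (n%:R ^+ 2)^-1 * `|Y G| + (2 * n%:R)^-1))).
  apply: ler_expect => G; rewrite edge_densityE (le_trans (ler_normB _ _)) //.
  have i1 : 0 <= (n%:R ^+ 2)^-1 :> R by rewrite invr_ge0 sqr_ge0.
  have i2 : 0 <= (2 * n%:R)^-1 :> R by rewrite invr_ge0 mulr_ge0.
  by rewrite normrM mulrC (ger0_norm i1) (ger0_norm i2).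
rewrite expectD expectZ expect_cst.
have h : expect (fun G => `|Y G|) <= n%:R.
  rewrite (le_trans (expect_norm_le_sqrt _)) //.
  by rewrite -[leRHS]ger0_norm // -sqrtr_sqr ler_wsqrtr // expect_edge_deviation_sqr.
have := ler_wpM2l (_ : 0 <= (n%:R ^+ 2)^-1 :> R) h.
rewrite invr_ge0 sqr_ge0 => /(_ isT).
have -> : (n%:R ^+ 2)^-1 * n%:R = n%:R^-1 :> R by field; rewrite gt_eqF.
have -> : (2 * n%:R)^-1 = 2^-1 * n%:R^-1 :> R by rewrite invfM.
have : 0 < n%:R^-1 :> R by rewrite invr_gt0.
lra.
Qed.

End EdgeDensity.

Lemma cvg_natV (R : realType) (c : R) : c / n%:R @[n --> \oo] --> (0 : R).
Proof.
rewrite -(mulr0 c); apply: cvgMr; apply/gtr0_cvgV0; last exact: cvgr_idn.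
by near=> n; rewrite ltr0n; near: n; exists 1%N.
Unshelve. all: by end_near. Qed.

Lemma cvg_expect_edge_density (R : realType) :
  expect (fun G : sgraph n => `|edge_density R G - 1 / 2|) @[n --> \oo] --> (0 : R).
Proof.
apply: (@squeeze_cvgr _ _ _ _ (fun=> 0) (fun n => 2 / n%:R)) => //.
- near=> n; rewrite expect_ge0 //=; apply: expect_edge_density_dist.
  by near: n; exists 1%N.
- exact: cvg_cst.
- exact: cvg_natV.
Unshelve. all: by end_near. Qed.

Lemma schatten_norm_eq2 (R : realType) :
  whp_asymp (schatten_norm (2 : R)) (Num.sqrt 2)^-1 (fun n => n%:R).
Proof.
(* With q = 1 / sqrt 2 >= 1/2, |s^2 - q^2| = |s - q| (s + q) >= |s - q| / 2, so a deviation e / 2 of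
   the density suffices. *)
move=> e e0; have e2 : 0 < e / 2 by rewrite divr_gt0.
apply: (whp_expect_cvg0 e2 _ (@cvg_expect_edge_density R)) => //.
near=> n; have n0 : 0 < n%:R :> R by rewrite ltr0n; near: n; exists 1%N.
move=> G /= De.
have D0 : 0 <= edge_density R G.
  rewrite divr_ge0 ?sqr_ge0 //; apply: sumr_ge0 => i _; apply: sumr_ge0 => j _.
  by rewrite mxE.
have -> : schatten_norm 2 G / n%:R = Num.sqrt (edge_density R G).
  rewrite /schatten_norm sum_singular_values.
  under eq_bigr do rewrite powR_mulrn ?normr_ge0 // real_normK ?num_real //.
  rewrite sum_eigenvalues_sqr ?adjmx_sym // mxtrace_adjmx_sqr.
  have S0 : 0 <= \sum_i \sum_j adjmx R G i j.
    by apply: sumr_ge0 => i _; apply: sumr_ge0 => j _; rewrite mxE.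
  rewrite powR12_sqrt // /edge_density [RHS]sqrtrM // sqrtrV ?sqr_ge0 //.
  by rewrite sqrtr_sqr ger0_norm // ltW.
set s := Num.sqrt (edge_density R G); have s0 : 0 <= s by exact: sqrtr_ge0.
have q2 : (Num.sqrt 2)^-1 ^+ 2 = 1 / 2 :> R by rewrite exprVn sqr_sqrtr // div1r.
have q0 : 0 < (Num.sqrt 2)^-1 :> R by rewrite invr_gt0 sqrtr_gt0.
move: De; rewrite -(sqr_sqrtr D0) -/s -q2; set q := (Num.sqrt 2)^-1 in q2 q0 *.
have q12 : 1 / 2 <= q by nra.
rewrite subr_sqr normrM (ger0_norm (addr_ge0 s0 (ltW q0))) => h.
have := normr_ge0 (s - q); nra.
Unshelve. all: by end_near. Qed.

(** * Expected number of closed walks of length four *)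

Section FourthMoment.
Variables (R : realType) (n : nat).
Implicit Types (G : sgraph n) (i j k l : 'I_n).
Local Notation A := (adjmx R).

(** The second hypothesis says that [f] does not depend on the edge ij; the product rule for
    independent factors is then integration by parts with zero difference. *)
Lemma expect_adjmx_mul i j (f : sgraph n -> R) : i != j ->
  (forall G, f (put_edge i j true G) = f (put_edge i j false G)) ->
  expect (fun G => A G i j * f G) = 1 / 2 * expect f.
Proof.
move=> ij fij; have := expect_ibp f ij.
rewrite [in RHS](@eq_expect _ _ _ (fun=> 0)) ?expect_cst ?mulr0; last first.
  by move=> G; rewrite fij subrr.
rewrite (@eq_expect _ _ _ (fun G => A G i j * f G - 1 / 2 * f G)); last first.
  by move=> G; rewrite mulrBl.
by rewrite expectB expectZ => /eqP; rewrite subr_eq0 => /eqP.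
Qed.

Let cyc i j k l G := A G i j * (A G j k * (A G k l * A G l i)).

Let A_put i j b G k l : i != j ->
  ~~ ((k == i) && (l == j) || (k == j) && (l == i)) ->
  A (put_edge i j b G) k l = A G k l.
Proof. by move=> ij kl; rewrite adjmx_put_edge // set2_eqE. Qed.

Lemma expect_cycle4 i j k l : i != j -> j != k -> k != l -> l != i ->
  i != k -> j != l -> expect (cyc i j k l) = 1 / 16.
Proof.
move=> ij jk kl li ik jl.
have ne := (negbTE ij, negbTE jk, negbTE kl, negbTE li, negbTE ik, negbTE jl).
have ne' := (eq_sym j i, eq_sym k j, eq_sym l k, eq_sym i l, eq_sym k i,
  eq_sym l j).
rewrite /cyc expect_adjmx_mul //; last first.
  by move=> G; rewrite !A_put // ?ne ?ne' ?ne ?andbF.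
rewrite expect_adjmx_mul //; last first.
  by move=> G; rewrite !A_put // ?ne ?ne' ?ne ?andbF.
rewrite expect_adjmx_mul //; last first.
  by move=> G; rewrite !A_put // ?ne ?ne' ?ne ?andbF.
rewrite (@eq_expect _ _ _ (fun G => A G l i * 1)); last by move=> G; rewrite mulr1.
by rewrite expect_adjmx_mul // expect_cst; field.
Qed.

Let A01 G i j : 0 <= A G i j <= 1.
Proof. by rewrite mxE ler0n lern1 leq_b1. Qed.

(** If i = k or j = l, the trivial bound 1 is used. Otherwise the walk either has a loop and
    contributes 0, or visits four distinct vertices and uses four independent edges. Degenerate
    walks thus cost only order n^3 in the sum. *)
Lemma expect_cycle4_le i j k l :
  expect (cyc i j k l) <= 1 / 16 + (i == k)%:R + (j == l)%:R.
Proof.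
have c1 G : cyc i j k l G <= 1.
  have /andP[a0 a1] := A01 G i j; have /andP[b0 b1] := A01 G j k.
  have /andP[d0 d1] := A01 G k l; have /andP[e0 e1] := A01 G l i.
  by rewrite /cyc !mulr_ile1 ?mulr_ge0.
have le1 : expect (cyc i j k l) <= 1.
  by rewrite -[leRHS](expect_cst n) ler_expect.
case: (eqVneq i k) => ik; first by rewrite (le_trans le1) //; case: (j == l) => /=; lra.
case: (eqVneq j l) => jl; first by rewrite (le_trans le1) //=; lra.
rewrite /= !addr0.
have z (P : (forall G, cyc i j k l G = 0)) : expect (cyc i j k l) <= 1 / 16.
  by rewrite (@eq_expect _ _ _ (fun=> 0)) ?expect_cst; [lra|exact: P].
have [ij|ij] := eqVneq i j.
  by apply: z => G; rewrite /cyc ij adjmx_diag mul0r.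
have [jk|jk] := eqVneq j k.
  by apply: z => G; rewrite /cyc jk adjmx_diag mul0r mulr0.
have [kl|kl] := eqVneq k l.
  by apply: z => G; rewrite /cyc kl adjmx_diag mul0r !mulr0.
have [li|li] := eqVneq l i.
  by apply: z => G; rewrite /cyc li adjmx_diag !mulr0.
by rewrite expect_cycle4.
Qed.

Lemma expect_tr4_le :
  expect (fun G => \tr (A G *m A G *m (A G *m A G))) <=
  n%:R ^+ 4 / 16 + 2 * n%:R ^+ 3.
Proof.
have trE G : \tr (A G *m A G *m (A G *m A G)) =
    \sum_i \sum_k \sum_j \sum_l cyc i j k l G.
  apply: eq_bigr => i _; rewrite mxE; apply: eq_bigr => k _.
  rewrite mxE mulr_suml; apply: eq_bigr => j _; rewrite [X in _ * X]mxE mulr_sumr.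
  by apply: eq_bigr => l _; rewrite /cyc !mulrA.
rewrite (eq_expect trE) expect_sum.
apply: (@le_trans _ _ (\sum_(i < n) \sum_(k < n) \sum_(j < n) \sum_(l < n)
    (1 / 16 + (i == k)%:R + (j == l)%:R))).
  apply: ler_sum => i _; rewrite expect_sum; apply: ler_sum => k _.
  rewrite expect_sum; apply: ler_sum => j _; rewrite expect_sum.
  by apply: ler_sum => l _; exact: expect_cycle4_le.
have s1 (c : R) : \sum_(i < n) c = n%:R * c.
  by rewrite sumr_const card_ord mulr_natl.
have s2 (j : 'I_n) : \sum_(l < n) ((j == l)%:R : R) = 1.
  rewrite (bigD1 j) //= eqxx big1 ?addr0 // => l /negbTE lj.
  by rewrite eq_sym lj.
under eq_bigr => i _ do under eq_bigr => k _ do under eq_bigr => j _ do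
  rewrite big_split /= s1 s2.
under eq_bigr => i _ do under eq_bigr => k _ do rewrite s1.
under eq_bigr => i _ do rewrite -mulr_sumr big_split /= s1 -mulr_sumr big_split /= s1 s2.
rewrite s1 le_eqVlt; apply/orP; left; apply/eqP; by field.
Qed.

End FourthMoment.

Definition tr4_density (R : realType) (n : nat) (G : sgraph n) : R :=
  \tr (adjmx R G *m adjmx R G *m (adjmx R G *m adjmx R G)) / n%:R ^+ 4.

Definition gap4 (R : realType) (n : nat) (G : sgraph n) : R :=
  tr4_density R G - edge_density R G ^+ 4.

Section LargeExponent.
Variables (R : realType) (p : R).
Hypothesis p2 : 2 < p.
Implicit Types (n : nat).

Let p0 : 0 < p. Proof. exact: lt_trans p2. Qed.

Section Deterministic.
Variables (n : nat) (G : sgraph n).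
Hypothesis n0 : (0 < n)%N.

Let N0 : 0 < n%:R :> R. Proof. by rewrite ltr0n. Qed.
Let es := eigenvalues (adjmx R G).
Let y (x : R) := `|x| / n%:R.

Let y0 x : 0 <= y x. Proof. by rewrite divr_ge0. Qed.

Let y4 x : y x ^+ 4 = x ^+ 4 / n%:R ^+ 4.
Proof.
by rewrite expr_div_n -[4%N]/(2 * 2)%N exprM real_normK ?num_real // -!exprM.
Qed.

Lemma edge_density_ge0 : 0 <= edge_density R G.
Proof.
rewrite divr_ge0 ?sqr_ge0 //; apply: sumr_ge0 => i _; apply: sumr_ge0 => j _.
by rewrite mxE.
Qed.

(* The top eigenvalue dominates the edge density, so [gap4] bounds the fourth
   powers of all other normalised eigenvalues. *)
Lemma eigenvalue_split : exists2 x0, x0 \in es &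
  [/\ edge_density R G <= y x0, y x0 ^+ 4 <= tr4_density R G &
      forall x, x \in rem x0 es -> y x ^+ 4 <= gap4 R G].
Proof.
have [x0 x0e Ax0] := exists_eigenvalue_ge_mean (adjmx_sym R G) n0.
exists x0 => //.
have T4 : tr4_density R G = y x0 ^+ 4 + \sum_(x <- rem x0 es) y x ^+ 4.
  rewrite /tr4_density -sum_eigenvalues_exp4 ?adjmx_sym // mulr_suml.
  rewrite (big_rem x0) //= y4; congr (_ + _).
  by apply: eq_bigr => x _; rewrite y4.
have s0 : 0 <= \sum_(x <- rem x0 es) y x ^+ 4.
  by apply: sumr_ge0 => x _; rewrite exprn_ge0.
have D1 : edge_density R G <= y x0.
  apply: (@le_trans _ _ (x0 / n%:R)).
    rewrite /edge_density ler_pdivrMr ?exprn_gt0 // (le_trans Ax0) //.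
    by rewrite expr2 mulrA divfK ?gt_eqF // mulrC.
  by rewrite ler_pM2r ?invr_gt0 // ler_norm.
split=> //; first by rewrite T4 lerDl.
move=> x xr; rewrite /gap4 T4.
have D4 : edge_density R G ^+ 4 <= y x0 ^+ 4.
  by rewrite lerXn2r ?nnegrE ?edge_density_ge0.
apply: (@le_trans _ _ (\sum_(x <- rem x0 es) y x ^+ 4)); last by lra.
by rewrite (big_rem x) //= lerDl sumr_ge0 // => z _; rewrite exprn_ge0.
Qed.

Lemma gap4_ge0 : 0 <= gap4 R G.
Proof.
have [x0 _ [D1 D2 _]] := eigenvalue_split; rewrite subr_ge0 (le_trans _ D2) //.
by rewrite lerXn2r ?nnegrE ?edge_density_ge0.
Qed.

Lemma schatten_norm_divn : schatten_norm p G / n%:R = (\sum_(x <- es) y x `^ p) `^ p^-1.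
Proof.
rewrite /schatten_norm sum_singular_values.
have -> : n%:R^-1 = ((n%:R^-1) `^ p) `^ p^-1 :> R.
  by rewrite -powRrM mulfV ?gt_eqF // powRr1 ?invr_ge0.
rewrite -powRM ?powR_ge0 //; last by apply: sumr_ge0 => x _; exact: powR_ge0.
rewrite mulr_suml; congr (_ `^ _); apply: eq_bigr => x _.
by rewrite -powRM ?invr_ge0.
Qed.

(** The norm is at least its top term, hence at least the density. From above, the top term stays
    below 1/2 + e/2 and the last hypothesis lets all other terms fit between the p-th powers of 1/2
    + e/2 and 1/2 + e. *)
Lemma schatten_norm_gt2_bound (e : R) : 0 < e ->
  `|edge_density R G - 1 / 2| < e / 8 -> gap4 R G < e / 8 ->
  (gap4 R G `^ 4^-1) `^ (p - 2) < (1 / 2 + e) `^ p - (1 / 2 + e / 2) `^ p ->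
  `|schatten_norm p G / n%:R - 1 / 2| < e.
Proof.
move=> e0 De Qe Qp; rewrite schatten_norm_divn.
have [x0 x0e [D1 D2 Hr]] := eigenvalue_split.
have D0 := edge_density_ge0.
have sE : \sum_(x <- es) y x `^ p = y x0 `^ p + \sum_(x <- rem x0 es) y x `^ p.
  by rewrite (big_rem x0).
have r0 : 0 <= \sum_(x <- rem x0 es) y x `^ p.
  by apply: sumr_ge0 => x _; exact: powR_ge0.
have lower : y x0 <= (\sum_(x <- es) y x `^ p) `^ p^-1.
  have pV : p * p^-1 = 1 by rewrite mulfV ?gt_eqF.
  rewrite -[leLHS](powRr1 (y0 x0)) -pV powRrM.
  apply: ge0_ler_powR; rewrite ?nnegrE ?invr_ge0 ?(ltW p0) ?powR_ge0 //.
    by apply: sumr_ge0 => x _; exact: powR_ge0.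
  by rewrite sE lerDl.
have x0le : y x0 <= 1 / 2 + e / 2.
  rewrite leNgt; apply/negP => h.
  have h4 : (1 / 2 + e / 2) ^+ 4 <= y x0 ^+ 4.
    by rewrite lerXn2r ?nnegrE ?(ltW h) //; lra.
  have D4 : edge_density R G ^+ 4 <= (1 / 2 + e / 8) ^+ 4.
    by move: De; rewrite ltr_norml => /andP[_ ?]; rewrite lerXn2r ?nnegrE //; lra.
  (* The linear terms already suffice: 4 (1/2)^3 (e/2 - e/8) = 3 e / 16, which exceeds e / 8. *)
  have : (1 / 2 + e / 8) ^+ 4 + e / 8 <= (1 / 2 + e / 2) ^+ 4.
    have e2 : 0 <= e ^+ 2 by rewrite sqr_ge0.
    have e3 : 0 <= e ^+ 3 by rewrite exprn_ge0 // ltW.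
    have e4 : 0 <= e ^+ 4 by rewrite exprn_ge0 // ltW.
    nra.
  by move: Qe D2; rewrite /gap4; lra.
(* Write y^p = y^(p-2) y^2: the first factor is uniformly small by [gap4], and the squares sum to at
   most 1. *)
have upper : \sum_(x <- rem x0 es) y x `^ p <= (gap4 R G `^ 4^-1) `^ (p - 2).
  apply: (@le_trans _ _ (\sum_(x <- rem x0 es)
      (gap4 R G `^ 4^-1) `^ (p - 2) * y x ^+ 2)).
    rewrite !big_seq; apply: ler_sum => x xr.
    have yx : y x <= gap4 R G `^ 4^-1.
      rewrite -[leLHS](powRr1 (y0 x)) -[X in _ `^ X](@mulfV _ 4%:R) //.
      rewrite powRrM powR_mulrn //.
      by apply: ge0_ler_powR; rewrite ?nnegrE ?gap4_ge0 ?exprn_ge0 ?Hr.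
    have -> : y x `^ p = y x `^ (p - 2) * y x ^+ 2.
      by rewrite -powR_mulrn // -powRD subrK // (gt_eqF p0).
    rewrite ler_wpM2r ?sqr_ge0 //.
    by apply: ge0_ler_powR; rewrite ?nnegrE ?powR_ge0 // subr_ge0 ltW.
  rewrite -mulr_sumr -[leRHS]mulr1 ler_wpM2l ?powR_ge0 //.
  apply: (@le_trans _ _ (\sum_(x <- es) y x ^+ 2)).
    by rewrite [leRHS](big_rem x0) //= lerDr sqr_ge0.
  under eq_bigr do rewrite expr_div_n real_normK ?num_real //.
  rewrite -mulr_suml ler_pdivrMr ?exprn_gt0 // mul1r.
  exact: sum_eigenvalues_sqr_le.
have s_lt : \sum_(x <- es) y x `^ p < (1 / 2 + e) `^ p.
  have : y x0 `^ p <= (1 / 2 + e / 2) `^ p.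
    by apply: ge0_ler_powR; rewrite ?nnegrE ?(ltW p0) //; lra.
  by rewrite sE; lra.
have : (\sum_(x <- es) y x `^ p) `^ p^-1 < 1 / 2 + e.
  have e1 : 0 <= 1 / 2 + e by lra.
  have pV : p * p^-1 = 1 by rewrite mulfV ?gt_eqF.
  have -> : 1 / 2 + e = ((1 / 2 + e) `^ p) `^ p^-1 by rewrite -powRrM pV powRr1.
  apply: gt0_ltr_powR; rewrite ?nnegrE ?invr_gt0 ?powR_ge0 //.
  by apply: sumr_ge0 => x _; exact: powR_ge0.
move=> h; move: De; rewrite !ltr_norml => /andP[? ?]; apply/andP; split; lra.
Qed.

End Deterministic.

Lemma expect_gap4_le n : (0 < n)%N -> expect (@gap4 R n) <= 3 / n%:R.
Proof.
move=> n0; have N0 : 0 < n%:R :> R by rewrite ltr0n.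
(* Tangent line of D^4 at 1/2. It bounds the expected fourth power below through the mean density
   1/2 - (2 n)^-1 alone, at a loss of 1 / (4 n). *)
have tan (D : R) : 1 / 16 + 1 / 2 * (D - 1 / 2) <= D ^+ 4.
  have : 0 <= (D - 1 / 2) ^+ 2 * ((D + 1 / 2) ^+ 2 + 1 / 2).
    by rewrite mulr_ge0 ?sqr_ge0 // addr_ge0 ?sqr_ge0.
  rewrite (_ : _ * _ = D ^+ 4 - (1 / 16 + 1 / 2 * (D - 1 / 2))); last by field.
  by rewrite subr_ge0.
apply: (@le_trans _ _ (expect (fun G : sgraph n => (n%:R ^+ 4)^-1 *
   \tr (adjmx R G *m adjmx R G *m (adjmx R G *m adjmx R G)) -
   ((- 3 / 16) + 1 / 2 * (edge_density R G) + 0)))).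
  apply: ler_expect => G; rewrite /gap4 /tr4_density mulrC.
  by have := tan (edge_density R G); lra.
rewrite expectB expectD expectZ expectD !expect_cst expectZ expect_edge_density //.
have := ler_wpM2l (_ : 0 <= (n%:R ^+ 4)^-1 :> R) (expect_tr4_le R n).
rewrite invr_ge0 exprn_ge0 // => /(_ isT) h.
have E : (n%:R ^+ 4)^-1 * (n%:R ^+ 4 / 16 + 2 * n%:R ^+ 3) =
    1 / 16 + 2 * n%:R^-1 :> R by field; rewrite gt_eqF.
have E2 : (2 * n%:R)^-1 = 2^-1 * n%:R^-1 :> R by rewrite invfM.
rewrite E in h; rewrite E2.
have : 0 < n%:R^-1 :> R by rewrite invr_gt0.
by move: h; set ET := expect _; lra.
Qed.

Lemma schatten_norm_gt2 :
  whp_asymp (schatten_norm p) (1 / 2) (fun n => n%:R).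
Proof.
move=> e e0.
pose X n (G : sgraph n) : R := `|edge_density R G - 1 / 2| + `|gap4 R G|.
pose g := (1 / 2 + e) `^ p - (1 / 2 + e / 2) `^ p.
have g0 : 0 < g.
  by rewrite subr_gt0; apply: gt0_ltr_powR; rewrite ?nnegrE //; lra.
(* The second argument makes a gap below d satisfy gap^((p - 2) / 4) <= g / 2 < g. *)
pose d := Num.min (e / 8) ((g / 2) `^ (4 / (p - 2))).
have d0 : 0 < d by rewrite lt_min divr_gt0 //= powR_gt0 // divr_gt0.
have q0 : 0 < p - 2 by rewrite subr_gt0.
have EX : expect (@X n) @[n --> \oo] --> (0 : R).
  have c0 : expect (fun G : sgraph n => `|edge_density R G - 1 / 2|) + 3 / n%:R
      @[n --> \oo] --> (0 : R).
    rewrite -[X in _ --> X]addr0; apply: cvgD; first exact: cvg_expect_edge_density.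
    exact: cvg_natV.
  apply: (@squeeze_cvgr _ _ _ _ (fun=> 0) (fun n =>
    expect (fun G : sgraph n => `|edge_density R G - 1 / 2|) + 3 / n%:R)) => //.
    near=> n; have n0 : (0 < n)%N by near: n; exists 1%N.
    rewrite expect_ge0 => [|G]; last by rewrite addr_ge0.
    rewrite /X expectD lerD2l (le_trans _ (expect_gap4_le n0)) //.
    by apply: ler_expect => G; rewrite ger0_norm // gap4_ge0.
  exact: cvg_cst.
apply: (whp_expect_cvg0 d0 _ EX) => [n G|]; first by rewrite addr_ge0.
near=> n; have n0 : (0 < n)%N by near: n; exists 1%N.
move=> G XG.
have Q0 := gap4_ge0 G n0.
have D0 := normr_ge0 (edge_density R G - 1 / 2).
move: XG; rewrite /X (ger0_norm Q0) lt_min => /andP[h1 h2].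
apply: schatten_norm_gt2_bound => //; [lra|lra|].
rewrite -/g -powRrM.
apply: (@le_lt_trans _ _ (g / 2)); last by rewrite ltr_pdivrMr // ltr_pMr // ltr1n.
have -> : g / 2 = ((g / 2) `^ (4 / (p - 2))) `^ (4^-1 * (p - 2)).
  rewrite -powRrM (_ : 4 / _ * _ = 1) ?powRr1 ?divr_ge0 ?ltW //.
  by field; rewrite gt_eqF.
apply: ge0_ler_powR; rewrite ?nnegrE ?powR_ge0 //.
  by rewrite mulr_ge0 // ltW.
by lra.
Unshelve. all: by end_near. Qed.

End LargeExponent.

Theorem theorem5 (R : realType) (p : R) (hp : 1 <= p) :
  (p < 2 ->
    whp_asymp_root p (schatten_norm p)
      ((Num.sqrt pi)^-1 * (Gamma (p / 2 + 1 / 2) / Gamma (p / 2 + 2)))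
      (fun n => n%:R `^ (p^-1 + 1 / 2))) /\
  (p = 2 ->
    whp_asymp (schatten_norm p) (Num.sqrt 2)^-1 (fun n => n%:R)) /\
  (2 < p ->
    whp_asymp (schatten_norm p) (1 / 2) (fun n => n%:R)).
Proof.
split; first exact: schatten_norm_lt2.
by split=> [->|]; [exact: schatten_norm_eq2|exact: schatten_norm_gt2].
Qed.
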